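(* Let $\mathcal P$ be an Apollonian circle packing in $\hat{\mathbb C}$, let $C_0=\partial B(z_0,r_0)\in\mathcal P$ be a bounded circle of the packing whose open disk $B(z_0,r_0)$ contains no other circle of $\mathcal P$, and let $\mathcal P_0$ denote the union of the disks $D_i$ bounded by the circles $C_i\in\mathcal P$ tangent to $C_0$. Let $C_1\in\mathcal P$ be a circle tangent to $C_0$ and let $w_0$ be the point of tangency of $C_0$ and $C_1$. For $0<\epsilon<1$, let $\tilde C_\epsilon$ be the circle of radius $r_0+\epsilon$ which passes through $w_0$, is tangent there to $C_0$ and $C_1$, and contains $C_0$ (i.e. encloses the disk bounded by $C_0$). Let $\tilde\mu_\epsilon$ be the Lebesgue (arc-length) probability measure on $\tilde C_\epsilon$. Then $$\lim_{\epsilon\to0}\tilde\mu_\epsilon(\mathcal P_0)=\frac{3}{\pi}.$$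
   Context: An Apollonian circle packing (ACP) is obtained by starting with three mutually tangent circles $C_1,C_2,C_3\subset\hat{\mathbb C}=\mathbb C\cup\{\infty\}$ (circles through $\infty$ being straight lines), adding the two circles tangent to all three, and then inductively, for every triple of mutually tangent circles already constructed, adding the remaining circle tangent to all three. For a circle $C_i$ of the packing, its disk $D_i$ is the open component of $\hat{\mathbb C}\setminus C_i$ (a disk, half-plane, or exterior of a disk) that contains no other circle of the packing. *)

(* Defs.v *)
From HB Require Import structures.
From mathcomp Require Import all_boot all_order all_algebra.
From mathcomp Require Import complex.
From mathcomp Require Import all_classical all_reals all_analysis.

Set Implicit Arguments.
Unset Strict Implicit.
Unset Printing Implicit Defensive.

Import Order.TTheory GRing.Theory Num.Theory.
Import numFieldNormedType.Exports.

Local Open Scope classical_set_scope.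
Local Open Scope ring_scope.
Local Open Scope complex_scope.

(* The Riemann sphere: [None] is the point at infinity. *)
Definition sphere_pt (R : realType) : Type := option R[i].

Section Circles.
Variable R : realType.
Local Notation Chat := (sphere_pt R).
Implicit Types (z w : R[i]) (r a b c : R) (p : Chat) (C D : set Chat).

(* Real-valued modulus; [`| _ |] on [R[i]] takes its values in [R[i]]. *)
Definition cdist z w : R := ComplexField.Normc.normc (w - z).

Definition round_circle z r : set Chat :=
  [set Some w | w in [set w | cdist z w = r]].

Definition round_disk z r : set Chat :=
  [set Some w | w in [set w | cdist z w < r]].

Definition round_exterior z r : set Chat :=
  None |` [set Some w | w in [set w | r < cdist z w]].

Definition line a b c : set Chat :=
  None |` [set Some w | w in [set w | a * complex.Re w + b * complex.Im w = c]].

Definition half_plane a b c : set Chat :=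
  [set Some w | w in [set w | a * complex.Re w + b * complex.Im w < c]].

Definition is_circle C : Prop :=
  (exists z r, 0 < r /\ C = round_circle z r) \/
  (exists a b c, (a, b) <> (0, 0) /\ C = line a b c).

(* [D] is one of the two connected components of the complement of the circle
   [C].  The half-plane on the other side of [line a b c] is
   [half_plane (- a) (- b) (- c)], and [line (- a) (- b) (- c)] is the same
   set as [line a b c], so [side_line] yields both. *)
Inductive side_of : set Chat -> set Chat -> Prop :=
| side_inner z r : 0 < r -> side_of (round_circle z r) (round_disk z r)
| side_outer z r : 0 < r -> side_of (round_circle z r) (round_exterior z r)
| side_line a b c : (a, b) <> (0, 0) ->
    side_of (line a b c) (half_plane a b c).

(* On the sphere two circles are tangent iff they meet in exactly one point;
   for parallel lines this point is [None]. *)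
Definition tangent_at (p : Chat) C C' : Prop := C `&` C' = [set p].

Definition tangent C C' : Prop := exists p : Chat, tangent_at p C C'.

(* Three circles tangent at one common point (e.g. three parallel lines) are
   excluded: only for distinct tangency points are there exactly two circles
   tangent to all three. *)
Definition mutually_tangent C1 C2 C3 : Prop :=
  [/\ tangent C1 C2, tangent C2 C3, tangent C1 C3 & C1 `&` C2 `&` C3 = set0].

Inductive generated (C1 C2 C3 : set Chat) : set (set Chat) :=
| generated_1 : generated C1 C2 C3 C1
| generated_2 : generated C1 C2 C3 C2
| generated_3 : generated C1 C2 C3 C3
| generated_step A1 A2 A3 A :
    generated C1 C2 C3 A1 -> generated C1 C2 C3 A2 -> generated C1 C2 C3 A3 ->
    mutually_tangent A1 A2 A3 ->
    is_circle A -> tangent A A1 -> tangent A A2 -> tangent A A3 ->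
    generated C1 C2 C3 A.

Definition apollonian_packing (P : set (set Chat)) : Prop :=
  exists C1 C2 C3,
    [/\ is_circle C1, is_circle C2, is_circle C3,
        mutually_tangent C1 C2 C3 & P = generated C1 C2 C3].

Definition no_other_circle (P : set (set Chat)) C D : Prop :=
  forall C', P C' -> C' <> C -> ~ (C' `<=` D).

Definition disk_of (P : set (set Chat)) C D : Prop :=
  side_of C D /\ no_other_circle P C D.

Definition tangent_disks (P : set (set Chat)) (C0 : set Chat) : set Chat :=
  [set x | exists C D, [/\ P C, tangent C C0, disk_of P C D & D x]].

Definition circle_pt z r (t : R) : R[i] := z + r%:C * (cos t +i* sin t).

(* Normalised arc length on the circle with centre [z] and radius [r]: the
   image of the uniform distribution on [[0, 2 pi[] by [circle_pt z r]. *)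
Definition arc_prob z r (A : set Chat) : \bar R :=
  (lebesgue_measure
     ([set t : R | 0 <= t < pi *+ 2 /\ A (Some (circle_pt z r t))]%R : set R)
   * ((pi *+ 2)^-1)%:E)%E.

End Circles.

(* Main.v *)
Require Import Defs.
From HB Require Import structures.
From mathcomp Require Import all_boot all_order all_algebra.
From mathcomp Require Import complex.
From mathcomp Require Import all_classical all_reals all_analysis.
From mathcomp Require Import measurable_realfun ring lra zify.

Import Order.TTheory GRing.Theory Num.Theory.
Import numFieldNormedType.Exports.

Local Open Scope classical_set_scope.
Local Open Scope ring_scope.

Set Implicit Arguments.
Unset Strict Implicit.
Unset Printing Implicit Defensive.

(* A circle is a unit vector of the Lorentz form of signature (3,1), and points of the sphere
   are null vectors. A Descartes configuration is a frame with Gram matrix 2 I - J, and the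
   packing is the orbit of such a frame under swaps of one circle. Along a path of swaps
   without backtracking, the pairing with a fixed vector grows, so distinct circles of the
   orbit pair to at most -1; hence their disks are disjoint, and a tangent pair belongs to a
   common frame.

   Send the tangency point w0 to infinity, C0 to the real line and C1 to the line Im z = 1.
   The other circles tangent to C0 become the Ford circles at the reduced fractions p / q, and
   the circle of radius r0 + e becomes the horizontal line at a height h = O(e), carrying the
   image of arc length, whose density is proportional to 1 / (1 + ((x - a) / b)^2).

   Let D(r) be the angular measure of the x such that |q (x + i h) - p|^2 < r h for some
   coprime p, q. The non-zero vectors satisfying this are multiples of one primitive vector,
   so counting all of them with q > 0 gives sum_k D(r / k^2). That count is a Riemann sum
   for the area of a disk, and tends to pi^2 r as h tends to 0. Since
   sum_(k >= 2) 1 / k^2 < 1, the relation can be inverted in the limit: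
   D(r) tends to (pi^2 / zeta(2)) r = 6 r, and D(1) / (2 pi) tends to 3 / pi. *)

(** * Lattice sums *)

(** Two obstacles shape the argument. A circle determines its Lorentz vector only up to sign,
    whereas tangency with disjoint disks is the value -1 of the form. Signs must therefore be fixed
    coherently on the whole orbit. A time orientation does this, and the condition that a disk
    contain no other circle then selects the right sign. On the analytic side, the coprime fractions
    carry no periodic pattern and the angular measure is not translation invariant. For fixed q,
    however, the admissible x for all p together are windows repeated with period 1 / q, and over
    one period the density changes only by a factor 1 + O(1 / q). Hence the count over all lattice
    vectors needs only a comparison of each window with its period, and the arithmetic is confined
    to the inversion at the end. That inversion starts from a bound D(r) = O(r) that is uniform in
    h, and shrinks the error |D(r) - 6 r| / r by a fixed factor at each round. *)

Lemma is_derive_ge0_le (R : realType) (f df : R -> R) (a b : R) : a <= b ->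
  (forall x : R, is_derive x 1 f (df x)) ->
  (forall x, a <= x <= b -> 0 <= df x) -> f a <= f b.
Proof.
move=> ab fd dfge0.
have cf : {within `[a, b], continuous f}.
  apply: continuous_subspaceT => x; apply: differentiable_continuous.
  by apply/derivable1_diffP; have [] := fd x.
have [c /itvP cab e] := MVT_segment ab (fun x _ => fd x) cf.
by rewrite -subr_ge0 e mulr_ge0 ?subr_ge0// dfge0// !cab.
Qed.

Section QuarterDisk.
Variable R : realType.
Implicit Types (A B X : R).

(** The area under the unit circle over [0, sin t]. Its derivative is cos t ^ 2, so slices of the
    disk can be compared with rectangles by monotonicity, without integrals. *)
Let Phi (t : R) : R := (t + sin t * cos t) / 2.

Let Phi_le A B : 0 <= A -> A <= B -> B <= pi / 2 ->
  Phi B - Phi A <= (sin B - sin A) * cos A.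
Proof.
move=> A0 AB Bpi.
pose f t := (sin t - sin A) * cos A - Phi t.
have fd (t : R) : is_derive t 1 f (cos t * cos A - cos t ^+ 2).
  by rewrite /f; apply: is_derive_eq; rewrite /GRing.scale/=; have := cos2Dsin2 t; lra.
suff : f A <= f B by rewrite /f subrr; lra.
apply: (is_derive_ge0_le AB fd) => x /andP[Ax xB].
have cx : 0 <= cos x by apply: cos_ge0_pihalf; have := pi_ge0 R; lra.
rewrite expr2 -mulrBr mulr_ge0// subr_ge0.
by rewrite leNgt ltr_cos -?leNgt// in_itv/=; have := pi_ge0 R; lra.
Qed.

Let Phi_ge A B : 0 <= A -> A <= B -> B <= pi / 2 ->
  (sin B - sin A) * cos B <= Phi B - Phi A.
Proof.
move=> A0 AB Bpi.
pose f t := Phi t - sin t * cos B.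
have fd (t : R) : is_derive t 1 f (cos t ^+ 2 - cos t * cos B).
  by rewrite /f; apply: is_derive_eq; rewrite /GRing.scale/=; have := cos2Dsin2 t; lra.
suff : f A <= f B by rewrite /f; lra.
apply: (is_derive_ge0_le AB fd) => x /andP[Ax xB].
have cx : 0 <= cos x by apply: cos_ge0_pihalf; have := pi_ge0 R; lra.
rewrite expr2 -mulrBr mulr_ge0// subr_ge0.
by rewrite leNgt ltr_cos -?leNgt// in_itv/=; have := pi_ge0 R; lra.
Qed.

(** The summand decreases in q, so the sum is a right-endpoint sum below the area of the quarter
    disk. Adding the term q = 0, which is X, gives the left-endpoint sum, above the area. Terms with
    q > X vanish because [Num.sqrt] is 0 on negative numbers. *)
Lemma sum_sqrt_quarter_disk X (Q : nat) : 0 < X -> X <= Q%:R ->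
  X ^+ 2 * (pi / 4) - X <= \sum_(1 <= q < Q.+1) Num.sqrt (X ^+ 2 - q%:R ^+ 2)
  <= X ^+ 2 * (pi / 4).
Proof.
move=> X0 XQ.
(* The subdivision q / X of [0, 1] in the angle variable. Cutting at 1 sends every q >= X to pi / 2,
   where the slices are empty. *)
pose a (q : nat) : R := asin (Num.min (q%:R / X) 1).
have mi q : -1 <= Num.min (q%:R / X) 1 <= 1.
  rewrite le_min ge_min lexx orbT andbT; apply/andP; split; last lra.
  by rewrite (@le_trans _ _ 0)// ?divr_ge0 ?(ltW X0)//; lra.
have sa q : sin (a q) = Num.min (q%:R / X) 1 by rewrite asinK// in_itv/=.
have a_le q : a q <= pi / 2 by apply: asin_lepi2.
have a_mono q : a q <= a q.+1.
  have I q' : a q' \in `[- (pi/2), pi/2]%R.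
    by rewrite in_itv/= asin_geNpi2// a_le.
  rewrite leNgt -ltr_sin ?I// !sa -leNgt le_min ge_min ge_min lexx orbT andbT.
  by rewrite ler_pM2r ?invr_gt0// ler_nat leqnSn.
have a0 : a 0 = 0.
  rewrite /a mul0r min_l//.
  by rewrite -[in LHS](@sin0 R) sinK// in_itv/=; have := pi_ge0 R; lra.
have a_ge q : 0 <= a q by elim: q => [|q IH]; [rewrite a0|apply: le_trans IH _].
have ca q : X * cos (a q) = Num.sqrt (X ^+ 2 - q%:R ^+ 2).
  have c0 : 0 <= cos (a q).
    by apply: cos_ge0_pihalf; have := a_le q; have := a_ge q; have := pi_ge0 R; lra.
  have Xc0 : 0 <= X * cos (a q) by rewrite mulr_ge0// ltW.
  have [qX|qX] := leP (q%:R) X.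
    rewrite -[LHS]ger0_norm// -sqrtr_sqr; congr Num.sqrt.
    rewrite exprMn cos2sin2 sa min_l; last by rewrite ler_pdivrMr// mul1r.
    by field; rewrite gt_eqF.
  rewrite ler0_sqrtr; last by rewrite subr_le0 ler_sqr ?nnegrE// ltW.
  have : cos (a q) ^+ 2 = 0.
    rewrite cos2sin2 sa min_r; last by rewrite ler_pdivlMr// mul1r ltW.
    by rewrite expr1n subrr.
  by move/eqP; rewrite sqrf_eq0 => /eqP ->; rewrite mulr0.
have telU : \sum_(1 <= q < Q.+1) (X ^+ 2 * (Phi (a q) - Phi (a q.-1))) =
    X ^+ 2 * (pi / 4).
  rewrite -mulr_sumr big_add1 /= telescope_sumr// a0.
  have -> : a Q = pi / 2.
    rewrite /a min_r; last by rewrite ler_pdivlMr// mul1r.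
    have := @sinK R (pi / 2); rewrite sin_pihalf; apply.
    by rewrite in_itv/=; have := pi_ge0 R; lra.
  by rewrite /Phi sin0 cos_pihalf; congr (_ * _); lra.
have X2 : X ^+ 2 * (1 / X) = X by field; rewrite gt_eqF.
apply/andP; split; last first.
  rewrite -telU; apply: ler_sum_nat => q /andP[q1 qQ].
  case: q q1 qQ => // q _ _ /=.
  have P := Phi_ge (a_ge q) (a_mono q) (a_le _).
  rewrite -ca; have [qX|qX] := leP (q.+1%:R) X.
    have XE : X = X ^+ 2 * (sin (a q.+1) - sin (a q)).
      rewrite !sa !min_l ?ler_pdivrMr ?mul1r//.
        by rewrite -[q.+1]addn1 natrD; field; rewrite gt_eqF.
      by rewrite (le_trans _ qX)// ler_nat.
    by rewrite {1}XE -mulrA ler_pM2l ?exprn_gt0.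
  have -> : cos (a q.+1) = 0.
    have : X * cos (a q.+1) = 0.
      by rewrite ca ler0_sqrtr// subr_le0 ler_sqr ?nnegrE ?(ltW X0)// ltW.
    by move/eqP; rewrite mulf_eq0 gt_eqF//= => /eqP.
  rewrite mulr0 mulr_ge0 ?sqr_ge0//; apply: le_trans P.
  rewrite mulr_ge0//.
    rewrite subr_ge0 !sa le_min !ge_min lexx orbT andbT.
    by rewrite ler_pM2r ?invr_gt0// ler_nat leqnSn.
  by apply: cos_ge0_pihalf; have := a_le q.+1; have := a_ge q.+1; have := pi_ge0 R; lra.
rewrite lerBlDl -telU big_add1 /=.
have <- : \sum_(0 <= q < Q.+1) Num.sqrt (X ^+ 2 - q%:R ^+ 2) =
    X + \sum_(1 <= q < Q.+1) Num.sqrt (X ^+ 2 - q%:R ^+ 2).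
  by rewrite big_ltn// expr0n subr0 sqrtr_sqr gtr0_norm.
rewrite [leRHS]big_nat_recr//= -[leLHS]addr0 lerD ?sqrtr_ge0//.
apply: ler_sum_nat => q _; rewrite -ca.
have P := Phi_le (a_ge q) (a_mono q) (a_le _).
apply: (@le_trans _ _ (X ^+ 2 * ((sin (a q.+1) - sin (a q)) * cos (a q)))).
  by rewrite ler_pM2l ?exprn_gt0.
rewrite mulrA ler_wpM2r//.
  by apply: cos_ge0_pihalf; have := a_le q; have := a_ge q; have := pi_ge0 R; lra.
rewrite -[leRHS]X2 ler_pM2l ?exprn_gt0// !sa.
have : q.+1%:R / X = q%:R / X + 1 / X by rewrite -mulrDl natr1.
have : 0 < 1 / X by rewrite divr_gt0.
move: (q.+1%:R / X) (q%:R / X) (1 / X) => x y z z0 xyz.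
by rewrite /Num.min; case: (ltP x 1) => ?; case: (ltP y 1) => ?; lra.
Qed.
End QuarterDisk.

(** * The Basel sum, by angle doubling *)

Section Basel.
Variable R : realType.
Implicit Types x y : R.

Lemma sin_le_id x : 0 <= x -> sin x <= x.
Proof.
move=> x0; pose f (t : R) := t - sin t.
have fd (t : R) : is_derive t 1 f (1 - cos t).
  by rewrite /f; apply: is_derive_eq.
have := is_derive_ge0_le x0 fd; rewrite /f sin0 subr0 subr_ge0; apply.
by move=> y _; rewrite subr_ge0 cos_le1.
Qed.

(* [x <= tan x] in a form free of the pole of the tangent. *)
Lemma mul_cos_le_sin x : 0 <= x -> x <= pi -> x * cos x <= sin x.
Proof.
move=> x0 xpi; pose f (t : R) := sin t - t * cos t.
have fd (t : R) : is_derive t 1 f (t * sin t).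
  by rewrite /f; apply: is_derive_eq; rewrite /GRing.scale/=; lra.
have := is_derive_ge0_le x0 fd; rewrite /f sin0 mul0r subr0 subr_ge0; apply.
by move=> y /andP[y0 yx]; rewrite mulr_ge0// sin_ge0_pi// y0 (le_trans yx).
Qed.

(** 1 / sin^2 = cot^2 + 1, and cot x <= 1 / x. *)
Lemma invsin2_bounds x : 0 < x -> x < pi / 2 ->
  (x ^+ 2)^-1 <= (sin x ^+ 2)^-1 <= (x ^+ 2)^-1 + 1.
Proof.
move=> x0 xpi; have pi0 := pi_gt0 R.
have s0 : 0 < sin x by apply: sin_gt0_pihalf; rewrite x0.
have c0 : 0 < cos x by apply: cos_gt0_pihalf; lra.
apply/andP; split.
  rewrite lef_pV2 ?posrE ?exprn_gt0// ler_sqr ?nnegrE ?(ltW x0) ?(ltW s0)//.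
  exact/sin_le_id/ltW.
have e : (sin x ^+ 2)^-1 = (cos x / sin x) ^+ 2 + 1.
  have := cos2Dsin2 x => h; apply: (@mulfI _ (sin x ^+ 2)).
    by rewrite expf_neq0// gt_eqF.
  rewrite divff ?expf_neq0 ?gt_eqF//; rewrite -[in LHS]h.
  by field; rewrite gt_eqF.
rewrite e lerD2r -exprVn ler_sqr ?nnegrE ?divr_ge0 ?invr_ge0 ?(ltW c0) ?(ltW s0) ?(ltW x0)//.
rewrite ler_pdivrMr// mulrC ler_pdivlMr// mulrC.
by apply: mul_cos_le_sin; lra.
Qed.

(** A trigonometric model of the sum of 1 / k^2, which has a closed form when M is a power of 2. *)
Let U (M : nat) : R :=
  \sum_(1 <= k < M) (sin (k%:R * (pi / (2 * M)%:R)) ^+ 2)^-1.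

Lemma invsin2_half y : sin y != 0 -> cos y != 0 ->
  4 / sin (y *+ 2) ^+ 2 = (sin y ^+ 2)^-1 + (sin (pi / 2 - y) ^+ 2)^-1.
Proof.
move=> sy cy; rewrite sin_mulr2n [_ - y]addrC sinDpihalf cosN addrC.
have h := cos2Dsin2 y.
transitivity ((cos y ^+ 2 + sin y ^+ 2) / (cos y * sin y) ^+ 2).
  by rewrite h; field; rewrite sy.
by field; rewrite sy.
Qed.

(** The angles of indices k and 2 M - k are complementary, so by [invsin2_half] each such pair sums
    to 4 times a term of [U M]. The middle index M has angle pi / 4 and contributes 2. *)
Let U_double (M : nat) : (0 < M)%N -> U (2 * M) = 4 * U M + 2.
Proof.
move=> M0; rewrite /U; set t : R := pi / (2 * (2 * M))%:R.
have pi0 := pi_gt0 R.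
have M0' : 0 < M%:R :> R by rewrite ltr0n.
have tM : (2 * M)%:R * t = pi / 2.
  by rewrite /t !natrM; field; rewrite gt_eqF.
have t2 : pi / (2 * M)%:R = t *+ 2.
  by rewrite /t !natrM -mulr_natr; field; rewrite gt_eqF.
have t0 : 0 < t by rewrite divr_gt0// ltr0n; lia.
have rev : \sum_(M.+1 <= k < 2 * M) (sin (k%:R * t) ^+ 2)^-1 =
    \sum_(1 <= k < M) (sin (pi / 2 - k%:R * t) ^+ 2)^-1.
  rewrite big_nat_rev/= -{1}(add0n M.+1) big_addn [RHS]big_add1/=.
  have -> : (2 * M - M.+1 = M.-1)%N by lia.
  apply: eq_big_nat => k /andP[_ kM]; congr (sin _ ^+ 2)^-1.
  rewrite -tM -mulrBl -natrB; last lia.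
  by congr (_%:R * _); lia.
rewrite (@big_cat_nat _ _ _ M) //=; last lia.
rewrite [X in _ + X]big_ltn; last lia.
rewrite rev mulr_sumr addrCA [RHS]addrC; congr (_ + _).
  have -> : M%:R * t = pi / 4 by rewrite /t !natrM; field; rewrite gt_eqF.
  have h := @tan_piquarter R; have h2 := cos2Dsin2 (pi / 4 : R).
  have c0 : cos (pi / 4 : R) != 0 by rewrite gt_eqF// cos_gt0_pihalf//; lra.
  have e : sin (pi / 4 : R) = cos (pi / 4).
    by rewrite -[LHS](divfK c0) -/(tan _) h mul1r.
  have -> : sin (pi / 4 : R) ^+ 2 = 2^-1 by move: h2; rewrite -e; lra.
  by rewrite invrK.
rewrite -big_split/=; apply: eq_big_nat => k /andP[k1 kM].
rewrite t2 mulrnAr; apply/esym; apply: invsin2_half.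
  rewrite gt_eqF// sin_gt0_pihalf// mulr_gt0 ?ltr0n//= -tM ltr_pM2r// ltr_nat; lia.
have kt : 0 < k%:R * t by rewrite mulr_gt0// ltr0n.
rewrite gt_eqF// cos_gt0_pihalf// (lt_trans _ kt)/=; last lra.
rewrite -tM ltr_pM2r// ltr_nat; lia.
Qed.

Let U_expn n : U (2 ^ n) = (4 ^+ n.+1 - 4) / 6.
Proof.
elim: n => [|n IH]; first by rewrite /U expn0 big_geq// expr1 subrr mul0r.
by rewrite expnS U_double ?expn_gt0// IH [in RHS]exprS; field.
Qed.

(** With t = pi / (2 * 2^n), the sum of 1 / k^2 is t^2 times the sum of 1 / (k t)^2. Passing to 1 /
    sin^2 costs at most 1 per term, hence t^2 * 2^n = O(2^-n) in all. *)
Let sum_invsq_expn n :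
  (pi : R) ^+ 2 / 6 - pi ^+ 2 / 2 ^+ n <= \sum_(1 <= k < 2 ^ n) (k%:R ^+ 2)^-1 <= (pi ^+ 2 / 6 : R).
Proof.
have pi0 := pi_gt0 R.
have E0 : 0 < (2 ^+ n : R) by rewrite exprn_gt0.
set t : R := pi / (2 * 2 ^ n)%:R.
have t0 : 0 < t by rewrite divr_gt0// ltr0n; lia.
have E1 : 1 <= (2 ^+ n : R) by rewrite exprn_ege1//; lra.
have e4 : (4 ^+ n.+1 : R) = 4 * 2 ^+ n * 2 ^+ n.
  by rewrite exprS (_ : 4 = 2 * 2) ?exprMn; lra.
have tE : t ^+ 2 * 4 ^+ n.+1 = pi ^+ 2.
  by rewrite e4 /t natrM natrX; field; rewrite gt_eqF.
have -> : \sum_(1 <= k < 2 ^ n) (k%:R ^+ 2)^-1 =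
    t ^+ 2 * \sum_(1 <= k < 2 ^ n) ((k%:R * t) ^+ 2)^-1.
  rewrite mulr_sumr; apply: eq_big_nat => k /andP[k1 kn].
  by field; rewrite gt_eqF//= gt_eqF// ltr0n.
have bd k : (1 <= k)%N -> (k < 2 ^ n)%N ->
    ((k%:R * t) ^+ 2)^-1 <= (sin (k%:R * t) ^+ 2)^-1 <= ((k%:R * t) ^+ 2)^-1 + 1.
  move=> k1 kn; apply: invsin2_bounds; first by rewrite mulr_gt0// ltr0n.
  have -> : pi / 2 = (2 ^ n)%:R * t.
    by rewrite /t natrM; field; rewrite pnatr_eq0 -lt0n expn_gt0.
  by rewrite ltr_pM2r// ltr_nat.
have lo : U (2 ^ n) - (2 ^+ n) <= \sum_(1 <= k < 2 ^ n) ((k%:R * t) ^+ 2)^-1.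
  rewrite lerBlDr.
  apply: (@le_trans _ _ (\sum_(1 <= k < 2 ^ n) (((k%:R * t) ^+ 2)^-1 + 1))).
    by apply: ler_sum_nat => k /andP[k1 kn]; have /andP[_] := bd k k1 kn.
  rewrite big_split/= lerD2l sumr_const_nat -natrX ler_nat; lia.
have hi : \sum_(1 <= k < 2 ^ n) ((k%:R * t) ^+ 2)^-1 <= U (2 ^ n).
  by apply: ler_sum_nat => k /andP[k1 kn]; have /andP[] := bd k k1 kn.
have t2 : t ^+ 2 = pi ^+ 2 / (4 * 2 ^+ n * 2 ^+ n).
  by rewrite -tE e4; field; rewrite gt_eqF.
rewrite U_expn e4 in lo hi; rewrite t2; apply/andP; split.
  apply: le_trans (ler_wpM2l _ lo); last first.
    by rewrite divr_ge0 ?sqr_ge0// ltW// !mulr_gt0.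
  set E := 2 ^+ n in E0 E1 *.
  have -> : pi ^+ 2 / (4 * E * E) * ((4 * E * E - 4) / 6 - E) =
    pi ^+ 2 / 6 - pi ^+ 2 / E * ((E^-1) / 6 + 4^-1) by field; rewrite gt_eqF.
  have Ei : E^-1 <= 1 by rewrite invf_le1.
  rewrite lerD2l lerN2 -[leRHS]mulr1 ler_wpM2l ?divr_ge0 ?sqr_ge0 ?(ltW E0)//; lra.
apply: le_trans (ler_wpM2l _ hi) _; first by rewrite divr_ge0 ?sqr_ge0// ltW// !mulr_gt0.
set E := 2 ^+ n in E0 E1 *.
have -> : pi ^+ 2 / (4 * E * E) * ((4 * E * E - 4) / 6) =
  pi ^+ 2 / 6 * (1 - (E * E)^-1) by field; rewrite gt_eqF.
rewrite -[leRHS]mulr1 ler_wpM2l ?divr_ge0 ?sqr_ge0//.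
by rewrite lerBlDr lerDl invr_ge0 mulr_ge0// ltW.
Qed.

Lemma sum_invsq_cvg (d : R) : 0 < d -> exists K0 : nat, forall K, (K0 <= K)%N ->
  (pi : R) ^+ 2 / 6 - d <= \sum_(1 <= k < K.+1) (k%:R ^+ 2)^-1 <= (pi ^+ 2 / 6 : R).
Proof.
move=> d0.
have mono (a b : nat) : (a <= b)%N ->
    \sum_(1 <= k < a) (k%:R ^+ 2)^-1 <= \sum_(1 <= k < b) (k%:R ^+ 2)^-1 :> R.
  move=> ab; have [a0|a0] := posnP a.
    by rewrite a0 [leLHS]big_geq// sumr_ge0// => k _; rewrite invr_ge0 sqr_ge0.
  rewrite [leRHS](@big_cat_nat _ _ _ a)//= lerDl.
  by apply: sumr_ge0 => k _; rewrite invr_ge0 sqr_ge0.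
pose n := Num.truncn (pi ^+ 2 / d : R).
have nd : pi ^+ 2 / 2 ^+ n <= d.
  rewrite ler_pdivrMr ?exprn_gt0// mulrC -ler_pdivrMr//.
  apply/ltW/(lt_le_trans (truncnS_gt _)).
  by rewrite -natrX ler_nat ltn_expl.
exists (2 ^ n)%N => K nK.
have /andP[lo _] := sum_invsq_expn n.
have /andP[_ hi] := sum_invsq_expn K.+1.
apply/andP; split.
  apply: le_trans (mono _ _ (leqW nK)); lra.
by apply: le_trans hi; apply: mono; rewrite ltnW// ltn_expl.
Qed.

End Basel.

(** * Equidistribution of Ford disks along a horocycle *)

Section AtanRatio.
Variable R : realType.
Implicit Types x y : R.

Lemma atan_MVT x y : x < y ->
  exists2 c, x < c < y & atan y - atan x = (1 + c ^+ 2)^-1 * (y - x).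
Proof.
move=> xy.
have cf : {within `[x, y], continuous (@atan R)}.
  by apply: continuous_subspaceT => z; exact: continuous_atan.
have [c + e] := MVT xy (fun z _ => is_derive1_atan z) cf.
by rewrite in_itv/= => cxy; exists c.
Qed.

(* The density [1 / (1 + x^2)] varies by a factor [1 + O(e)] on a window of length [e]. *)
Lemma atan_ratio (a e x y x' y' : R) : 0 <= e ->
  a <= x -> x < y -> y <= a + e -> a <= x' -> x' < y' -> y' <= a + e ->
  (atan y - atan x) * (y' - x') <= (1 + e + e ^+ 2) * ((atan y' - atan x') * (y - x)).
Proof.
move=> e0 ax xy ye ax' xy' ye'.
have [c /andP[xc cy] ->] := atan_MVT xy.
have [c' /andP[xc' cy'] ->] := atan_MVT xy'.
have p : 0 < (y - x) * (y' - x') by rewrite mulr_gt0 ?subr_gt0.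
rewrite -mulrA [X in _ <= _ * X](_ : _ = (1 + c' ^+ 2)^-1 * ((y - x) * (y' - x'))); last by ring.
rewrite [leRHS]mulrA ler_pM2r//.
have q : 0 < 1 + c ^+ 2 by rewrite ltr_wpDr ?sqr_ge0.
have q' : 0 < 1 + c' ^+ 2 by rewrite ltr_wpDr ?sqr_ge0.
rewrite ler_pdivlMr// mulrC ler_pdivrMr//.
have h1 : c' - c <= e by lra.
have h2 : c - c' <= e by lra.
have h3 : 0 <= (e - (c' - c)) * (e + (c' - c)) by rewrite mulr_ge0//; lra.
have h4 : (c' - c) * (2 * c) <= e * (1 + c ^+ 2).
  have [cc|cc] := leP 0 c.
    have : 0 <= (e - (c' - c)) * c by rewrite mulr_ge0//; lra.
    have : 0 <= e * (c - 1) ^+ 2 by rewrite mulr_ge0// sqr_ge0.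
    by rewrite !expr2; lra.
  have : 0 <= (e + (c' - c)) * (- c) by rewrite mulr_ge0//; lra.
  have : 0 <= e * (c + 1) ^+ 2 by rewrite mulr_ge0// sqr_ge0.
  by rewrite !expr2; lra.
have h5 : 0 <= e ^+ 2 * c ^+ 2 by rewrite mulr_ge0// sqr_ge0.
by move: h3 h4 h5; rewrite !expr2; lra.
Qed.

End AtanRatio.

(** * Angular measure carried to the line *)

Section TanCell.
Variable R : realType.
Variables (al be : R).
Hypothesis be0 : 0 < be.
Implicit Types (a b th s : R) (p : int) (q : nat).

(* Stereographic coordinate of the point of angle [th] on a circle, sent affinely to [R]. *)
Definition tan_param th : R := al + be * tan (th / 2).

(** The open interval leaves out the pole of [tan (th / 2)], the angle of the point sent to
    infinity. *)
Definition tan_pre (S : set R) : set R := `]- pi, pi[ `&` tan_param @^-1` S.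

Let ang a : R := 2 * atan ((a - al) / be).

Lemma tan_pre_itv (b0 b1 : bool) a b :
  tan_pre [set` Interval (BSide b0 a) (BSide b1 b)] =
  [set` Interval (BSide b0 (ang a)) (BSide b1 (ang b))].
Proof.
have I th : - pi < th < pi -> th / 2 \in `](- (pi/2)), (pi/2)[.
  by rewrite in_itv/=; lra.
have angI x : - pi < ang x < pi.
  by have := atan_gtNpi2 ((x - al) / be); have := atan_ltpi2 ((x - al) / be); rewrite /ang; lra.
have ltE th x : - pi < th < pi -> (tan_param th < x) = (th < ang x).
  move=> thI; rewrite /tan_param addrC -ltrBrDr mulrC -ltr_pdivlMr//.
  rewrite -[X in _ < X]atanK ltr_tan ?I//.
    by rewrite ltr_pdivrMr// mulrC.
  by rewrite in_itv/= atan_gtNpi2 atan_ltpi2.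
have ltE' th x : - pi < th < pi -> (x < tan_param th) = (ang x < th).
  move=> thI; rewrite /tan_param addrC -ltrBlDr mulrC -ltr_pdivrMr//.
  rewrite -[X in X < _]atanK ltr_tan ?I//.
    by rewrite ltr_pdivlMr// mulrC.
  by rewrite in_itv/= atan_gtNpi2 atan_ltpi2.
have leE th x : - pi < th < pi -> (tan_param th <= x) = (th <= ang x).
  by move=> thI; rewrite leNgt ltE'// -leNgt.
have leE' th x : - pi < th < pi -> (x <= tan_param th) = (ang x <= th).
  by move=> thI; rewrite leNgt ltE// -leNgt.
have aI := angI a; have bI := angI b.
apply/seteqP; split => th /=; rewrite /tan_pre/= !in_itv/=.
  by move=> [thI]; case: b0; case: b1 => /=; rewrite ?ltE ?ltE' ?leE ?leE'.
move=> h; have thI : - pi < th < pi by move: h; case: b0; case: b1 => /=; lra.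
by split => //; move: h; case: b0; case: b1 => /=; rewrite ?ltE ?ltE' ?leE ?leE'.
Qed.

Lemma tan_pre_itv_measure (b0 b1 : bool) a b : a <= b ->
  lebesgue_measure (tan_pre [set` Interval (BSide b0 a) (BSide b1 b)]) =
  (2 * (atan ((b - al) / be) - atan ((a - al) / be)))%:E.
Proof.
move=> ab; rewrite tan_pre_itv lebesgue_measure_itv/= lte_fin.
have : (a - al) / be <= (b - al) / be by rewrite ler_pM2r ?invr_gt0// lerD2r.
move/le_atan => h; rewrite /ang mulrBr -EFinB.
by case: ltP => // h'; congr (_%:E); lra.
Qed.

Lemma measurable_tan_pre_itv (b0 b1 : bool) a b :
  measurable (tan_pre [set` Interval (BSide b0 a) (BSide b1 b)] : set R).
Proof. by rewrite tan_pre_itv; exact: measurable_itv. Qed.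

Lemma tan_preT_measure :
  lebesgue_measure (tan_pre setT) = (2 * pi)%:E.
Proof.
rewrite /tan_pre preimage_setT setIT lebesgue_measure_itv/= lte_fin.
have pi0 := pi_gt0 R.
by rewrite ifT; [rewrite -EFinB; congr (_%:E); lra|lra].
Qed.

End TanCell.

Lemma le_measure_bigcup_countable (d : measure_display) (T : measurableType d)
    (R : realType) (mu : {measure set T -> \bar R}) (I : countType)
    (A C : I -> set T) (k : R) : 0 <= k ->
  (forall i, measurable (A i)) -> (forall i, measurable (C i)) ->
  trivIset setT A -> trivIset setT C ->
  (forall i, (mu (A i) <= k%:E * mu (C i))%E) ->
  (mu (\bigcup_i A i) <= k%:E * mu (\bigcup_i C i))%E.
Proof.
move=> k0 mA mC tA tC h.
pose F (B : I -> set T) (n : nat) := oapp B set0 (pickle_inv n).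
have FU B : \bigcup_i B i = \bigcup_n F B n.
  apply/seteqP; split => x [i _ Bx].
    by exists (pickle i) => //; rewrite /F pickleK_inv.
  by move: Bx; rewrite /F; case: (pickle_inv i) => //= j Bx; exists j.
have mF B : (forall i, measurable (B i)) -> forall n, measurable (F B n).
  by move=> mB n; rewrite /F; case: pickle_inv => //=.
have tF B : trivIset setT B -> trivIset setT (F B).
  move=> /trivIsetP tB; apply/trivIsetP => m n _ _ mn; rewrite /F.
  have := @pickle_invK I m; have := @pickle_invK I n.
  case: (pickle_inv m) => [i|] /=; case: (pickle_inv n) => [j|] /=;
    rewrite ?set0I ?setI0// => nj mi.
  by apply: tB => //; apply/eqP => ij; move: mn; rewrite -nj -mi ij eqxx.
rewrite !FU !measure_semi_bigcup; try by [apply: mF|apply: tF];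
  try by apply: bigcupT_measurable; exact: mF.
rewrite -nneseriesZl//; apply: lee_nneseries => // n _.
by rewrite /F; case: pickle_inv => //=; rewrite !measure0 mule0.
Qed.

Section NearInt.
Variable R : realType.
Variables (al be : R).
Hypothesis be0 : 0 < be.

Definition near_int (q : nat) (s : R) : set R :=
  [set x | exists p : int, `|q%:R * x - p%:~R| < s].

Let A (q : nat) (s : R) (p : int) : set R :=
  tan_pre al be `](p%:~R - s) / q%:R, (p%:~R + s) / q%:R[.
(** The half-open cells of length 1 / q around the p / q tile the line. For s <= 1 / 2 the window
    [A q s p] lies in its cell and takes up the fraction 2 s of its length. *)
Let C (q : nat) (p : int) : set R :=
  tan_pre al be `[(p%:~R - 2^-1) / q%:R, (p%:~R + 2^-1) / q%:R[.

Let A_sub q s p th : (0 < q)%N ->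
  A q s p th <-> (- pi < th < pi) /\ `|q%:R * tan_param al be th - p%:~R| < s.
Proof.
move=> q0; have q0' : 0 < q%:R :> R by rewrite ltr0n.
rewrite /A /tan_pre/= !in_itv/= ltr_pdivrMr// ltr_pdivlMr// ltr_distl.
by rewrite mulrC; split => -[? ?].
Qed.

Let near_intE q s : (0 < q)%N -> tan_pre al be (near_int q s) = \bigcup_p A q s p.
Proof.
move=> q0; apply/seteqP; split => th.
  by move=> [thI [p hp]]; exists p => //; apply/(A_sub _ _ _ q0).
by move=> [p _ /(A_sub _ _ _ q0)[? hp]]; split => //; exists p.
Qed.

Lemma measurable_near_int q s : (0 < q)%N ->
  measurable (tan_pre al be (near_int q s) : set R).
Proof.
move=> q0; rewrite near_intE//; apply: countable_bigcupT_measurable => // p.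
exact: measurable_tan_pre_itv.
Qed.

Let C_cover q : (0 < q)%N -> tan_pre al be setT = \bigcup_p C q p.
Proof.
move=> q0; have q0' : 0 < q%:R :> R by rewrite ltr0n.
apply/seteqP; split => th; last by move=> [p _ [thI _]]; split.
move=> [thI _]; exists (Num.floor (q%:R * tan_param al be th + 2^-1)) => //.
split => //=; rewrite in_itv/= ler_pdivrMr// ltr_pdivlMr//.
have /andP[] := floor_itv (q%:R * tan_param al be th + 2^-1).
by rewrite rmorphD/= [q%:R * _]mulrC; lra.
Qed.

Let trivC q : (0 < q)%N -> trivIset setT (C q).
Proof.
move=> q0; have q0' : 0 < q%:R :> R by rewrite ltr0n.
apply/trivIsetP => i j _ _ /eqP ij; apply/seteqP; split => // th [[_ +] [_ +]].
rewrite /= !in_itv/= !ler_pdivrMr// !ltr_pdivlMr// => hi hj; apply: ij.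
have e (p : int) :
    p%:~R - 2^-1 <= tan_param al be th * q%:R < p%:~R + 2^-1 ->
    Num.floor (q%:R * tan_param al be th + 2^-1) = p.
  by move=> h; apply: floor_def; rewrite rmorphD/= [q%:R * _]mulrC; lra.
by rewrite -(e _ hi) -(e _ hj).
Qed.

Let trivA q s : (0 < q)%N -> s <= 2^-1 -> trivIset setT (A q s).
Proof.
move=> q0 s2.
have q0' : 0 < q%:R :> R by rewrite ltr0n.
have /trivIsetP tC := trivC q0.
apply/trivIsetP => i j _ _ /(tC _ _ I I) h; apply: subsetI_eq0 h => th [thI /=] h;
  split => //=; move: h; rewrite !in_itv/= !ltr_pdivrMr// !ltr_pdivlMr// !ler_pdivrMr//; lra.
Qed.

(** Each window has 2 s times the measure of its cell, up to the factor K by which the density can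
    vary over a cell, whose length is (q be)^-1 in the rescaled coordinate. The cells have total
    measure 2 pi, hence the main term 4 pi s. *)
Lemma near_int_measure (q : nat) (s : R) : (0 < q)%N -> 0 <= s -> s <= 2^-1 ->
  let K := 1 + (q%:R * be)^-1 + (q%:R * be)^-1 ^+ 2 in
  ((4 * pi * s)%:E <= K%:E * lebesgue_measure (tan_pre al be (near_int q s)) /\
   lebesgue_measure (tan_pre al be (near_int q s)) <= (K * (4 * pi * s))%:E)%E.
Proof.
move=> q0 s0 s2 /=; set e := (q%:R * be)^-1; set K := 1 + e + e ^+ 2.
have q0' : 0 < q%:R :> R by rewrite ltr0n.
have e0 : 0 < e by rewrite invr_gt0 mulr_gt0.
have e20 := exprn_gt0 2 e0.
have K0 : 0 < K by rewrite /K; lra.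
have mA p : measurable (A q s p : set R) by apply: measurable_tan_pre_itv.
have mC p : measurable (C q p : set R) by apply: measurable_tan_pre_itv.
have [->|s_neq0] := eqVneq s 0.
  rewrite !mulr0; split; first by rewrite mule_ge0// lee_fin ltW.
  rewrite (_ : tan_pre _ _ _ = set0) ?measure0//.
  apply/seteqP; split => // th [_ [p]].
  by rewrite ltNge normr_ge0.
have s0' : 0 < s by rewrite lt_neqAle eq_sym s_neq0.
pose x (p : int) (t : R) := ((p%:~R + t) / q%:R - al) / be.
have mx p (t u : R) : x p u - x p t = (u - t) * e.
  by rewrite /x /e; field; rewrite !gt_eqF.
have lA p : lebesgue_measure (A q s p : set R) = (2 * (atan (x p s) - atan (x p (- s))))%:E.
  by apply: tan_pre_itv_measure => //; rewrite ler_pM2r ?invr_gt0//; lra.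
have lC p : lebesgue_measure (C q p : set R) =
    (2 * (atan (x p 2^-1) - atan (x p (- 2^-1))))%:E.
  by apply: tan_pre_itv_measure => //; rewrite ler_pM2r ?invr_gt0//; lra.
have se : s * e <= 2^-1 * e by rewrite ler_pM2r.
have se0 : 0 < s * e by rewrite mulr_gt0.
have hA p : (lebesgue_measure (A q s p : set R) <=
    (K * (2 * s))%:E * lebesgue_measure (C q p : set R))%E.
  rewrite lA lC -EFinM lee_fin.
  have := @atan_ratio R (x p (- 2^-1)) e (x p (- s)) (x p s) (x p (- 2^-1)) (x p 2^-1).
  have := mx p (- s) s; have := mx p (- 2^-1) (2^-1); have := mx p (- 2^-1) (- s).
  have := mx p s 2^-1.
  move: (x p (- 2^-1)) (x p (- s)) (x p s) (x p 2^-1) => x1 x2 x3 x4 m1 m2 m3 m4.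
  rewrite m3 m4 -/K => H.
  have {}H : (atan x3 - atan x2) * ((2^-1 - - 2^-1) * e) <=
      K * ((atan x4 - atan x1) * ((s - - s) * e)) by apply: H; lra.
  rewrite -(ler_pM2r e0); move: H; lra.
have hC p : ((2 * s)%:E * lebesgue_measure (C q p : set R) <=
    K%:E * lebesgue_measure (A q s p : set R))%E.
  rewrite lA lC -!EFinM lee_fin.
  have := @atan_ratio R (x p (- 2^-1)) e (x p (- 2^-1)) (x p 2^-1) (x p (- s)) (x p s).
  have := mx p (- s) s; have := mx p (- 2^-1) (2^-1); have := mx p (- 2^-1) (- s).
  have := mx p s 2^-1.
  move: (x p (- 2^-1)) (x p (- s)) (x p s) (x p 2^-1) => x1 x2 x3 x4 m1 m2 m3 m4.
  rewrite m3 m4 -/K => H.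
  have {}H : (atan x4 - atan x1) * ((s - - s) * e) <=
      K * ((atan x3 - atan x2) * ((2^-1 - - 2^-1) * e)) by apply: H; lra.
  rewrite -(ler_pM2r e0); move: H; lra.
have lT : lebesgue_measure (\bigcup_p C q p : set R) = (2 * pi)%:E.
  by rewrite -C_cover// tan_preT_measure.
have KI : (0 < K^-1)%R by rewrite invr_gt0.
split; rewrite near_intE//.
  have : ((lebesgue_measure (\bigcup_p C q p : set R)) <=
      (K / (2 * s))%:E * lebesgue_measure (\bigcup_p A q s p : set R))%E.
    apply: le_measure_bigcup_countable => //.
    - by rewrite divr_ge0 ?(ltW K0)//; lra.
    - exact: trivC.
    - exact: trivA.
    - move=> p; rewrite -(@lee_pmul2l _ (2 * s)%:E) ?fin_numE//; last first.
        by rewrite lte_fin; lra.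
      rewrite muleA -EFinM (_ : 2 * s * (K / (2 * s)) = K) ?hC//.
      by field.
  rewrite lT -(@lee_pmul2l _ (2 * s)%:E) ?fin_numE//; last first.
    by rewrite lte_fin; lra.
  rewrite muleA -!EFinM (_ : 2 * s * (K / (2 * s)) = K); last by field.
  by apply: le_trans; rewrite lee_fin; lra.
have : (lebesgue_measure (\bigcup_p A q s p : set R) <=
    (K * (2 * s))%:E * (lebesgue_measure (\bigcup_p C q p : set R)))%E.
  apply: le_measure_bigcup_countable => //.
  - by rewrite mulr_ge0 ?(ltW K0)//; lra.
  - exact: trivA.
  - exact: trivC.
by move/le_trans; apply; rewrite lT -EFinM lee_fin; lra.
Qed.

End NearInt.

(** * Primitive lattice vectors and their multiples *)

Section Farey.
Variable R : realType.
Implicit Types (x h r : R) (p : int) (q k : nat).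

Definition lattice_sqnorm h x p q : R := (q%:R * x - p%:~R) ^+ 2 + (q%:R * h) ^+ 2.

(* For [z = x + i h] and [r = 1] the condition reads [|q z - p|^2 < Im z], i.e. [z] lies in
   the Ford disk at [p / q]; smaller [r] give horodisks of smaller radius. *)
Definition farey h r : set R := [set x | exists p q,
  [/\ (0 < q)%N, coprime `|p| q & lattice_sqnorm h x p q < r * h]].

(** The half-width of the windows for a given q: how close q x must be to an integer. For large q
    the radicand is negative, [Num.sqrt] returns 0, and the windows are empty. *)
Definition farey_gap h r q : R := Num.sqrt (r * h - (q%:R * h) ^+ 2).

Lemma lattice_sqnorm_gap h r x p q :
  (`|q%:R * x - p%:~R| < farey_gap h r q) = (lattice_sqnorm h x p q < r * h).
Proof.
rewrite /farey_gap /lattice_sqnorm -ltrBrDr -(@sqrtr_sqr R).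
have [h0|h0] := leP (r * h - (q%:R * h) ^+ 2) 0; last by rewrite ltr_sqrt.
rewrite (ler0_sqrtr h0) ltNge sqrtr_ge0/=; apply/esym/negbTE.
by rewrite -leNgt (le_trans h0)// sqr_ge0.
Qed.

Lemma near_int_farey_gap h r q x :
  near_int q (farey_gap h r q) x <-> exists p, lattice_sqnorm h x p q < r * h.
Proof. by split => -[p hp]; exists p; move: hp; rewrite lattice_sqnorm_gap. Qed.

(* [h (q' p - q p')] is the determinant of the vectors [q z - p] and [q' z - p']
   for [z = x + i h], hence smaller than [h] in absolute value. *)
Lemma lattice_sqnorm_prop h x p q p' q' : 0 < h ->
  lattice_sqnorm h x p q < h -> lattice_sqnorm h x p' q' < h ->
  q%:Z * p' = q'%:Z * p.
Proof.
move=> h0; rewrite /lattice_sqnorm.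
set u := q%:R * x - p%:~R; set u' := q'%:R * x - p'%:~R => H H'.
set D := q%:Z * p' - q'%:Z * p.
suff : D = 0 by move/eqP; rewrite subr_eq0 => /eqP.
apply/eqP/negP => /negP D0.
have D1 : 1 <= (D%:~R : R) ^+ 2.
  have : (1 <= D ^+ 2)%R by rewrite expr2; nia.
  by rewrite -(ler_int R) rmorphXn.
have e : h * D%:~R = u * (q'%:R * h) - u' * (q%:R * h).
  by rewrite /D /u /u' rmorphB !rmorphM/= -!pmulrn; ring.
have : (h * D%:~R) ^+ 2 < h * h.
  rewrite e; apply: le_lt_trans (ltr_pM _ _ H H'); rewrite ?addr_ge0 ?sqr_ge0//.
  have := sqr_ge0 (u * u' + (q%:R * h) * (q'%:R * h)).
  by rewrite !expr2; lra.
rewrite exprMn -expr2 -[ltRHS]mulr1 ltr_pM2l ?exprn_gt0//.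
by rewrite ltNge D1.
Qed.

Lemma coprime_reduce p q : (0 < q)%N -> exists k p1 q1,
  [/\ (0 < k)%N, (0 < q1)%N, coprime `|p1| q1, p = k%:Z * p1 & q = (k * q1)%N].
Proof.
move=> q0; set k := gcdn `|p| q.
have k0 : (0 < k)%N by rewrite gcdn_gt0 q0 orbT.
have kp : (k %| `|p|)%N by exact: dvdn_gcdl.
have kq : (k %| q)%N by exact: dvdn_gcdr.
have pE : (p %/ k%:Z)%Z * k%:Z = p by rewrite divzK// dvdzE.
have apE : (`|(p %/ k%:Z)%Z| * k)%N = `|p|%N by rewrite -[in RHS]pE abszM absz_nat.
exists k, (p %/ k%:Z)%Z, (q %/ k)%N; split => //.
- by rewrite divn_gt0// dvdn_leq.
- by rewrite /coprime -(eqn_pmul2r k0) muln_gcdl apE divnK// mul1n.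
- by rewrite mulrC.
- by rewrite mulnC divnK.
Qed.

Lemma coprime_prop p q p0 q0 : (0 < q)%N -> (0 < q0)%N -> coprime `|p0| q0 ->
  q%:Z * p0 = q0%:Z * p -> exists k, [/\ (0 < k)%N, p = k%:Z * p0 & q = (k * q0)%N].
Proof.
move=> hq hq0 cop e.
have e' : (q * `|p0| = q0 * `|p|)%N by have := congr1 absz e; rewrite !abszM.
have /dvdnP[k qk] : (q0 %| q)%N.
  by rewrite -(@Gauss_dvdl _ _ `|p0|) 1?coprime_sym// e' dvdn_mulr.
exists k; split => //; first by case: k qk hq => // ->; rewrite mul0n.
have q0z : q0%:Z != 0 by lia.
apply: (mulfI q0z); rewrite -e qk PoszM; ring.
Qed.

Let sum_pred1_nat (n a : nat) (c : nat -> bool) :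
  \sum_(1 <= k < n) ((k == a) && c k)%:R = ((0 < a < n)%N && c a)%:R :> R.
Proof.
rewrite (eq_bigr (fun k => if k == a then (c k)%:R else 0)) => [|k _]; last first.
  by case: eqP.
by rewrite -big_mkcond big_nat1_eq; case: (0 < a < n)%N.
Qed.

(** Both sides count the lattice vectors (p, q) with q > 0 and squared norm below r h at the fixed
    x. They are all multiples k (p0, q0) of one primitive vector. The left side lists them by q, the
    right side by k, since the k-th multiple qualifies exactly when (p0, q0) does for r / k^2. As (q
    h)^2 < r h forces q < Q, no vector falls outside the ranges. *)
Lemma farey_count h r x (Q : nat) : 0 < h -> 0 < r -> r <= 1 ->
  r <= Q%:R ^+ 2 * h ->
  \sum_(1 <= q < Q.+1) \1_(near_int q (farey_gap h r q)) x =
  \sum_(1 <= k < Q.+1) \1_(farey h (r / k%:R ^+ 2)) x :> R.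
Proof.
move=> h0 r0 r1 rQ.
have rh : r * h <= h by rewrite ler_piMl// ltW.
have scale k p q : lattice_sqnorm h x (k%:Z * p) (k * q)%N =
    k%:R ^+ 2 * lattice_sqnorm h x p q.
  by rewrite /lattice_sqnorm natrM intrM -!pmulrn; ring.
have N0 p q : 0 <= lattice_sqnorm h x p q by rewrite addr_ge0 ?sqr_ge0.
have scaled k p q : (0 < k)%N ->
    (lattice_sqnorm h x p q < r / k%:R ^+ 2 * h) =
    (lattice_sqnorm h x (k%:Z * p) (k * q)%N < r * h).
  move=> k0; rewrite scale mulrAC ltr_pdivlMr ?exprn_gt0 ?ltr0n//.
  by rewrite mulrC.
have [[p0 [q0 [q0_gt0 cop N]]]|no] := pselect (farey h r x); last first.
  transitivity (0 : R); [|apply/esym]; rewrite big_nat big1// => k /andP[k0 _];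
    rewrite indicE memNset//.
    move=> /near_int_farey_gap[p N]; apply: no.
    have [j [p1 [q1 [j0 q10 cop pE qE]]]] := coprime_reduce p k0.
    exists p1, q1; split => //; move: N; rewrite pE qE scale; apply: le_lt_trans.
    by rewrite ler_peMl// exprn_ege1// ler1n.
  move=> [p [q [q0 cop]]]; rewrite scaled// scale => N; apply: no.
  exists p, q; split => //; apply: le_lt_trans N.
  by rewrite ler_peMl// exprn_ege1// ler1n.
pose c k := lattice_sqnorm h x (k%:Z * p0) (k * q0)%N < r * h.
have fareyE k : (0 < k)%N -> \1_(farey h (r / k%:R ^+ 2)) x =
    (c k)%:R :> R.
  move=> k0; rewrite indicE; congr (_%:R); congr nat_of_bool.
  apply/idP/idP; rewrite inE.
    move=> [p [q [hq hc]]]; rewrite scaled// => H.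
    have H' : lattice_sqnorm h x p q < h.
      apply: lt_le_trans rh; apply: le_lt_trans H; rewrite scale ler_peMl//.
      by rewrite exprn_ege1// ler1n.
    have [j [j0 pE qE]] := coprime_prop hq q0_gt0 cop
      (lattice_sqnorm_prop h0 H' (lt_le_trans N rh)).
    have j1 : j = 1%N.
      move: hc; rewrite pE qE abszM absz_nat /coprime -muln_gcdr muln_eq1.
      by case/andP => /eqP.
    by move: H; rewrite /c pE qE j1 mul1r mul1n.
  by rewrite /c => H; exists p0, q0; split => //; rewrite scaled.
(* A denominator q is hit exactly when q = k q0 for an admissible multiple k; exchanging the two
   sums then counts by k. *)
have nearE q : (0 < q)%N -> (q < Q.+1)%N -> \1_(near_int q (farey_gap h r q)) x =
    \sum_(1 <= k < Q.+1)
      ((q == (k * q0)%N) && c k)%:R :> R.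
  rewrite ltnS => q_gt0 qQ; rewrite indicE; case: (pselect (near_int q (farey_gap h r q) x)).
    move=> nq; rewrite mem_set//; have /near_int_farey_gap[p Np] := nq.
    have [j [j0 pE qE]] := coprime_prop q_gt0 q0_gt0 cop
      (lattice_sqnorm_prop h0 (lt_le_trans Np rh) (lt_le_trans N rh)).
    rewrite (eq_bigr (fun k => ((k == j) && predT k)%:R)) => [|k _]; last first.
      rewrite qE eqn_pmul2r// eq_sym; case: eqVneq => // ->.
      by rewrite /c -pE -qE Np.
    rewrite sum_pred1_nat j0 ltnS (leq_trans _ qQ)// qE leq_pmulr//.
  move=> nq; rewrite memNset//= big1// => k _; case: eqVneq => //= qE.
  rewrite /c; case: ltP => // Nk; exfalso; apply: nq; apply/near_int_farey_gap.
  by exists (k%:Z * p0); rewrite qE.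
rewrite (eq_big_nat _ _ (F2 := fun q => \sum_(1 <= k < Q.+1)
    ((q == (k * q0)%N) && c k)%:R)); last by move=> q /andP[]; exact: nearE.
rewrite exchange_big_nat/=; apply: eq_big_nat => k /andP[k0 kQ].
rewrite (sum_pred1_nat _ _ (fun=> c k)) fareyE// muln_gt0 k0 q0_gt0/= ltnS.
rewrite /c; case: ltP => Nk; rewrite ?andbF// andbT.
suff -> : (k * q0 <= Q)%N by [].
have : ((k * q0)%:R * h) ^+ 2 < Q%:R ^+ 2 * h * h.
  apply: (@le_lt_trans _ _ (lattice_sqnorm h x (k%:Z * p0) (k * q0)%N)).
    by rewrite /lattice_sqnorm lerDr sqr_ge0.
  by apply: lt_le_trans Nk _; rewrite ler_pM2r.
rewrite -mulrA -expr2 exprMn ltr_pM2r ?exprn_gt0// ltr_sqr ?nnegrE// ltr_nat.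
exact: ltnW.
Qed.

End Farey.

Lemma sum_measure_indic (R : realType) (I J : Type) (s : seq I) (t : seq J)
    (A : I -> set R) (B : J -> set R) :
  (forall i, measurable (A i)) -> (forall j, measurable (B j)) ->
  (forall x, \sum_(i <- s) \1_(A i) x = \sum_(j <- t) \1_(B j) x :> R) ->
  (\sum_(i <- s) lebesgue_measure (A i) = \sum_(j <- t) lebesgue_measure (B j))%E.
Proof.
move=> mA mB h.
have key (K : Type) (u : seq K) (C : K -> set R) : (forall i, measurable (C i)) ->
    (\sum_(i <- u) lebesgue_measure (C i) =
     \int[lebesgue_measure]_(x in setT) (\sum_(i <- u) \1_(C i) x)%:E)%E.
  move=> mC; under [RHS]eq_integral do rewrite -sumEFin.
  rewrite ge0_integral_sum//.
    apply: eq_bigr => i _.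
    by have := integral_indic lebesgue_measure measurableT (mC i); rewrite setIT => ->.
  by move=> i; apply/measurable_EFinP; apply: measurable_indic => //; exact: mC.
rewrite !key//; apply: eq_integral => x _; by rewrite h.
Qed.

Lemma sum_leq_nat (m n : nat) : (\sum_(1 <= q < n.+1) (q <= m) = minn n m)%N.
Proof.
elim: n => [|n IH]; first by rewrite big_geq// min0n.
by rewrite big_nat_recr//= IH; case: leqP; lia.
Qed.

Section FareyMeasure.
Variable R : realType.
Variables (al be h : R).
Hypothesis be0 : 0 < be.
Hypothesis h0 : 0 < h.

Definition farey_measure (r : R) : R :=
  fine (lebesgue_measure (tan_pre al be (farey h r))).

Let near_measure (r : R) (q : nat) : R :=
  fine (lebesgue_measure (tan_pre al be (near_int q (farey_gap h r q)))).

Lemma measurable_farey (r : R) : measurable (tan_pre al be (farey h r) : set R).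
Proof.
pose F (pq : int * nat) : set R :=
  if (0 < pq.2)%N && coprime `|pq.1| pq.2 then
  tan_pre al be `](pq.1%:~R - farey_gap h r pq.2) / pq.2%:R,
                  (pq.1%:~R + farey_gap h r pq.2) / pq.2%:R[ else set0.
rewrite (_ : tan_pre al be (farey h r) = \bigcup_pq F pq).
  apply: countable_bigcupT_measurable => // -[p q]; rewrite /F; case: ifP => // _.
  exact: measurable_tan_pre_itv.
have key th p q : (0 < q)%N -> (tan_param al be th \in
    `](p%:~R - farey_gap h r q) / q%:R, (p%:~R + farey_gap h r q) / q%:R[) =
    (lattice_sqnorm h (tan_param al be th) p q < r * h).
  move=> q0; have q0' : 0 < q%:R :> R by rewrite ltr0n.
  rewrite in_itv/= ltr_pdivrMr// ltr_pdivlMr// [_ * q%:R]mulrC.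
  by rewrite -lattice_sqnorm_gap ltr_distl.
apply/seteqP; split => th.
  move=> [thI [p [q [q0 cop H]]]]; exists (p, q) => //; rewrite /F/= q0 cop/=.
  by split => //=; rewrite key.
move=> [[p q] _]; rewrite /F/=; case: ifP => // /andP[q0 cop] [thI /=].
by rewrite key// => H; split => //; exists p, q.
Qed.

Lemma tan_pre_fin_num (S : set R) : measurable (tan_pre al be S : set R) ->
  lebesgue_measure (tan_pre al be S) \is a fin_num.
Proof.
move=> mS; rewrite ge0_fin_numE//.
apply: (@le_lt_trans _ _ (lebesgue_measure (tan_pre al be setT))).
  apply: le_measure; rewrite ?inE//; last by move=> x [].
  by rewrite /tan_pre preimage_setT setIT; exact: measurable_itv.
by rewrite tan_preT_measure ltry.
Qed.

Lemma farey_measure_ge0 r : 0 <= farey_measure r.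
Proof. exact/fine_ge0. Qed.

Let full_eq (r : R) (Q : nat) : 0 < r -> r <= 1 -> r <= Q%:R ^+ 2 * h ->
  \sum_(1 <= k < Q.+1) farey_measure (r / k%:R ^+ 2) =
  \sum_(1 <= q < Q.+1) near_measure r q.
Proof.
move=> r0 r1 rQ.
have mN (q : nat) : (0 < q)%N ->
    measurable (tan_pre al be (near_int q (farey_gap h r q)) : set R).
  by move=> q0; apply: measurable_near_int.
have indic_pre S th : \1_(tan_pre al be S) th =
    \1_(`]- pi, pi[%classic : set R) th * \1_S (tan_param al be th) :> R.
  by rewrite /tan_pre indicI.
pose A (k : nat) := tan_pre al be (farey h (r / k%:R ^+ 2)).
(* [q.-1.+1] equals q on the summation range and keeps the denominator positive at q = 0, so every
   [B q] is measurable. *)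
pose B (q : nat) := tan_pre al be (near_int q.-1.+1 (farey_gap h r q.-1.+1)).
have mA k : measurable (A k) by exact: measurable_farey.
have mB q : measurable (B q) by exact: mN.
have key : (\sum_(1 <= k < Q.+1) lebesgue_measure (A k) =
    \sum_(1 <= q < Q.+1) lebesgue_measure (B q))%E.
  apply: (sum_measure_indic mA mB) => th.
  transitivity ((\1_(`]- pi, pi[%classic : set R) th : R) *
      \sum_(1 <= k < Q.+1) \1_(farey h (r / k%:R ^+ 2)) (tan_param al be th)).
    by rewrite mulr_sumr; apply: eq_bigr => k _; rewrite indic_pre.
  rewrite -(farey_count (tan_param al be th) h0 r0 r1 rQ) mulr_sumr.
  by apply: eq_big_nat => q /andP[q0 _]; rewrite /B prednK// indic_pre.
apply: EFin_inj; rewrite -!sumEFin.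
transitivity (\sum_(1 <= k < Q.+1) lebesgue_measure (A k))%E.
  by apply: eq_bigr => k _; rewrite /farey_measure fineK// tan_pre_fin_num//; exact: mA.
rewrite key; apply: eq_big_nat => q /andP[q0 _].
by rewrite /B prednK// /near_measure fineK// tan_pre_fin_num//; exact: mN.
Qed.

Let near_measure_bounds (r : R) (q : nat) : (0 < q)%N ->
  0 <= r -> r <= 1 -> h <= 4^-1 ->
  let K := 1 + (q%:R * be)^-1 + (q%:R * be)^-1 ^+ 2 in
  4 * pi * farey_gap h r q <= K * near_measure r q /\
  near_measure r q <= K * (4 * pi * farey_gap h r q).
Proof.
move=> q0 r0 r1 h4 /=.
have s0 : 0 <= farey_gap h r q by exact: sqrtr_ge0.
(* This is where h <= 1 / 4 enters: the windows stay inside their cells. *)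
have s2 : farey_gap h r q <= 2^-1.
  rewrite /farey_gap -[leRHS]ger0_norm ?invr_ge0// -sqrtr_sqr ler_wsqrtr//.
  have : 0 <= (q%:R * h) ^+ 2 by exact: sqr_ge0.
  have : r * h <= h by rewrite ler_piMl// ltW.
  by rewrite [_^-1 ^+ 2]expr2; lra.
have [] := near_int_measure al be0 q0 s0 s2.
set mu := lebesgue_measure _.
have -> : mu = (near_measure r q)%:E.
  by rewrite /near_measure fineK// tan_pre_fin_num//; exact: measurable_near_int.
by rewrite -EFinM !lee_fin.
Qed.

(** For X^2 = r / h the gap is h times sqrt (X^2 - q^2). The quarter disk of radius X gives h X^2 pi
    / 4 = r pi / 4, and the Riemann error is h X = sqrt (r h). *)
Let sum_gap (r : R) (Q : nat) : 0 < r -> r <= Q%:R ^+ 2 * h ->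
  r * (pi / 4) - Num.sqrt (r * h) <= \sum_(1 <= q < Q.+1) farey_gap h r q <= r * (pi / 4).
Proof.
move=> r0 rQ; pose X : R := Num.sqrt (r / h).
have X2 : X ^+ 2 = r / h by rewrite sqr_sqrtr// divr_ge0// ltW.
have X0 : 0 < X by rewrite sqrtr_gt0 divr_gt0.
have XQ : X <= Q%:R.
  rewrite -[leRHS]ger0_norm// -sqrtr_sqr ler_wsqrtr//.
  by rewrite ler_pdivrMr.
have gapE q : farey_gap h r q = h * Num.sqrt (X ^+ 2 - q%:R ^+ 2).
  rewrite /farey_gap -[in RHS](gtr0_norm h0) -sqrtr_sqr -sqrtrM ?sqr_ge0//.
  by rewrite X2; congr Num.sqrt; field; rewrite gt_eqF.
have hX : h * X = Num.sqrt (r * h).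
  rewrite -[in LHS](gtr0_norm h0) -sqrtr_sqr -sqrtrM ?sqr_ge0//.
  by congr Num.sqrt; field; rewrite gt_eqF.
rewrite (eq_bigr _ (fun q _ => gapE q)) -mulr_sumr.
have /andP[lo hi] := sum_sqrt_quarter_disk X0 XQ.
have e : h * X ^+ 2 = r by rewrite X2 mulrC divfK// gt_eqF.
have := ler_wpM2l (ltW h0) lo; have := ler_wpM2l (ltW h0) hi.
by rewrite mulrBr [h * (_ * _)]mulrA e hX => -> ->.
Qed.

(** In the application [be] moves with the circle. A fixed lower bound makes the constants below
    independent of it. *)
Variable bm : R.
Hypothesis bm0 : 0 < bm.
Hypothesis bm_le : bm <= be.
Hypothesis h4 : h <= 4^-1.

(** Chosen so that K - 1 = e + e^2 <= C / q for e = (q be)^-1 and q >= 1. *)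
Let C : R := bm^-1 + bm^-1 ^+ 2.

Let near_measure_err (r : R) (q : nat) : (0 < q)%N -> 0 <= r -> r <= 1 ->
  `|near_measure r q - 4 * pi * farey_gap h r q| <=
  4 * pi * C * (farey_gap h r q / q%:R).
Proof.
move=> q0 r0 r1; have [] := near_measure_bounds q0 r0 r1 h4.
set b := near_measure r q; set s := farey_gap h r q.
have q1 : 1 <= q%:R :> R by rewrite ler1n.
have qi : 0 < (q%:R^-1 : R) by rewrite invr_gt0 ltr0n.
have qi1 : (q%:R^-1 : R) <= 1 by rewrite invf_le1// ltr0n.
have bi : 0 < be^-1 by rewrite invr_gt0.
have bi1 : be^-1 <= bm^-1 by rewrite lef_pV2 ?posrE.
have s0 : 0 <= s by exact: sqrtr_ge0.
have b0 : 0 <= b by exact: fine_ge0.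
have pi0 := pi_gt0 R.
rewrite invfM; set e := q%:R^-1 * be^-1; set K := 1 + e + e ^+ 2.
have K1 : 1 <= K by rewrite /K; have := mulr_gt0 qi bi; have := sqr_ge0 e; rewrite -/e; lra.
have KC : K - 1 <= C / q%:R.
  rewrite /K /C /e exprMn.
  have h1 : q%:R^-1 * be^-1 <= q%:R^-1 * bm^-1 by rewrite ler_pM2l.
  have h2 : (q%:R^-1 : R) ^+ 2 <= q%:R^-1 by rewrite expr2 ler_piMl// ltW.
  have h3 : be^-1 ^+ 2 <= bm^-1 ^+ 2 by rewrite ler_sqr ?nnegrE ?(ltW bi) ?invr_ge0 ?(ltW bm0).
  have h5 : q%:R^-1 ^+ 2 * be^-1 ^+ 2 <= q%:R^-1 * bm^-1 ^+ 2.
    by apply: ler_pM => //; rewrite sqr_ge0.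
  by rewrite mulrDl; lra.
have S0 : 0 <= 4 * pi * s by rewrite !mulr_ge0// ltW.
set S := 4 * pi * s in S0 *.
move=> lo hi.
have -> : 4 * pi * C * (s / q%:R) = C / q%:R * S by rewrite /S; ring.
have KS : (K - 1) * S <= C / q%:R * S by rewrite ler_wpM2r.
rewrite ler_norml; apply/andP; split; last by lra.
have [bS|bS] := leP S b.
  have : 0 <= (K - 1) * S by rewrite mulr_ge0//; lra.
  by lra.
have : (K - 1) * b <= (K - 1) * S by rewrite ler_wpM2l ?(ltW bS)//; lra.
by lra.
Qed.

Let C0 : 0 <= C.
Proof. by rewrite addr_ge0 ?sqr_ge0// invr_ge0 ltW. Qed.

Let near_sum_err (r : R) (Q : nat) : 0 < r -> r <= 1 ->
  `|\sum_(1 <= q < Q.+1) near_measure r q - 4 * pi * \sum_(1 <= q < Q.+1) farey_gap h r q|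
  <= 4 * pi * C * \sum_(1 <= q < Q.+1) (farey_gap h r q / q%:R).
Proof.
move=> r0 r1; rewrite !mulr_sumr -sumrB; apply: le_trans (ler_norm_sum _ _ _) _.
by apply: ler_sum_nat => q /andP[q0 _]; apply: near_measure_err => //; exact: ltW.
Qed.

(** The main term is 4 pi times r pi / 4. In the density error, the sum of gap / q is cut at m: each
    q <= m contributes at most sqrt (r h), and the others together at most r (pi / 4) / m. *)
Lemma farey_sum_err (r : R) (Q m : nat) : 0 < r -> r <= 1 ->
  r <= Q%:R ^+ 2 * h -> (0 < m)%N ->
  `|\sum_(1 <= k < Q.+1) farey_measure (r / k%:R ^+ 2) - pi ^+ 2 * r| <=
  4 * pi * Num.sqrt (r * h) +
  4 * pi * C * (m%:R * Num.sqrt (r * h) + r * (pi / 4) / m%:R).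
Proof.
move=> r0 r1 rQ m0; have pi0 := pi_gt0 R.
rewrite full_eq//; have /andP[lo hi] := sum_gap r0 rQ.
have := near_sum_err Q r0 r1.
set N := \sum_(1 <= q < Q.+1) near_measure r q.
set G := \sum_(1 <= q < Q.+1) farey_gap h r q in lo hi *.
set E := \sum_(1 <= q < Q.+1) (_ / _) => HE.
set sg := Num.sqrt (r * h) in lo *.
have sg0 : 0 <= sg by exact: sqrtr_ge0.
have m0' : 0 < m%:R :> R by rewrite ltr0n.
have EB : E <= m%:R * sg + r * (pi / 4) / m%:R.
  have : E <= \sum_(1 <= q < Q.+1) ((q <= m)%N%:R * sg + farey_gap h r q / m%:R).
    apply: ler_sum_nat => q /andP[q0 _].
    have gap0 : 0 <= farey_gap h r q by exact: sqrtr_ge0.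
    have gsg : farey_gap h r q <= sg.
      by rewrite ler_wsqrtr// gerBl sqr_ge0.
    have q1 : 1 <= q%:R :> R by rewrite ler1n.
    case: leqP => qm.
      rewrite mul1r -[leLHS]addr0 lerD ?divr_ge0//.
      by rewrite ler_pdivrMr ?ltr0n// (le_trans gsg)// ler_peMr.
    rewrite mul0r add0r ler_wpM2l// lef_pV2 ?posrE ?ltr0n//.
    by rewrite ler_nat ltnW.
  move/le_trans; apply; rewrite big_split/= -!mulr_suml lerD//; last first.
    by rewrite ler_pM2r ?invr_gt0.
  rewrite ler_wpM2r// -natr_sum ler_nat.
  by rewrite sum_leq_nat geq_minr.
have C4 : 0 <= 4 * pi * C by rewrite !mulr_ge0// ltW.
have HE' := le_trans HE (ler_wpM2l C4 EB).
have HG : `|4 * pi * G - pi ^+ 2 * r| <= 4 * pi * sg.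
  have -> : 4 * pi * G - pi ^+ 2 * r = 4 * pi * (G - r * (pi / 4)) by field.
  rewrite normrM ger0_norm ?mulr_ge0 ?(ltW pi0)// ler_pM2l ?mulr_gt0//.
  by rewrite ler_norml; lra.
rewrite -[N - _](subrKA (4 * pi * G)).
apply: le_trans (ler_normD _ _) _; by rewrite addrC lerD.
Qed.

(** Keeps only k = 1 in the sum over multiples. The linear bound, uniform in h, starts the Tauberian
    iteration and controls its tail. *)
Lemma farey_measure_le (r : R) : 0 < r -> r <= 1 ->
  farey_measure r <= pi ^+ 2 * (1 + C) * r.
Proof.
move=> r0 r1; have pi0 := pi_gt0 R.
pose Q := (Num.truncn (r / h)).+1.
have rQ : r <= Q%:R ^+ 2 * h.
  rewrite -ler_pdivrMr//; apply: le_trans (ltW (truncnS_gt _)) _.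
  by rewrite expr2 ler_peMr// ler1n.
have /andP[_ hi] := sum_gap r0 rQ.
have : farey_measure r <= \sum_(1 <= k < Q.+1) farey_measure (r / k%:R ^+ 2).
  rewrite big_ltn// expr1n divr1 lerDl sumr_ge0// => k _; exact: farey_measure_ge0.
rewrite full_eq// => /le_trans; apply.
have := near_sum_err Q r0 r1; rewrite ler_norml => /andP[_].
set E := \sum_(1 <= q < Q.+1) (_ / _).
have EB : E <= \sum_(1 <= q < Q.+1) farey_gap h r q.
  apply: ler_sum_nat => q /andP[q0 _]; rewrite ler_pdivrMr ?ltr0n//.
  by rewrite ler_peMr ?ler1n// sqrtr_ge0.
have C4 : 0 <= 4 * pi * C by rewrite !mulr_ge0// ltW.
have h1 := ler_wpM2l C4 (le_trans EB hi).
have h2 : 4 * pi * \sum_(1 <= q < Q.+1) farey_gap h r q <= 4 * pi * (r * (pi / 4)).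
  by rewrite ler_pM2l// mulr_gt0.
by rewrite lerBlDr => /le_trans; apply; move: h1 h2; rewrite expr2; lra.
Qed.

End FareyMeasure.

Section Tauberian.
Variable R : realType.

(** 1 / (a + 1)^2 <= 1 / a - 1 / (a + 1) telescopes. *)
Lemma sum_invsq_tail (m n : nat) : (0 < m)%N ->
  \sum_(m.+1 <= k < n) (k%:R ^+ 2)^-1 <= m%:R^-1 :> R.
Proof.
move=> m0; have [nm|mn] := leqP n m; first by rewrite big_geq ?invr_ge0// leqW.
have H j : \sum_(m.+1 <= k < j + m.+1) (k%:R ^+ 2)^-1 <= m%:R^-1 - (j + m)%:R^-1 :> R.
  elim: j => [|j IH]; first by rewrite big_geq// add0n subrr.
  rewrite addSn big_nat_recr/=; last by rewrite leq_addl.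
  apply: (le_trans (lerD IH (lexx _))).
  have a0 : 0 < (j + m)%:R :> R by rewrite ltr0n addn_gt0 m0 orbT.
  rewrite addnS addSn -natr1; set a : R := (j + m)%:R in a0 *.
  have a1 : 0 < a + 1 by rewrite addr_gt0.
  have : ((a + 1) ^+ 2)^-1 <= a^-1 - (a + 1)^-1.
    have -> : a^-1 - (a + 1)^-1 = (a * (a + 1))^-1.
      by clearbody a; field; rewrite !lt0r_neq0.
    rewrite lef_pV2 ?posrE ?mulr_gt0 ?exprn_gt0// expr2 ler_pM2r//; lra.
  by move: (((a + 1) ^+ 2)^-1) (a^-1) ((a + 1)^-1) => ? ? ?; lra.
rewrite -(subnK mn); apply: (le_trans (H _)).
by rewrite gerBl invr_ge0.
Qed.

Lemma sum_invsq_from2 (n : nat) : \sum_(2 <= k < n) (k%:R ^+ 2)^-1 <= 3 / 4 :> R.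
Proof.
have [n2|n2] := leqP n 2; first by rewrite big_geq//; lra.
rewrite big_ltn//; have := @sum_invsq_tail 2 n isT.
rewrite expr2; lra.
Qed.

(* Only [\sum_(k >= 2) k^-2 < 1] makes the self-consistent estimate contract. *)
Lemma tauberian (T : Type) (F : set_system T) (FF : Filter F) (D : T -> R -> R) (M : R) :
  0 < M ->
  (\forall t \near F, forall r, 0 < r -> r <= 1 -> 0 <= D t r <= M * r) ->
  (forall r d (K : nat), 0 < r -> r <= 1 -> 0 < d -> \forall t \near F,
    exists2 Q : nat, (K <= Q)%N &
      `|\sum_(1 <= k < Q.+1) D t (r / k%:R ^+ 2) - pi ^+ 2 * r| <= d * r) ->
  forall r e, 0 < r -> r <= 1 -> 0 < e -> \forall t \near F, `|D t r - 6 * r| <= e * r.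
Proof.
move=> M0 DM Dsum.
(* [S e] holds eventually for each r separately, so it can be used at finitely many r / k^2 only.
   Hence a cut K is fixed before t, while Q may depend on t; beyond K the crude bound takes over. *)
pose S (e : R) := forall r, 0 < r -> r <= 1 -> \forall t \near F, `|D t r - 6 * r| <= e * r.
have crude t : (forall r, 0 < r -> r <= 1 -> 0 <= D t r <= M * r) ->
    forall r, 0 < r -> r <= 1 -> `|D t r - 6 * r| <= (M + 6) * r.
  move=> H r r0 r1; have /andP[] := H r r0 r1; rewrite ler_norml mulrDl => ? ?.
  by have := mulr_gt0 M0 r0; lra.
have S0 : S (M + 6).
  by move=> r r0 r1; apply: filterS DM => t /crude; apply.
(* The budget: 3/4 e from 2 <= k <= K, e / 20 from the tail k > K, d = e / 80 from the hypothesis on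
   the sums and 6 d from the truncated Basel sum, in all 0.8875 e. *)
have contract e : 0 < e -> S e -> S (9 / 10 * e).
  move=> e0 Se r r0 r1.
  pose d := e / 80.
  have d0 : 0 < d by rewrite divr_gt0.
  have [K1 basel] := sum_invsq_cvg d0.
  pose K := (maxn K1 (Num.truncn (20 * (M + 6) / e)).+1).
  have K0 : (0 < K)%N by rewrite leq_max orbT.
  have tail : (M + 6) / K%:R <= e / 20.
    rewrite ler_pdivrMr ?ltr0n// mulrC -ler_pdivrMr ?divr_gt0//.
    rewrite (_ : _ / _ = 20 * (M + 6) / e); last by field; rewrite gt_eqF.
    apply: le_trans (ltW (truncnS_gt _)) _.
    by rewrite ler_nat leq_max leqnn orbT.
  have sm : \forall t \near F, forall k : 'I_K.+1, (0 < k)%N ->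
      `|D t (r / k%:R ^+ 2) - 6 * (r / k%:R ^+ 2)| <= e * (r / k%:R ^+ 2).
    apply: filter_forall => k.
    have [k0|k0] := posnP k; first by near=> t; rewrite k0.
    have kr : 0 < r / k%:R ^+ 2 by rewrite divr_gt0// exprn_gt0// ltr0n.
    have kr1 : r / k%:R ^+ 2 <= 1.
      rewrite ler_pdivrMr ?exprn_gt0 ?ltr0n// mul1r (le_trans r1)//.
      by rewrite exprn_ege1// ler1n.
    by apply: filterS (Se _ kr kr1).
  have := Dsum r d K r0 r1 d0.
  apply: filter_app; near=> t => -[Q KQ HQ].
  have {}DMt : forall r, 0 < r -> r <= 1 -> 0 <= D t r <= M * r by near: t.
  have smt : forall k : 'I_K.+1, (0 < k)%N ->
      `|D t (r / k%:R ^+ 2) - 6 * (r / k%:R ^+ 2)| <= e * (r / k%:R ^+ 2) by near: t.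
  have K1Q : (K1 <= Q)%N by apply: leq_trans KQ; rewrite leq_maxl.
  have /andP[blo bhi] := basel Q K1Q.
  have Q0 : (0 < Q)%N by apply: leq_trans KQ.
  pose dk k := D t (r / k%:R ^+ 2) - 6 * (r / k%:R ^+ 2).
  have rest : `|\sum_(2 <= k < Q.+1) dk k| <= e * (3 / 4) * r + e / 20 * r.
    apply: le_trans (ler_norm_sum _ _ _) _.
    have le1 : \sum_(2 <= k < Q.+1) `|dk k| <=
        \sum_(2 <= k < Q.+1) (e * r * (k%:R ^+ 2)^-1) +
        \sum_(K.+1 <= k < Q.+1) ((M + 6) * r * (k%:R ^+ 2)^-1).
      have bnd k : (0 < k)%N -> `|dk k| <= (M + 6) * r * (k%:R ^+ 2)^-1.
        move=> k0; rewrite -mulrA; apply: crude => //.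
          by rewrite divr_gt0// exprn_gt0// ltr0n.
        rewrite ler_pdivrMr ?exprn_gt0 ?ltr0n// mul1r (le_trans r1)//.
        by rewrite exprn_ege1// ler1n.
      have bnd' k : (0 < k)%N -> (k < K.+1)%N -> `|dk k| <= e * r * (k%:R ^+ 2)^-1.
        by move=> k0 kK; rewrite -mulrA; apply: (smt (Ordinal kK)).
      have pos k : 0 <= e * r * (k%:R ^+ 2)^-1.
        by rewrite mulr_ge0 ?invr_ge0 ?sqr_ge0// ltW// mulr_gt0.
      have [K2|K2] := leqP 2 K.+1.
        rewrite [leLHS](@big_cat_nat _ _ _ K.+1)//= [X in _ <= X + _](@big_cat_nat _ _ _ K.+1)//=.
        rewrite -addrA lerD//.
          by apply: ler_sum_nat => k /andP[k2 kK]; apply: bnd' => //; exact: ltnW.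
        apply: ler_wpDl; first by apply: sumr_ge0.
        by apply: ler_sum_nat => k /andP[kK _]; apply: bnd; exact: leq_ltn_trans kK.
      by move: K2; rewrite ltnS ltnNge K0.
    apply: (le_trans le1); rewrite -!mulr_sumr; apply: lerD.
      have := ler_wpM2l (ltW (mulr_gt0 e0 r0)) (sum_invsq_from2 Q.+1).
      by move: (\sum_(2 <= i < Q.+1) _) => ?; lra.
    rewrite mulrAC ler_pM2r//; apply: le_trans tail; rewrite ler_pM2l ?addr_gt0//.
    exact: sum_invsq_tail.
  have split1 : D t r - 6 * r = (\sum_(1 <= k < Q.+1) D t (r / k%:R ^+ 2) - pi ^+ 2 * r)
      - 6 * r * (\sum_(1 <= k < Q.+1) (k%:R ^+ 2)^-1 - pi ^+ 2 / 6)
      - \sum_(2 <= k < Q.+1) dk k.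
    by rewrite sumrB !(@big_ltn _ _ _ 1)// expr1n divr1 invr1 -!mulr_sumr; field.
  rewrite split1; move: HQ rest; rewrite !ler_norml => /andP[? ?] /andP[? ?].
  set B := \sum_(1 <= k < Q.+1) _ in blo bhi *.
  have b1 : 0 <= r * (pi ^+ 2 / 6 - B) by rewrite mulr_ge0 ?(ltW r0)//; lra.
  have b2 : r * (pi ^+ 2 / 6 - B) <= r * d by rewrite ler_pM2l//; lra.
  have er := mulr_gt0 e0 r0.
  have dE : d * r = e * r / 80 by rewrite /d; field.
  by clearbody d B; apply/andP; split; lra.
move=> r e r0 r1 e0.
have Sn n : S ((9 / 10) ^+ n * (M + 6)).
  elim: n => [|n IH]; first by rewrite expr0 mul1r.
  by rewrite exprS -mulrA; apply: contract => //; rewrite mulr_gt0 ?exprn_gt0//; lra.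
have [n hn] : exists n, (9 / 10) ^+ n * (M + 6) <= e.
  have : (fun n => (9 / 10 : R) ^+ n) @ \oo --> (0 : R).
    by apply: cvg_expr; rewrite ger0_norm; lra.
  move/cvgrPdist_le => /(_ (e / (M + 6))).
  have Mp : 0 < M + 6 by rewrite addr_gt0.
  case; first by rewrite divr_gt0.
  move=> n _ /(_ n (leqnn n)) /=; rewrite sub0r normrN ger0_norm ?exprn_ge0//.
  by rewrite ler_pdivlMr// => ?; exists n.
apply: filterS (Sn n r r0 r1) => t /le_trans; apply.
by rewrite ler_pM2r.
Unshelve. all: by end_near. Qed.

End Tauberian.

(** The error bounds involve only [bm] and h, so the centre [al] may move freely and [be] may vary
    above [bm]. *)
Theorem farey_measure_cvg (R : realType) (T : Type) (F : set_system T)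
    (FF : Filter F) (al be h : T -> R) (bm : R) : 0 < bm ->
  (\forall t \near F, bm <= be t) -> (\forall t \near F, 0 < h t) ->
  h t @[t --> F] --> 0 ->
  farey_measure (al t) (be t) (h t) 1 @[t --> F] --> (6 : R).
Proof.
move=> bm0 bme hpos h0; have pi0 := pi_gt0 R.
pose C := bm^-1 + bm^-1 ^+ 2.
have C0 : 0 <= C by rewrite addr_ge0 ?sqr_ge0// invr_ge0 ltW.
have hsmall (d : R) : 0 < d -> \forall t \near F, h t <= d.
  move=> d0; move/cvgrPdist_le : h0 => /(_ d d0); apply: filterS => t.
  by rewrite sub0r normrN; apply: le_trans; rewrite ler_norm.
have H : forall r e, 0 < r -> r <= 1 -> 0 < e -> \forall t \near F,
    `|farey_measure (al t) (be t) (h t) r - 6 * r| <= e * r.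
  apply: (@tauberian R T F FF (fun t => farey_measure (al t) (be t) (h t)) (pi ^+ 2 * (1 + C))).
  - by rewrite mulr_gt0 ?exprn_gt0//; lra.
  - near=> t => r r0 r1; rewrite farey_measure_ge0/=.
    apply: farey_measure_le => //; try by near: t.
    + by apply: (lt_le_trans bm0); near: t.
    + by near: t; apply: hsmall; rewrite invr_gt0.
  - move=> r d K r0 r1 d0.
    (* The cut m makes the term pi^2 C r / m at most d r / 2. The remaining terms are A * sqrt (r
       h), and the threshold [hd] brings them below d r / 2. *)
    pose m := (Num.truncn (2 * pi ^+ 2 * C / d)).+1.
    have m0 : 0 < m%:R :> R by rewrite ltr0n.
    have hm : pi ^+ 2 * C / m%:R <= d / 2.
      rewrite ler_pdivrMr// [leRHS]mulrC -ler_pdivrMr ?divr_gt0//.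
      rewrite (_ : _ / _ = 2 * pi ^+ 2 * C / d); last by field; rewrite gt_eqF.
      exact/ltW/truncnS_gt.
    pose A := 4 * pi + 4 * pi * C * m%:R.
    have A0 : 0 < A by rewrite ltr_wpDr ?mulr_gt0// !mulr_ge0// ltW.
    pose hd := (d / 2 / A) ^+ 2 * r.
    have hd0 : 0 < hd by rewrite mulr_gt0 ?exprn_gt0 ?divr_gt0.
    near=> t.
    have ht0 : 0 < h t by near: t.
    have htd : h t <= hd by near: t; apply: hsmall.
    pose Q := maxn K (Num.truncn (r / h t)).+1.
    exists Q; first exact: leq_maxl.
    have rQ : r <= Q%:R ^+ 2 * h t.
      rewrite -ler_pdivrMr//; apply: le_trans (ltW (truncnS_gt _)) _.
      have Q1 : 1 <= Q%:R :> R by rewrite ler1n leq_max orbT.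
      rewrite expr2 (le_trans _ (ler_peMr _ Q1))//.
      by rewrite ler_nat leq_max leqnn orbT.
    have be0 : 0 < be t by apply: (lt_le_trans bm0); near: t.
    have bmt : bm <= be t by near: t.
    have h4 : h t <= 4^-1 by near: t; apply: hsmall; rewrite invr_gt0.
    apply: le_trans (@farey_sum_err R (al t) (be t) (h t) be0 ht0 bm bm0 bmt h4 r Q m r0 r1 rQ isT) _.
    have sq : Num.sqrt (r * h t) <= d / 2 / A * r.
      have dA : 0 <= d / 2 / A * r by rewrite mulr_ge0 ?(ltW r0)// !divr_ge0// ltW.
      rewrite -[leRHS]ger0_norm// -sqrtr_sqr ler_wsqrtr//.
      rewrite (_ : (_ * r) ^+ 2 = r * hd); last by rewrite /hd; ring.
      by rewrite ler_pM2l.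
    have eA : A * (d / 2 / A * r) = d / 2 * r.
      by rewrite mulrA [A * _]mulrCA divff ?gt_eqF// mulr1.
    have := ler_wpM2l (ltW A0) sq; rewrite eA.
    have := ler_wpM2r (ltW r0) hm; rewrite -/C /A expr2; set sg := Num.sqrt _.
    have -> : r * (pi / 4) / m%:R = r * pi / m%:R / 4 by field; rewrite gt_eqF.
    have -> : pi * pi * C / m%:R * r = pi * C * (r * pi / m%:R) by ring.
    by move: (r * pi / m%:R) => z; lra.
apply/cvgrPdist_le => e e0.
have := H 1 e ltr01 (lexx 1) e0; rewrite !mulr1.
by apply: filterS => t; rewrite distrC.
Unshelve. all: by end_near. Qed.

(** * Circles as Lorentz vectors *)

Section Lorentz.
Local Open Scope complex_scope.
Variable R : realType.

(* [(b, x, y, c)] stands for the circle [b |z|^2 - 2 (x Re z + y Im z) + c = 0];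
   it has radius [1 / |b|] when [lform v v = 1]. *)
Definition vec : Type := (R * R * R * R)%type.
HB.instance Definition _ := GRing.Zmodule.on vec.
Implicit Types (u v w : vec) (p : sphere_pt R) (z : R[i]).

Definition lform v w : R :=
  v.1.1.2 * w.1.1.2 + v.1.2 * w.1.2 - (v.1.1.1 * w.2 + v.2 * w.1.1.1) / 2.

Lemma lformC v w : lform v w = lform w v.
Proof. rewrite /lform; ring. Qed.

Lemma lformDl u v w : lform (u + v) w = lform u w + lform v w.
Proof. rewrite /lform/=; ring. Qed.

Lemma lformDr u v w : lform w (u + v) = lform w u + lform w v.
Proof. by rewrite !(lformC w) lformDl. Qed.

Lemma lformNl v w : lform (- v) w = - lform v w.
Proof. rewrite /lform/=; ring. Qed.

Lemma lformNr v w : lform w (- v) = - lform w v.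
Proof. by rewrite !(lformC w) lformNl. Qed.

Lemma lform0l w : lform 0 w = 0.
Proof. rewrite /lform/=; ring. Qed.

Lemma lformMnl v w n : lform (v *+ n) w = lform v w *+ n.
Proof.
elim: n => [|n IH]; first by rewrite !mulr0n lform0l.
by rewrite !mulrS lformDl IH.
Qed.

Lemma lformMnr v w n : lform w (v *+ n) = lform w v *+ n.
Proof. by rewrite !(lformC w) lformMnl. Qed.

Definition point_vec p : vec :=
  if p is Some z
  then (1, complex.Re z, complex.Im z, complex.Re z ^+ 2 + complex.Im z ^+ 2)
  else (0, 0, 0, 1).

(** [v] and [- v] give the same circle and opposite sides, so a unit vector encodes an oriented
    circle. For [round_vec] the positive side is the bounded disk. *)
Definition circ v : set (sphere_pt R) := [set p | lform v (point_vec p) = 0].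
Definition disk v : set (sphere_pt R) := [set p | 0 < lform v (point_vec p)].

Definition round_vec z (r : R) : vec :=
  (r^-1, complex.Re z / r, complex.Im z / r,
   (complex.Re z ^+ 2 + complex.Im z ^+ 2 - r ^+ 2) / r).

Definition line_vec (a b c : R) : vec :=
  let k := Num.sqrt (a ^+ 2 + b ^+ 2) in (0, a / k, b / k, 2 * c / k).

Lemma cdistE z z' : cdist z z' = Num.sqrt ((complex.Re z' - complex.Re z) ^+ 2 +
  (complex.Im z' - complex.Im z) ^+ 2).
Proof. by case: z => a b; case: z' => c d. Qed.

Lemma lform_round z r z' : 0 < r -> lform (round_vec z r) (point_vec (Some z')) =
  (r ^+ 2 - cdist z z' ^+ 2) / (2 * r).
Proof.
move=> r0; rewrite cdistE sqr_sqrtr ?addr_ge0 ?sqr_ge0//.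
by rewrite /lform/=; field; rewrite gt_eqF.
Qed.

Lemma cdist_ge0 z z' : 0 <= cdist z z'.
Proof. by rewrite cdistE sqrtr_ge0. Qed.

Lemma lform_roundC z r : 0 < r -> lform (round_vec z r) (point_vec None) < 0.
Proof.
move=> r0; have ri : 0 < r^-1 by rewrite invr_gt0.
by rewrite /lform/=; lra.
Qed.

Lemma round_vec_unit z r : 0 < r -> lform (round_vec z r) (round_vec z r) = 1.
Proof. by move=> r0; rewrite /lform/=; field; rewrite gt_eqF. Qed.

Lemma line_vec_norm (a b : R) : (a, b) <> (0, 0) -> 0 < a ^+ 2 + b ^+ 2.
Proof.
move=> ab; rewrite lt_neqAle eq_sym addr_ge0 ?sqr_ge0// andbT.
rewrite paddr_eq0 ?sqr_ge0// !sqrf_eq0; apply/negP => /andP[/eqP a0 /eqP b0].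
by apply: ab; rewrite a0 b0.
Qed.

Lemma line_vec_unit a b c : (a, b) <> (0, 0) ->
  lform (line_vec a b c) (line_vec a b c) = 1.
Proof.
move=> /line_vec_norm h; rewrite /lform/=; set k := Num.sqrt _.
have k0 : 0 < k by rewrite sqrtr_gt0.
have k2 : a ^+ 2 + b ^+ 2 = k ^+ 2 by rewrite sqr_sqrtr// ltW.
transitivity ((a ^+ 2 + b ^+ 2) / k ^+ 2); first by field; rewrite gt_eqF.
by rewrite k2 divff// expf_neq0// gt_eqF.
Qed.

Lemma lform_line a b c z : (a, b) <> (0, 0) ->
  lform (line_vec a b c) (point_vec (Some z)) =
  (a * complex.Re z + b * complex.Im z - c) / Num.sqrt (a ^+ 2 + b ^+ 2).
Proof.
move=> /line_vec_norm h; rewrite /lform/=; set k := Num.sqrt _.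
have k0 : 0 < k by rewrite sqrtr_gt0.
by field; rewrite gt_eqF.
Qed.

Lemma lform_lineC a b c : lform (line_vec a b c) (point_vec None) = 0.
Proof. by rewrite /lform/=; ring. Qed.

Lemma round_circleE z r : 0 < r -> round_circle z r = circ (round_vec z r).
Proof.
move=> r0; have r2 : 0 < 2 * r by rewrite mulr_gt0.
apply/seteqP; split => [p [z' /= h <-]|[z'|]]; rewrite /circ /=.
- by rewrite lform_round// h subrr mul0r.
- rewrite lform_round// => /eqP; rewrite mulf_eq0 invr_eq0 (gt_eqF r2) orbF.
  rewrite subr_eq0 eqrXn2 ?cdist_ge0 ?(ltW r0)// => /eqP h.
  by exists z'.
- by have := lform_roundC z r0 => /[swap] ->; rewrite ltxx.
Qed.

Lemma round_diskE z r : 0 < r -> round_disk z r = disk (round_vec z r).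
Proof.
move=> r0; have r2 : 0 < 2 * r by rewrite mulr_gt0.
have key z' : (0 < lform (round_vec z r) (point_vec (Some z'))) = (cdist z z' < r).
  by rewrite lform_round// pmulr_lgt0 ?invr_gt0// subr_gt0 ltr_sqr ?nnegrE ?cdist_ge0 ?ltW.
apply/seteqP; split => [p [z' /= h <-]|[z'|]]; rewrite /disk /=.
- by rewrite key.
- by rewrite key => h; exists z'.
- by have := lform_roundC z r0; lra.
Qed.

Lemma round_exteriorE z r : 0 < r -> round_exterior z r = disk (- round_vec z r).
Proof.
move=> r0; have r2 : 0 < 2 * r by rewrite mulr_gt0.
have key z' : (0 < lform (- round_vec z r) (point_vec (Some z'))) = (r < cdist z z').
  rewrite lformNl oppr_gt0 lform_round// pmulr_llt0 ?invr_gt0// subr_lt0.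
  by rewrite ltr_sqr ?nnegrE ?cdist_ge0 ?ltW.
have := lform_roundC z r0 => hN.
apply/seteqP; split => [p [->|[z' /= h <-]]|[z'|]]; rewrite /disk /= ?lformNl ?oppr_gt0//.
- by rewrite -oppr_gt0 -lformNl key.
- by rewrite -oppr_gt0 -lformNl key => h; right; exists z'.
- by left.
Qed.

Lemma lineE a b c : (a, b) <> (0, 0) -> line a b c = circ (line_vec a b c).
Proof.
move=> ab; have k0 : 0 < Num.sqrt (a ^+ 2 + b ^+ 2) by rewrite sqrtr_gt0 line_vec_norm.
apply/seteqP; split => [p [->|[z' /= h <-]]|[z'|]]; rewrite /circ /= ?lform_lineC//.
- by rewrite lform_line// h subrr mul0r.
- rewrite lform_line// => /eqP; rewrite mulf_eq0 invr_eq0 (gt_eqF k0) orbF subr_eq0 => /eqP h.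
  by right; exists z'.
- by left.
Qed.

Lemma half_planeE a b c : (a, b) <> (0, 0) -> half_plane a b c = disk (- line_vec a b c).
Proof.
move=> ab; have k0 : 0 < Num.sqrt (a ^+ 2 + b ^+ 2) by rewrite sqrtr_gt0 line_vec_norm.
have key z' : (0 < lform (- line_vec a b c) (point_vec (Some z'))) =
    (a * complex.Re z' + b * complex.Im z' < c).
  by rewrite lformNl oppr_gt0 lform_line// pmulr_llt0 ?invr_gt0// subr_lt0.
apply/seteqP; split => [p [z' /= h <-]|[z'|]]; rewrite /disk /=.
- by rewrite key.
- by rewrite key => h; exists z'.
- by rewrite lformNl lform_lineC oppr0 ltxx.
Qed.

Lemma circN v : circ (- v) = circ v.
Proof.
apply/seteqP; split => p; rewrite /circ /= lformNl => /eqP; rewrite ?oppr_eq0 => /eqP //.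
by move=> ->; rewrite oppr0.
Qed.

Lemma is_circle_vec C : is_circle C -> exists2 v, lform v v = 1 & C = circ v.
Proof.
move=> [[z [r [r0 ->]]]|[a [b [c [ab ->]]]]].
  by exists (round_vec z r); [exact: round_vec_unit|exact: round_circleE].
by exists (line_vec a b c); [exact: line_vec_unit|exact: lineE].
Qed.

Lemma side_of_vec C D : side_of C D -> exists v, [/\ lform v v = 1, C = circ v & D = disk v].
Proof.
case=> [z r r0|z r r0|a b c ab].
- by exists (round_vec z r); rewrite round_vec_unit// round_circleE// round_diskE.
- exists (- round_vec z r).
  by rewrite lformNl lformNr opprK round_vec_unit// circN round_circleE// round_exteriorE.
- exists (- line_vec a b c).
  by rewrite lformNl lformNr opprK line_vec_unit// circN lineE// half_planeE.
Qed.

Lemma unit_vec_cases v : lform v v = 1 ->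
  [\/ exists z r, 0 < r /\ v = round_vec z r,
      exists z r, 0 < r /\ v = - round_vec z r |
      exists a b c, (a, b) <> (0, 0) /\ v = - line_vec a b c].
Proof.
case: v => [[[b x] y] c]; rewrite /lform/= => h.
have pos (b' x' y' c' : R) : 0 < b' -> x' * x' + y' * y' - (b' * c' + c' * b') / 2 = 1 ->
    (b', x', y', c') = round_vec ((x' / b') +i* (y' / b')) b'^-1.
  move=> b0 h'; rewrite /round_vec/=; congr (_, _, _, _); rewrite ?invrK ?divfK ?gt_eqF//.
  have -> : c' = (x' * x' + y' * y' - 1) / b'.
    by rewrite -h'; field; rewrite gt_eqF.
  by field; rewrite gt_eqF.
have [b0|b0|b0] := ltgtP b 0.
- apply: Or32; exists ((x / b) +i* (y / b)), (- b)^-1; split.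
    by rewrite invr_gt0 oppr_gt0.
  have := pos (- b) (- x) (- y) (- c); rewrite oppr_gt0 !mulrNN => /(_ b0 h) e.
  rewrite -!(divrNN _ b) -e -[RHS]/(- - b, - - x, - - y, - - c).
  by rewrite !opprK.
- by apply: Or31; exists ((x / b) +i* (y / b)), b^-1; rewrite invr_gt0; split => //; exact: pos.
- apply: Or33; exists (- x), (- y), (- c / 2).
  have n1 : x ^+ 2 + y ^+ 2 = 1 by move: h; rewrite b0 !expr2; lra.
  split; first by move=> [/eqP + /eqP]; rewrite !oppr_eq0 => /eqP x0 /eqP y0; move: n1;
    rewrite x0 y0 !expr0n addr0 => /eqP; rewrite eq_sym oner_eq0.
  rewrite /line_vec !sqrrN n1 sqrtr1 !divr1 b0.
  rewrite -[RHS]/(- 0, - - x, - - y, - (2 * (- c / 2))) oppr0.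
  by congr (_, _, _, _); rewrite ?opprK//; lra.
Qed.

Lemma side_of_disk v : lform v v = 1 -> side_of (circ v) (disk v).
Proof.
case/unit_vec_cases => [[z [r [r0 ->]]]|[z [r [r0 ->]]]|[a [b [c [ab ->]]]]].
- by rewrite -round_circleE// -round_diskE//; constructor.
- by rewrite circN -round_circleE// -round_exteriorE//; constructor.
- by rewrite circN -lineE// -half_planeE//; constructor.
Qed.

Lemma is_circle_circ v : lform v v = 1 -> is_circle (circ v).
Proof.
case/unit_vec_cases => [[z [r [r0 ->]]]|[z [r [r0 ->]]]|[a [b [c [ab ->]]]]].
- by left; exists z, r; rewrite round_circleE.
- by left; exists z, r; rewrite circN round_circleE.
- by right; exists a, b, c; rewrite circN lineE.
Qed.

(** For finite points the form is - |z - z'|^2 / 2; between a finite point and infinity it is - 1 /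
    2. *)
Lemma lform_points p p' : lform (point_vec p) (point_vec p') = 0 -> p = p'.
Proof.
case: p => [[a b]|]; case: p' => [[a' b']|] //; rewrite /lform/= => h;
  try by exfalso; move: h; lra.
have : (a - a') ^+ 2 + (b - b') ^+ 2 = 0 by move: h; rewrite !expr2; lra.
move/eqP; rewrite paddr_eq0 ?sqr_ge0// !sqrf_eq0 !subr_eq0.
by move=> /andP[/eqP -> /eqP ->].
Qed.

Lemma point_vec_null p : lform (point_vec p) (point_vec p) = 0.
Proof. by case: p => [z|]; rewrite /lform/=; field. Qed.

(* Null vectors are multiples of point vectors; the sign of the factor is the time orientation. *)
Lemma null_vec_point n : lform n n = 0 -> n <> 0 -> exists p (k : R),
  [/\ k != 0, 0 <= n.1.1.1 + n.2 -> 0 < k & forall w, lform w n = k * lform w (point_vec p)].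
Proof.
case: n => [[[b x] y] c]; rewrite {1}/lform/= => h n0.
have [b0|b0] := eqVneq b 0.
  have [x0 y0] : x = 0 /\ y = 0.
    have /eqP : x ^+ 2 + y ^+ 2 = 0 by move: h; rewrite b0 !expr2; lra.
    by rewrite paddr_eq0 ?sqr_ge0// !sqrf_eq0 => /andP[/eqP -> /eqP ->].
  have c0 : c != 0 by apply/eqP => c0; apply: n0; rewrite b0 x0 y0 c0.
  exists None, c; split => //; first by rewrite b0 add0r le_eqVlt eq_sym (negbTE c0).
  by move=> w; rewrite /lform/= b0 x0 y0; field.
have cE : c = (x ^+ 2 + y ^+ 2) / b.
  by apply: (mulIf b0); rewrite divfK//; move: h; rewrite !expr2; lra.
exists (Some ((x / b) +i* (y / b))), b; split => //.
  move=> bc; rewrite lt_neqAle eq_sym b0/= leNgt; apply/negP => bn.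
  suff : c <= 0 by move: bc bn; lra.
  by rewrite cE mulr_ge0_le0 ?addr_ge0 ?sqr_ge0// invr_le0 ltW.
by move=> w; rewrite /lform/= cE; field.
Qed.

(** [v + w] is a null vector, and its point is the tangency point: any common point of the circles
    is orthogonal to [v + w]. The condition [v + w <> 0] excludes one circle with its two
    orientations. *)
Lemma form_tangent v w : lform v v = 1 -> lform w w = 1 -> lform v w = -1 -> v + w <> 0 ->
  exists p (k : R), [/\ tangent_at p (circ v) (circ w), k != 0,
    0 <= (v + w).1.1.1 + (v + w).2 -> 0 < k &
    forall u, lform u (v + w) = k * lform u (point_vec p)].
Proof.
move=> vv ww vw vw0.
have n0 : lform (v + w) (v + w) = 0 by rewrite !(lformDl, lformDr) vv ww (lformC w v) vw; lra.
have [p [k [k0 kpos H]]] := null_vec_point n0 vw0.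
exists p, k; split => //; apply/seteqP; split => q.
  move=> [/= qv qw]; apply: lform_points; apply: (mulfI k0).
  by rewrite -H lformDr !(lformC (point_vec q)) qv qw addr0 mulr0.
move=> ->; split; rewrite /circ/=; apply: (mulfI k0); rewrite -H lformDr mulr0.
  by rewrite vv vw subrr.
by rewrite ww lformC vw addrC subrr.
Qed.

(** At a common point the form is the cosine of the angle between the unit normals (X, Y) and (X',
    Y'). Unless it is 1 or -1, the circles cross there and have a second common point. *)
Lemma tangent_form v w p : lform v v = 1 -> lform w w = 1 ->
  tangent_at p (circ v) (circ w) -> lform v w = 1 \/ lform v w = -1.
Proof.
move=> vv ww T.
have [pv pw] : circ v p /\ circ w p by have [] : (circ v `&` circ w) p by rewrite T.
have uniq q : circ v q -> circ w q -> q = p.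
  by move=> qv qw; have : (circ v `&` circ w) q by []; rewrite T.
have sq1 (x : R) : x ^+ 2 = 1 -> x = 1 \/ x = -1.
  by move/eqP; rewrite sqrf_eq1 => /orP[/eqP ->|/eqP ->]; [left|right].
case: p {T} pv pw uniq => [[p1 p2]|]; case: v vv => [[[b x] y] c];
  case: w ww => [[[b' x'] y'] c']; rewrite /circ /lform/= => ww vv pv pw uniq; apply: sq1.
- pose X := x - b * p1; pose Y := y - b * p2.
  pose X' := x' - b' * p1; pose Y' := y' - b' * p2.
  have N : X ^+ 2 + Y ^+ 2 = 1.
    by have := congr1 ( *%R b) pv; move: vv; rewrite /X /Y !expr2; lra.
  have N' : X' ^+ 2 + Y' ^+ 2 = 1.
    by have := congr1 ( *%R b') pw; move: ww; rewrite /X' /Y' !expr2; lra.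
  set g := (X in X ^+ 2); have gE : g = X * X' + Y * Y'.
    have := congr1 ( *%R b') pv; have := congr1 ( *%R b) pw.
    by rewrite /g /X /Y /X' /Y' !expr2; lra.
  pose D := X * Y' - X' * Y.
  suff D0 : D = 0.
    have -> : g ^+ 2 = (X ^+ 2 + Y ^+ 2) * (X' ^+ 2 + Y' ^+ 2) - D ^+ 2 by rewrite gE /D; ring.
    by rewrite N N' D0 expr0n subr0 mulr1.
  apply/eqP/negP => /negP D0.
  (* Inversion about p turns the circles into the lines with normals (X, Y), (X', Y') and constants
     b / 2, b' / 2. They meet at o, by Cramer's rule, so p + o / |o|^2 is a second common point. If
     o = 0 both circles are lines and also meet at infinity. *)
  pose o1 := (b * Y' - b' * Y) / (2 * D); pose o2 := (X * b' - X' * b) / (2 * D).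
  have E1 : X * o1 + Y * o2 = b / 2.
    transitivity (b * (X * Y' - X' * Y) / (2 * D)); first by rewrite /o1 /o2; ring.
    by rewrite -/D; field.
  have E2 : X' * o1 + Y' * o2 = b' / 2.
    transitivity (b' * (X * Y' - X' * Y) / (2 * D)); first by rewrite /o1 /o2; ring.
    by rewrite -/D; field.
  have [oo|oo] := eqVneq (o1 ^+ 2 + o2 ^+ 2) 0.
    have [ zo1 zo2] : o1 = 0 /\ o2 = 0.
      by move/eqP: oo; rewrite paddr_eq0 ?sqr_ge0// !sqrf_eq0 => /andP[/eqP -> /eqP ->].
    have b0 : b = 0 by move: E1; rewrite zo1 zo2; lra.
    have b'0 : b' = 0 by move: E2; rewrite zo1 zo2; lra.
    suff : None = Some (p1 +i* p2) :> sphere_pt R by [].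
    by apply: uniq; rewrite /= ?b0 ?b'0; field.
  set q := o1 ^+ 2 + o2 ^+ 2 in oo.
  have : Some ((p1 + o1 / q) +i* (p2 + o2 / q)) = Some (p1 +i* p2).
    have T2 : (o1 / q) ^+ 2 + (o2 / q) ^+ 2 = q^-1.
      by transitivity ((o1 ^+ 2 + o2 ^+ 2) / q ^+ 2); [field|rewrite -/q; field].
    have T1 : X * (o1 / q) + Y * (o2 / q) = b / 2 * q^-1 by rewrite -E1; ring.
    have T1' : X' * (o1 / q) + Y' * (o2 / q) = b' / 2 * q^-1 by rewrite -E2; ring.
    move: T1 T1' T2; rewrite /X /Y /X' /Y'.
    move: (o1 / q) (o2 / q) (q^-1) => t1 t2 iq T1 T1' T2.
    apply: uniq; rewrite /circ /lform/=.
      by have := congr1 ( *%R b) T2; move: pv T1; rewrite !expr2; lra.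
    by have := congr1 ( *%R b') T2; move: pw T1'; rewrite !expr2; lra.
  case=> e1 e2.
  have zo1 : o1 = 0.
    by apply: (mulIf (invr_neq0 oo)); rewrite mul0r; move: (o1 / q) e1 => t; lra.
  have zo2 : o2 = 0.
    by apply: (mulIf (invr_neq0 oo)); rewrite mul0r; move: (o2 / q) e2 => t; lra.
  by move: oo; rewrite /q zo1 zo2 !expr0n addr0 eqxx.
- have b0 : b = 0 by move: pv; lra.
  have b'0 : b' = 0 by move: pw; lra.
  have N : x ^+ 2 + y ^+ 2 = 1 by move: vv; rewrite b0 !expr2; lra.
  have N' : x' ^+ 2 + y' ^+ 2 = 1 by move: ww; rewrite b'0 !expr2; lra.
  pose D := x * y' - x' * y.
  suff D0 : D = 0.
    have -> : (x * x' + y * y' - (b * c' + c * b') / 2) ^+ 2 =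
        (x ^+ 2 + y ^+ 2) * (x' ^+ 2 + y' ^+ 2) - D ^+ 2 by rewrite b0 b'0 /D; field.
    by rewrite N N' D0 expr0n subr0 mulr1.
  apply/eqP/negP => /negP D0.
  (* Two lines that are not parallel meet at this finite point as well as at infinity. *)
  pose o1 := (c * y' - c' * y) / (2 * D); pose o2 := (x * c' - x' * c) / (2 * D).
  have E1 : x * o1 + y * o2 = c / 2.
    transitivity (c * (x * y' - x' * y) / (2 * D)); first by rewrite /o1 /o2; ring.
    by rewrite -/D; field.
  have E2 : x' * o1 + y' * o2 = c' / 2.
    transitivity (c' * (x * y' - x' * y) / (2 * D)); first by rewrite /o1 /o2; ring.
    by rewrite -/D; field.
  have := uniq (Some (o1 +i* o2)); rewrite /circ /lform/= b0 b'0 => H.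
  suff : Some (o1 +i* o2) = None :> sphere_pt R by [].
  by apply: H; [rewrite E1|rewrite E2]; field.
Qed.

Let circ_pts (b x y c : R) (s1 s2 : R) : b != 0 ->
  lform ((b, x, y, c) : vec) (b, x, y, c) = 1 -> s1 ^+ 2 + s2 ^+ 2 = 1 ->
  circ (b, x, y, c) (Some (((x + s1) / b) +i* ((y + s2) / b))).
Proof.
move=> b0; rewrite /circ /lform/= => h s.
transitivity ((x * x + y * y - (b * c + c * b) / 2 - (s1 ^+ 2 + s2 ^+ 2)) / (2 * b)).
  by field.
by rewrite h s subrr mul0r.
Qed.

(** Rules out that a circle is tangent to itself in the sense of [tangent_at]. *)
Lemma circ_not_singleton v p : lform v v = 1 -> circ v <> [set p].
Proof.
case: v => [[[b x] y] c] vv h.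
have [b0|b0] := eqVneq b 0.
  have : circ (b, x, y, c) None by rewrite /circ/= /lform/= b0; ring.
  have : circ (b, x, y, c) (Some ((x * c / 2) +i* (y * c / 2))).
    move: vv; rewrite /circ/= /lform/= b0 => vv.
    transitivity ((x * x + y * y - (0 * c + c * 0) / 2 - 1) * c / 2); first by field.
    by rewrite vv subrr !mul0r.
  by rewrite h /= => <-.
have := circ_pts b0 vv (_ : 1 ^+ 2 + 0 ^+ 2 = 1).
have := circ_pts b0 vv (_ : (- 1) ^+ 2 + 0 ^+ 2 = 1).
rewrite h /= => H1 H2.
have : Some (((x - 1) / b) +i* ((y + 0) / b)) = Some (((x + 1) / b) +i* ((y + 0) / b)) :> sphere_pt R.
  by rewrite H1 ?H2//; rewrite ?expr1n ?sqrrN ?expr1n ?expr0n ?addr0.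
case=> /(mulIf _) => /(_ (invr_neq0 b0)); lra.
Qed.

Lemma circ_inj v w : lform v v = 1 -> lform w w = 1 -> circ v = circ w -> v = w \/ v = - w.
Proof.
case: v => [[[b x] y] c]; case: w => [[[b' x'] y'] c'] vv ww e.
have sub p : circ (b, x, y, c) p -> circ (b', x', y', c') p by rewrite e.
suff [k [kb kx ky kc]] : exists k : R, [/\ b' = k * b, x' = k * x, y' = k * y & c' = k * c].
  rewrite kb kx ky kc in ww *.
  have /eqP : k ^+ 2 = 1.
    by rewrite -ww -[LHS]mulr1 -[in LHS]vv /lform/=; ring.
  rewrite sqrf_eq1 => /orP[/eqP ->|/eqP ->]; [left|right]; rewrite ?mul1r//.
  by rewrite -[RHS]/(- (-1 * b), - (-1 * x), - (-1 * y), - (-1 * c)) !mulN1r !opprK.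
have [b0|b0] := eqVneq b 0.
  have : circ (b', x', y', c') None by apply: sub; rewrite /circ/= /lform/= b0; ring.
  rewrite /circ/= /lform/= => b'0.
  have {}b'0 : b' = 0 by move: b'0; lra.
  have n1 : x ^+ 2 + y ^+ 2 = 1 by move: vv; rewrite /lform/= b0 !expr2; lra.
  have P (t : R) : circ (b', x', y', c') (Some ((x * c / 2 - y * t) +i* (y * c / 2 + x * t))).
    apply: sub; rewrite /circ/= /lform/= b0.
    transitivity ((x ^+ 2 + y ^+ 2 - 1) * c / 2); first by field.
    by rewrite n1 subrr !mul0r.
  have := P 0; have := P 1; rewrite /circ/= /lform/= b'0 => P1 P0.
  have D : x * y' = y * x' by move: P1 P0; lra.
  have P0' : (x * x' + y * y') * c = c' by move: P0; lra.
  exists (x * x' + y * y'); split; first by rewrite b0 ?b'0 mulr0.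
  - rewrite -[LHS]mul1r -n1; transitivity (x ^+ 2 * x' + y * (y * x')); first by ring.
    by rewrite -D; ring.
  - rewrite -[LHS]mul1r -n1; transitivity (x * (x * y') + y ^+ 2 * y'); first by ring.
    by rewrite D; ring.
  - by rewrite P0'.
(* On the points of [circ v] in the direction (s1, s2) from the centre, the equation of [circ w]
   becomes affine in (s1, s2). Three directions make its coefficients vanish, so w = k v. *)
pose k := b' / b; pose K := x' * x + y' * y - (k * (x ^+ 2 + y ^+ 2 + 1) + c' * b) / 2.
have P (s1 s2 : R) : s1 ^+ 2 + s2 ^+ 2 = 1 -> (x' - k * x) * s1 + (y' - k * y) * s2 + K = 0.
  move=> s; have := sub _ (circ_pts b0 vv s); rewrite /circ/= /lform/= => h.
  have -> : K = x' * x + y' * y - (k * (x ^+ 2 + y ^+ 2 + (s1 ^+ 2 + s2 ^+ 2)) + c' * b) / 2.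
    by rewrite s.
  by rewrite -[RHS](mulr0 b) -h /k; field.
have := P 1 0; have := P (-1) 0; have := P 0 1.
rewrite sqrrN !expr1n !expr0n !addr0 !add0r.
move=> /(_ erefl) P3 /(_ erefl) P2 /(_ erefl) P1.
have K0 : K = 0 by move: P1 P2; lra.
have xE : x' = k * x by move: P1; rewrite K0; lra.
have yE : y' = k * y by move: P3; rewrite K0; lra.
exists k; split => //; first by rewrite divfK.
apply: (mulIf b0); move: K0 vv; rewrite /K /lform/= xE yE => K0 vv.
have : c' * b = k * (x ^+ 2 + y ^+ 2) - k by move: K0; rewrite !expr2; lra.
by move=> ->; rewrite -[X in _ - X]mulr1 -[X in _ - k * X]vv; field.
Qed.

End Lorentz.

(** * The orbit of a Descartes configuration *)

Section Frames.
Variable R : realType.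
Local Notation vec := (vec R).
Implicit Types (u v w : vec) (q : 'I_4 -> vec) (i j k : 'I_4).

Lemma lform_sumr (I : Type) (s : seq I) (F : I -> vec) w :
  lform w (\sum_(i <- s) F i) = \sum_(i <- s) lform w (F i).
Proof.
elim/big_rec2: _ => [|i x y _ IH]; first by rewrite lformC lform0l.
by rewrite lformDr IH.
Qed.

(* Four pairwise tangent circles, oriented to have disjoint open disks. *)
Definition is_frame q := forall i j, lform (q i) (q j) = if i == j then 1 else -1.

(* By Descartes' theorem, [swap q k k] is the second circle tangent to the other three. *)
Definition swap q k : 'I_4 -> vec :=
  fun j => if j == k then (\sum_i q i) *+ 2 - q k *+ 3 else q j.

Lemma frame_sum q k : is_frame q -> lform (q k) (\sum_i q i) = -2.
Proof.
move=> fq; rewrite lform_sumr (bigD1 k)//= fq eqxx.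
rewrite (eq_bigr (fun=> -1)); last by move=> i ik; rewrite fq eq_sym (negbTE ik).
rewrite sumr_const (_ : #|_| = 3%N); first by rewrite mulrSr mulr2n; lra.
by rewrite cardC1 card_ord.
Qed.

Lemma swap_same q k : swap q k k = (\sum_i q i) *+ 2 - q k *+ 3.
Proof. by rewrite /swap eqxx. Qed.

Lemma swap_other q k j : j != k -> swap q k j = q j.
Proof. by rewrite /swap => /negbTE ->. Qed.

Lemma lform_swap q k w : lform w (swap q k k) =
  (\sum_i lform w (q i)) *+ 2 - lform w (q k) *+ 3.
Proof. by rewrite swap_same lformDr lformNr !lformMnr lform_sumr. Qed.

Lemma lform_swap_self q k : is_frame q -> lform (q k) (swap q k k) = -7.
Proof. by move=> fq; rewrite lform_swap -lform_sumr frame_sum// fq eqxx; lra. Qed.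

Lemma swap_frame q k : is_frame q -> is_frame (swap q k).
Proof.
move=> fq.
have nj j : j != k -> lform (q j) (swap q k k) = -1.
  by move=> jk; rewrite lform_swap -lform_sumr frame_sum// fq (negbTE jk); lra.
move=> i j; have [->|ik] := eqVneq i k; have [->|jk] := eqVneq j k; rewrite ?eqxx.
- rewrite lform_swap -lform_sumr {1}swap_same lformDl lformNl !lformMnl.
  rewrite frame_sum// lform_sumr (eq_bigr (fun=> -2)); last by move=> l _; rewrite lformC frame_sum.
  rewrite sumr_const card_ord lformC lform_swap_self//; lra.
- by rewrite ?(eq_sym k) ?(negbTE jk) (swap_other _ jk) lformC nj.
- by rewrite ?(negbTE ik) (swap_other _ ik) nj.
- by rewrite !swap_other.
Qed.

Lemma swap_involutive q k : swap (swap q k) k = q.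
Proof.
apply: funext => j; have [->|jk] := eqVneq j k; last by rewrite !swap_other.
rewrite swap_same (bigD1 k)//= (eq_bigr q); last by move=> i ik; rewrite swap_other.
rewrite swap_same [in RHS](_ : q k = (\sum_i q i) - \sum_(i | i != k) q i); last first.
  by rewrite [X in X - _](bigD1 k)//= addrK.
set S := \sum_i q i; have -> : \sum_(i < 4 | i != k) q i = S - q k.
  by rewrite /S [X in _ = X - _](bigD1 k)//= addrAC subrr add0r.
move: S (q k) => S x; case: S => [[[? ?] ?] ?]; case: x => [[[? ?] ?] ?].
by rewrite !mulrS !mulr0n; congr (_, _, _, _) => /=; ring.
Qed.

Inductive reach (q0 : 'I_4 -> vec) : ('I_4 -> vec) -> Prop :=
| reach_refl : reach q0 q0
| reach_swap q k : reach q0 q -> reach q0 (swap q k).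

Lemma reach_frame q0 q : is_frame q0 -> reach q0 q -> is_frame q.
Proof. by move=> f0; elim=> // q' k _; exact: swap_frame. Qed.

Lemma reach_trans q0 q1 q : reach q0 q1 -> reach q1 q -> reach q0 q.
Proof. by move=> h; elim=> // q' k _; exact: reach_swap. Qed.

Lemma reach_sym q0 q : reach q0 q -> reach q q0.
Proof.
elim=> [|q' k _ IH]; first exact: reach_refl.
apply: reach_trans IH; rewrite -{2}(swap_involutive q' k); apply: reach_swap.
exact: reach_refl.
Qed.

(* Paths without backtracking, together with the index of the last swap. *)
Inductive reduced (q0 : 'I_4 -> vec) : ('I_4 -> vec) -> option 'I_4 -> Prop :=
| reduced_refl : reduced q0 q0 None
| reduced_swap q o k : reduced q0 q o -> o <> Some k -> reduced q0 (swap q k) (Some k).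

Lemma reduced_reach q0 q o : reduced q0 q o -> reach q0 q.
Proof. by elim=> [|q' lo k _ IH _]; [exact: reach_refl|exact: reach_swap]. Qed.

Lemma reach_reduced q0 q : reach q0 q -> exists o, reduced q0 q o.
Proof.
elim=> [|q' k _ [lo h]]; first by exists None; exact: reduced_refl.
have [ok|ok] := eqVneq lo (Some k); last by exists (Some k); apply: reduced_swap h _; exact/eqP.
move: ok; case: h => // q1 lo1 k1 h1 _ [<-].
by exists lo1; rewrite swap_involutive.
Qed.

(* A linear form that is nonnegative on a frame and at least the sum of the
   others on the last swapped vector keeps growing along a reduced path. *)
Lemma reduced_escape q0 u (T : R) (A : ('I_4 -> vec) -> Prop) :
  let F v := - lform v u in
  let B q k := [/\ forall j, 0 <= F (q j), T <= F (q k) & \sum_(j | j != k) F (q j) <= F (q k)] in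
  A q0 -> (forall q k, reach q0 q -> A q -> A (swap q k) \/ B (swap q k) k) ->
  forall q, reach q0 q -> forall j, T <= F (q j) \/
    exists q' j', [/\ reach q0 q', A q' & q j = q' j'].
Proof.
move=> F B A0 AB q /reach_reduced [lo hq].
(* A vector on which F is still below T must already occur in a frame satisfying A; this is what
   traces a small pairing back to a known frame. *)
pose old v := T <= F v \/ exists q' j', [/\ reach q0 q', A q' & v = q' j'].
suff : A q \/ exists2 k, lo = Some k & B q k /\ forall j, old (q j).
  move=> [Aq|[k _ [_ ?]]] // j; right; exists q, j; split => //; exact: reduced_reach hq.
elim: hq => [|{}q {}lo k hq IH ok]; first by left.
have rq := reduced_reach hq.
case: IH => [Aq|[i li [[F0 Ti Si] Oq]]].
  have [?|Bq] := AB q k rq Aq; first by left.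
  right; exists k => //; split => // j; have [->|jk] := eqVneq j k.
    by left; case: Bq.
  by rewrite swap_other//; right; exists q, j.
right; exists k => //.
have ki : k != i by apply/eqP => ki; apply: ok; rewrite li ki.
(* Let S be the sum of the F (q j). As k differs from the last swapped index i, F (q i) >= F (q k) +
   (the rest), so S >= 2 F (q k). The new value 2 S - 3 F (q k) is therefore at least S - F (q k),
   the sum of the other three. *)
have Fk : F (swap q k k) = (\sum_i F (q i)) *+ 2 - F (q k) *+ 3.
  rewrite /F lformC lform_swap sumrN; under eq_bigr do rewrite lformC.
  by rewrite (lformC u (q k)); lra.
have S1 : \sum_j F (q j) = F (q i) + F (q k) + \sum_(j | (j != i) && (j != k)) F (q j).
  by rewrite (bigD1 i)//= (bigD1 k)//= addrA.
have S2 : \sum_j F (q j) = F (q i) + \sum_(j | j != i) F (q j) by rewrite (bigD1 i).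
have S3 : \sum_j F (q j) = F (q k) + \sum_(j | j != k) F (q j) by rewrite (bigD1 k).
have R0 : 0 <= \sum_(j | (j != i) && (j != k)) F (q j) by apply: sumr_ge0.
have S4 : \sum_(j | j != k) F (swap q k j) = \sum_(j | j != k) F (q j).
  by apply: eq_bigr => j jk; rewrite swap_other.
have Fi0 := F0 i; have Fk0 := F0 k.
have big : \sum_(j | j != k) F (q j) <= F (swap q k k) by rewrite Fk; lra.
have Tk : T <= F (swap q k k) by apply: le_trans big; lra.
split; last first.
  move=> j; have [->|jk] := eqVneq j k; first by left.
  by rewrite swap_other.
split => //; last by rewrite S4.
move=> j; have [->|jk] := eqVneq j k; last by rewrite swap_other.
by apply: le_trans big; apply: sumr_ge0.
Qed.

End Frames.

Section Parseval.
Variable R : realType.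
Local Notation vec := (vec R).
Implicit Types (u v w : vec) (q : 'I_4 -> vec) (i j k l : 'I_4).

Let coord v : 'rV[R]_4 := \row_j nth 0 [:: v.1.1.1; v.1.1.2; v.1.2; v.2] j.
Let formmx : 'M[R]_4 := \matrix_(i, j)
  match nat_of_ord i, nat_of_ord j with
  | 0, 3 | 3, 0 => - 2^-1 | 1, 1 | 2, 2 => 1 | _, _ => 0
  end.

Let lformE u v : lform u v = (coord u *m formmx *m (coord v)^T) 0 0.
Proof.
by rewrite !mxE !big_ord_recl !big_ord0 !mxE !big_ord_recl !big_ord0 !mxE /lform/=; field.
Qed.

(* The Gram matrix [2 I - J] of a frame has inverse [I / 2 - J / 4]. *)
Lemma frame_parseval q u v : is_frame q ->
  lform u v = (\sum_i lform u (q i) * lform v (q i)) / 2 -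
              (\sum_i lform u (q i)) * (\sum_i lform v (q i)) / 4.
Proof.
move=> fq; pose M : 'M[R]_4 := \matrix_i coord (q i).
pose G : 'M[R]_4 := \matrix_(i, j) (if i == j then 1 else -1).
pose H : 'M[R]_4 := \matrix_(i, j) (if i == j then 4^-1 else - 4^-1).
have MF w i : (coord w *m formmx *m M^T) 0 i = lform w (q i).
  by rewrite lformE !mxE; apply: eq_bigr => j _; rewrite !mxE.
have MG : M *m formmx *m M^T = G.
  apply/matrixP => i j; rewrite [RHS]mxE -fq lformE !mxE.
  apply: eq_bigr => l _; rewrite [in RHS]mxE; congr (_ * _); last by rewrite !mxE.
  by rewrite !mxE; apply: eq_bigr => l' _; rewrite !mxE.
have GH : G *m H = 1%:M.
  apply/matrixP => i j; rewrite !mxE !big_ord_recl big_ord0 !mxE.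
  by case: i => -[|[|[|[|//]]]] hi; case: j => -[|[|[|[|//]]]] hj;
    rewrite -!val_eqE/=; field.
(* A one-sided inverse of a square matrix is two-sided: the Gram identity becomes a resolution of
   the identity. *)
have HM : formmx *m M^T *m H *m M = 1%:M by apply: mulmx1C; rewrite !mulmxA MG GH.
have FMT : formmx^T = formmx.
  apply/matrixP => i j; rewrite !mxE.
  by case: i => -[|[|[|[|//]]]] hi; case: j => -[|[|[|[|//]]]] hj.
have -> : lform u v = ((coord u *m formmx *m M^T) *m H *m (coord v *m formmx *m M^T)^T) 0 0.
  rewrite lformE !trmx_mul trmxK FMT -!mulmxA; congr ((_ *m _) 0 0).
  by rewrite !mulmxA HM mul1mx.
have aE w : coord w *m formmx *m M^T = \row_i lform w (q i).
  by apply/rowP => i; rewrite MF mxE.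
rewrite !aE.
rewrite !mxE !big_ord_recl !big_ord0 !mxE !big_ord_recl !big_ord0 !mxE -!val_eqE /=.
by field.
Qed.

End Parseval.

Section FrameGeometry.
Variable R : realType.
Local Notation vec := (vec R).
Implicit Types (u v w : vec) (q : 'I_4 -> vec) (i j k l : 'I_4).

Lemma lform_nondegenerate v : (forall w, lform v w = 0) -> v = 0.
Proof.
case: v => [[[b x] y] c] h.
have := h (1, 0, 0, 0); have := h (0, 1, 0, 0); have := h (0, 0, 1, 0); have := h (0, 0, 0, 1).
rewrite /lform/= => h1 h2 h3 h4.
have -> : b = 0 by lra.
have -> : x = 0 by lra.
have -> : y = 0 by lra.
by have -> : c = 0 by lra.
Qed.

Lemma frame_ext q u v : is_frame q -> (forall i, lform u (q i) = lform v (q i)) -> u = v.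
Proof.
move=> fq h; apply/eqP; rewrite -subr_eq0; apply/eqP/lform_nondegenerate => w.
rewrite (frame_parseval _ _ fq).
have z i : lform (u - v) (q i) = 0 by rewrite lformDl lformNl h subrr.
have -> : \sum_i lform (u - v) (q i) = 0 by rewrite big1.
rewrite big1 ?mul0r ?subrr// => i _; by rewrite z mul0r.
Qed.

Lemma ord4_others k : exists i j l, uniq [:: k; i; j; l].
Proof.
pose a : 'I_4 := @Ordinal 4 0 isT; pose b : 'I_4 := @Ordinal 4 1 isT.
pose c : 'I_4 := @Ordinal 4 2 isT; pose d : 'I_4 := @Ordinal 4 3 isT.
by case: k => -[|[|[|[|//]]]] hk; [exists b, c, d|exists a, c, d|exists a, b, d|exists a, b, c].
Qed.

Lemma ord4_others2 i0 i1 : i0 != i1 -> exists j l, uniq [:: i0; i1; j; l].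
Proof.
have [i [j [l]]] := ord4_others i0; rewrite /= !inE !negb_or => /and3P[/and3P[ni nj nl] /andP[ij il]].
rewrite andbT => jl n1.
have [e1|n2] := eqVneq i1 i; first by exists j, l; rewrite e1 !inE !negb_or ni nj nl ij il jl.
have [e1|n3] := eqVneq i1 j.
  by exists i, l; rewrite e1 !inE !negb_or ni nj nl il jl (eq_sym j) ij.
by exists i, j; rewrite !inE !negb_or n1 ni nj n2 n3 ij.
Qed.

Lemma ord4_others3 i0 i1 i2 : uniq [:: i0; i1; i2] -> exists l, uniq [:: i0; i1; i2; l].
Proof.
rewrite /= !inE !negb_or => /and3P[/andP[n01 n02] n12 _].
have [j [l]] := ord4_others2 n01; rewrite /= !inE !negb_or.
move=> /and4P[/and3P[_ a b] /andP[c d] e _].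
have [->|nj] := eqVneq i2 j; first by exists l; rewrite !inE !negb_or a b c d e n01.
by exists j; rewrite !inE !negb_or n01 n02 n12 nj a c.
Qed.

Lemma ord4_mem i0 i1 i2 i3 m : uniq [:: i0; i1; i2; i3] -> m \in [:: i0; i1; i2; i3].
Proof.
move=> u; have [||_ e] := @uniq_min_size _ [:: i0; i1; i2; i3] (enum 'I_4) u.
- by move=> x _; rewrite mem_enum.
- by rewrite size_enum_ord.
- by rewrite e mem_enum.
Qed.

Lemma big_ord4 (T : nmodType) i0 i1 i2 i3 (F : 'I_4 -> T) : uniq [:: i0; i1; i2; i3] ->
  \sum_i F i = F i0 + F i1 + F i2 + F i3.
Proof.
move=> u; have p : perm_eq (index_enum 'I_4) [:: i0; i1; i2; i3].
  apply: uniq_perm => //; first exact: index_enum_uniq.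
  by move=> x; rewrite mem_index_enum ord4_mem.
by rewrite (perm_big _ p)/= !big_cons big_nil addr0 !addrA.
Qed.

Lemma frame_neq q i j : is_frame q -> i != j -> lform (q i) (q j) = -1.
Proof. by move=> fq /negbTE ij; rewrite fq ij. Qed.

Lemma frame_unit q i : is_frame q -> lform (q i) (q i) = 1.
Proof. by move=> fq; rewrite fq eqxx. Qed.

Lemma frame_tangent q i j : is_frame q -> i != j -> exists p (k : R),
  [/\ tangent_at p (circ (q i)) (circ (q j)), k != 0,
    0 <= (q i + q j).1.1.1 + (q i + q j).2 -> 0 < k &
    forall u, lform u (q i + q j) = k * lform u (point_vec p)].
Proof.
move=> fq ij; apply: form_tangent; rewrite ?frame_unit ?frame_neq//.
have [l [m]] := ord4_others2 ij; rewrite /= !inE !negb_or.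
move=> /and4P[/and3P[_ il _] /andP[jl _] _ _] e.
have : lform (q i + q j) (q l) = -2 by rewrite lformDl !frame_neq//; lra.
by rewrite e lform0l; lra.
Qed.

Lemma point_vec_neq0 (p : sphere_pt R) : point_vec p <> 0.
Proof. by case: p => [z|] [] => [/eqP|/eqP]; rewrite oner_eq0. Qed.

(** If p lay on three of the circles and paired to t with the fourth, [frame_parseval] for the null
    vector of p would give t^2 / 4 = 0. That vector would then be orthogonal to the whole frame,
    hence zero. *)
Lemma frame_mutually_tangent q i j l : is_frame q -> uniq [:: i; j; l] ->
  mutually_tangent (circ (q i)) (circ (q j)) (circ (q l)).
Proof.
move=> fq u; have [k uk] := ord4_others3 u.
move: (u); rewrite /= !inE !negb_or => /and3P[/andP[ij il] jl _].
split.
- by have [p [? []]] := frame_tangent fq ij; exists p.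
- by have [p [? []]] := frame_tangent fq jl; exists p.
- by have [p [? []]] := frame_tangent fq il; exists p.
apply/seteqP; split => // p [[/= pi pj] pl].
have := frame_parseval (point_vec p) (point_vec p) fq.
rewrite point_vec_null !(big_ord4 _ uk) !(lformC (point_vec p)) pi pj pl => h.
have {}h : lform (q k) (point_vec p) = 0.
  by apply/eqP; rewrite -sqrf_eq0 expr2; apply/eqP; move: h; lra.
apply: (@point_vec_neq0 p); apply: (frame_ext fq) => m.
rewrite lform0l; have := ord4_mem m uk.
by rewrite !inE => /or4P[] /eqP ->; rewrite lformC.
Qed.

(** Descartes' theorem: by [frame_parseval] the pairing t of u with [q k] satisfies (t - 1) (t + 7)
    = 0, and the roots belong to [q k] and to its swap. *)
Lemma frame_complete q k u : is_frame q -> lform u u = 1 ->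
  (forall j, j != k -> lform u (q j) = -1) -> u = q k \/ u = swap q k k.
Proof.
move=> fq uu h; have [i [j [l]]] := ord4_others k => uq.
have := frame_parseval u u fq; rewrite uu !(big_ord4 _ uq).
move: (uq); rewrite /= !inE !negb_or => /and4P[/and3P[ki kj kl] _ _ _].
rewrite (h i) 1?eq_sym// (h j) 1?eq_sym// (h l) 1?eq_sym//; set t := lform u (q k) => e.
have : (t - 1) * (t + 7) = 0 by move: e; lra.
have same v : lform v (q k) = t -> (forall j, j != k -> lform v (q j) = -1) -> u = v.
  move=> vk vj; apply: (frame_ext fq) => m.
  by have [->|mk] := eqVneq m k; rewrite ?vk// h// vj.
move/eqP; rewrite mulf_eq0 subr_eq0 addr_eq0 => /orP[] /eqP te; [left|right].
  by apply: same; [rewrite frame_unit|move=> m mk; rewrite frame_neq// eq_sym].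
apply: same; first by rewrite lformC lform_swap_self.
move=> m mk; have := frame_neq (swap_frame k fq) (_ : k != m).
by rewrite (swap_other q mk); apply; rewrite eq_sym.
Qed.

Definition vorbit q0 v := exists q i, reach q0 q /\ v = q i.

(** [reduced_escape] for the pairing with v, where A says that the frame still contains v. When v is
    swapped out the values of F are 7, 1, 1, 1, and 7 dominates the sum of the rest. Hence any
    vector outside the frames through v pairs to at most -3 with it. *)
Lemma orbit_sep q0 v w : is_frame q0 -> vorbit q0 v -> vorbit q0 w -> v <> w ->
  lform v w <= -1 /\ (lform v w = -1 ->
    exists q i j, [/\ reach q0 q, i != j, q i = v & q j = w]).
Proof.
move=> f0 [q1 [i0 [r1 ->]]] [q2 [j0 [r2 ->]]] vw.
have f1 := reach_frame f0 r1.
have r12 : reach q1 q2 by apply: reach_trans r2; exact: reach_sym.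
have := @reduced_escape R q1 (q1 i0) 3 (fun q => q i0 = q1 i0) erefl.
move=> /(_ _ q2 r12 j0) [].
- move=> q k rq qi; have fq := reach_frame f1 rq.
  have [ki|ki] := eqVneq k i0; last by left; rewrite swap_other// eq_sym.
  right; rewrite ki -qi; have fs := lform_swap_self i0 fq.
  have fo j : j != i0 -> - lform (swap q i0 j) (q i0) = 1.
    by move=> ji; rewrite swap_other// frame_neq// opprK.
  have fi : - lform (swap q i0 i0) (q i0) = 7 by rewrite lformC fs opprK.
  split; rewrite ?fi//.
  + by move=> j; have [->|ji] := eqVneq j i0; rewrite ?fi ?fo.
  + by rewrite ler_nat.
  rewrite (eq_bigr (fun=> 1)) => [|j ji]; last by rewrite fo.
  rewrite sumr_const (_ : #|_| = 3%N) ?ler_nat//.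
  by rewrite cardC1 card_ord.
- by rewrite lformC => h; split; [lra|move=> e; move: h; rewrite e; lra].
- move=> [q [j [rq qi qj]]]; have fq := reach_frame f1 rq.
  have ij : i0 != j by apply/eqP => e; apply: vw; rewrite qj -e.
  rewrite qj -qi frame_neq//; split => // _.
  by exists q, i0, j; split => //; exact: reach_trans rq.
Qed.

(** The same escape argument for the pairing with [u + v], with A saying that the frame contains
    both. Swapping one of them out gives the values 8, 0, 2, 2. Since w has the value 2 < 3, it must
    lie in a frame with u and v. *)
Lemma orbit_triple q0 u v w : is_frame q0 -> vorbit q0 u -> vorbit q0 v -> vorbit q0 w ->
  lform u v = -1 -> lform u w = -1 -> lform v w = -1 ->
  exists q i j k, [/\ reach q0 q, uniq [:: i; j; k] & [/\ q i = u, q j = v & q k = w]].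
Proof.
move=> f0 ou ov [q2 [j0 [r2 ->]]] uv uw vw.
have uu : lform u u = 1 by case: ou => [q [i [rq ->]]]; exact: frame_unit (reach_frame f0 rq).
have vv : lform v v = 1 by case: ov => [q [i [rq ->]]]; exact: frame_unit (reach_frame f0 rq).
have nuv : u <> v by move=> e; move: uv; rewrite e vv; lra.
have [_ /(_ uv) [q1 [i0 [i1 [r1 i01 q1u q1v]]]]] := orbit_sep f0 ou ov nuv.
have f1 := reach_frame f0 r1.
have r12 : reach q1 q2 by apply: reach_trans r2; exact: reach_sym.
have := @reduced_escape R q1 (u + v) 3 (fun q => q i0 = u /\ q i1 = v) (conj q1u q1v).
move=> /(_ _ q2 r12 j0) [].
- move=> q k rq [qu qv]; have fq := reach_frame f1 rq.
  have [j [l uq]] := ord4_others2 i01.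
  move: (uq); rewrite /= !inE !negb_or => /and4P[/and3P[_ i0j i0l] /andP[i1j i1l] jl _].
  have key (a b : 'I_4) : a != b -> q a + q b = u + v -> uniq [:: a; b; j; l] ->
      [/\ forall m, 0 <= - lform (swap q a m) (u + v), 3 <= - lform (swap q a a) (u + v) &
       \sum_(m | m != a) - lform (swap q a m) (u + v) <= - lform (swap q a a) (u + v)].
    move=> ab <- ub; have fa := lform_swap_self a fq.
    move: (ub); rewrite /= !inE !negb_or => /and4P[/and3P[_ aj al] /andP[bj bl] _ _].
    have Fa : - lform (swap q a a) (q a + q b) = 8.
      rewrite lformDr lformC fa -[q b](@swap_other _ q a b) 1?eq_sym//.
      by rewrite (frame_neq (swap_frame a fq) ab); lra.
    have Fb : - lform (swap q a b) (q a + q b) = 0.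
      rewrite swap_other 1?eq_sym// lformDr frame_unit// lformC frame_neq//; lra.
    have Fj : - lform (swap q a j) (q a + q b) = 2.
      by rewrite swap_other 1?eq_sym// lformDr !frame_neq 1?eq_sym//; lra.
    have Fl : - lform (swap q a l) (q a + q b) = 2.
      by rewrite swap_other 1?eq_sym// lformDr !frame_neq 1?eq_sym//; lra.
    have := big_ord4 (fun m => - lform (swap q a m) (q a + q b)) ub.
    rewrite (bigD1 a)//= Fa Fb Fj Fl => S; split; [|lra|lra].
    move=> m; have := ord4_mem m ub.
    by rewrite !inE => /or4P[] /eqP ->; rewrite ?Fa ?Fb ?Fj ?Fl.
  have [->|k0] := eqVneq k i0; first by right; apply: (key i0 i1) => //; rewrite qu qv.
  have [->|k1] := eqVneq k i1.
    right; apply: (key i1 i0); rewrite 1?eq_sym//; first by rewrite qu qv addrC.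
    by rewrite /= !inE !negb_or i1j i1l i0j i0l jl (eq_sym i1) i01.
  by left; rewrite !swap_other// eq_sym.
- by rewrite lformDr ![lform (q2 j0) _]lformC uw vw; lra.
- move=> [q [j [rq [qu qv] qj]]]; have fq := reach_frame f1 rq.
  exists q, i0, i1, j; split; [exact: reach_trans rq| |by split].
  have i0j : i0 != j by apply/eqP => e; move: uw; rewrite qj -e qu uu; lra.
  have i1j : i1 != j by apply/eqP => e; move: vw; rewrite qj -e qv vv; lra.
  by rewrite /= !inE !negb_or i01 i0j i1j.
Qed.

End FrameGeometry.

Section Packing.
Variable R : realType.
Local Notation vec := (vec R).
Implicit Types (u v w : vec) (q : 'I_4 -> vec) (i j k l : 'I_4) (p : sphere_pt R).

Let o0 : 'I_4 := @Ordinal 4 0 isT.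
Let o1 : 'I_4 := @Ordinal 4 1 isT.
Let o2 : 'I_4 := @Ordinal 4 2 isT.
Let o3 : 'I_4 := @Ordinal 4 3 isT.

Lemma orbit_unit q0 v : is_frame q0 -> vorbit q0 v -> lform v v = 1.
Proof. by move=> f0 [q [i [rq ->]]]; exact: frame_unit (reach_frame f0 rq). Qed.

Lemma tangent_neq v w p : lform v v = 1 -> tangent_at p (circ v) (circ w) -> v <> w.
Proof. by move=> vv + e; rewrite -e /tangent_at setIid; exact: circ_not_singleton. Qed.

Lemma tangent_neqN v w p : lform v v = 1 -> tangent_at p (circ v) (circ w) -> v <> - w.
Proof.
by move=> vv + e; rewrite -[w]opprK -e circN /tangent_at setIid; exact: circ_not_singleton.
Qed.

Lemma orbit_tangent q0 v w p : is_frame q0 -> vorbit q0 v -> vorbit q0 w ->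
  tangent_at p (circ v) (circ w) -> lform v w = -1.
Proof.
move=> f0 ov ow T.
have [h _] := orbit_sep f0 ov ow (tangent_neq (orbit_unit f0 ov) T).
have [e|//] := tangent_form (orbit_unit f0 ov) (orbit_unit f0 ow) T.
by move: h; rewrite e; lra.
Qed.

(** Three mutually tangent circles of the orbit lie in a common frame, so the circle added to them
    is the fourth of that frame or its swap. Conversely, each new vector of a swapped frame is
    tangent to the three that remain. *)
Lemma orbit_generated q0 C : is_frame q0 ->
  generated (circ (q0 o0)) (circ (q0 o1)) (circ (q0 o2)) C <->
  exists2 v, vorbit q0 v & C = circ v.
Proof.
move=> f0; split.
  elim=> {C} [| | |A1 A2 A3 A _ [v1 ov1 ->] _ [v2 ov2 ->] _ [v3 ov3 ->] [[p12 T12] [p23 T23] [p13 T13] _]].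
  - by exists (q0 o0) => //; exists q0, o0; split => //; exact: reach_refl.
  - by exists (q0 o1) => //; exists q0, o1; split => //; exact: reach_refl.
  - by exists (q0 o2) => //; exists q0, o2; split => //; exact: reach_refl.
  move=> /is_circle_vec[a aa ->] [p1 T1] [p2 T2] [p3 T3].
  have [q [i [j [k [rq uq [qi qj qk]]]]]] := orbit_triple f0 ov1 ov2 ov3
    (orbit_tangent f0 ov1 ov2 T12) (orbit_tangent f0 ov1 ov3 T13) (orbit_tangent f0 ov2 ov3 T23).
  have fq := reach_frame f0 rq; have [l ul] := ord4_others3 uq.
  have g1 := tangent_form aa (orbit_unit f0 ov1) T1.
  have g2 := tangent_form aa (orbit_unit f0 ov2) T2.
  have g3 := tangent_form aa (orbit_unit f0 ov3) T3.
  have n1 := tangent_neq aa T1; have n1' := tangent_neqN aa T1.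
  have n2 := tangent_neq aa T2; have n2' := tangent_neqN aa T2.
  have n3 := tangent_neq aa T3; have n3' := tangent_neqN aa T3.
  rewrite -qi -qj -qk in g1 g2 g3 n1 n1' n2 n2' n3 n3'.
  move: (ul); rewrite /= !inE !negb_or => /and4P[/and3P[ij ik il] /andP[jk jl] kl _].
  have mem m : [\/ m = i, m = j, m = k | m = l].
    by have := ord4_mem m ul; rewrite !inE => /or4P[] /eqP ->; [apply: Or41|apply: Or42|apply: Or43|apply: Or44].
  have sgn b : (b = a \/ b = - a) -> lform b (q i) = -1 -> lform b (q j) = -1 ->
      lform b (q k) = -1 -> exists2 v, vorbit q0 v & circ a = circ v.
    move=> ba bi bj bk.
    have bb : lform b b = 1 by case: ba => ->; rewrite ?lformNl ?lformNr ?opprK.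
    have -> : circ a = circ b by case: ba => ->; rewrite ?circN.
    have [|->|->] := @frame_complete R q l b fq bb.
    - by move=> m ml; case: (mem m) ml => -> //; rewrite eqxx.
    - by exists (q l) => //; exists q, l.
    - exists (swap q l l) => //; exists (swap q l), l; split => //; exact: reach_swap.
  have ii : i \in [:: i; j; k] by rewrite !inE eqxx.
  have ji : j \in [:: i; j; k] by rewrite !inE eqxx orbT.
  have ki : k \in [:: i; j; k] by rewrite !inE eqxx !orbT.
  have nji : j != i by rewrite eq_sym.
  have nki : k != i by rewrite eq_sym.
  have nkj : k != j by rewrite eq_sym.
  (* Mixed signs force [a] to be one of the three vectors up to sign. *)
  have mixed b m : (b = a \/ b = - a) -> m \in [:: i; j; k] ->
      (forall m', m' \in [:: i; j; k] -> lform b (q m') = lform (q m) (q m')) -> False.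
    move=> ba mi h.
    have bb : lform b b = 1 by case: ba => ->; rewrite ?lformNl ?lformNr ?opprK.
    (* With such pairings, [frame_parseval] leaves (t + 1)^2 = 0 for the pairing t with the fourth
       vector. *)
    have bl : lform b (q l) = -1.
      have := frame_parseval b b fq; rewrite bb !(big_ord4 _ ul).
      rewrite (h i ii) (h j ji) (h k ki); set t := lform b (q l) => e.
      have s : lform (q m) (q i) + lform (q m) (q j) + lform (q m) (q k) = -1.
        move: mi; rewrite !inE => /or3P[] /eqP ->; rewrite !fq ?eqxx ?(negbTE ij) ?(negbTE ik) ?(negbTE jk)
          ?(negbTE nji) ?(negbTE nki) ?(negbTE nkj); lra.
      have s2 : lform (q m) (q i) * lform (q m) (q i) + lform (q m) (q j) * lform (q m) (q j)
         + lform (q m) (q k) * lform (q m) (q k) = 3.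
        move: mi; rewrite !inE => /or3P[] /eqP ->; rewrite !fq ?eqxx ?(negbTE ij) ?(negbTE ik) ?(negbTE jk)
          ?(negbTE nji) ?(negbTE nki) ?(negbTE nkj); lra.
      rewrite s s2 in e; have : (t + 1) ^+ 2 = 0 by rewrite expr2; move: e; lra.
      by move/eqP; rewrite sqrf_eq0 addr_eq0 => /eqP.
    have bm : b = q m.
      apply: (frame_ext fq) => m'.
      case: (mem m') => ->; [exact: h ii|exact: h ji|exact: h ki|].
      by rewrite bl; move: mi; rewrite !inE => /or3P[] /eqP ->; rewrite (frame_neq fq).
    have {}bm : a = q m \/ a = - q m by case: ba bm => -> <-; [left|right]; rewrite ?opprK.
    by move: mi bm; rewrite !inE => /or3P[] /eqP -> [].
  have N m : lform (- a) (q m) = - lform a (q m) by rewrite lformNl.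
  have mx b m : (b = a \/ b = - a) -> m \in [:: i; j; k] ->
    lform b (q i) = (if m == i then 1 else -1) -> lform b (q j) = (if m == j then 1 else -1) ->
    lform b (q k) = (if m == k then 1 else -1) -> False.
    move=> ba mi hi hj hk; apply: (mixed b m ba mi) => m'; rewrite !inE fq.
    by case/or3P => /eqP ->.
  have La : a = a \/ a = - a by left.
  have Ra : - a = a \/ - a = - a by right.
  (* If the three signs agree, a or -a completes the triple. Otherwise one sign is in the minority,
     and a or -a has the pairings of that vector of the triple. *)
  case: g1 => g1; case: g2 => g2; case: g3 => g3.
  - by apply: (sgn (- a)) => //; rewrite N ?g1 ?g2 ?g3.
  - exfalso; apply: (mx (- a) k) => //; rewrite N ?g1 ?g2 ?g3 ?eqxx ?opprK//.
      by rewrite eq_sym (negbTE ik).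
    by rewrite eq_sym (negbTE jk).
  - exfalso; apply: (mx (- a) j) => //; rewrite N ?g1 ?g2 ?g3 ?eqxx ?opprK//.
      by rewrite eq_sym (negbTE ij).
    by rewrite (negbTE jk).
  - by exfalso; apply: (mx a i) => //; rewrite ?g1 ?g2 ?g3 ?eqxx ?(negbTE ij) ?(negbTE ik).
  - exfalso; apply: (mx (- a) i) => //; rewrite N ?g1 ?g2 ?g3 ?eqxx ?opprK//.
      by rewrite (negbTE ij).
    by rewrite (negbTE ik).
  - exfalso; apply: (mx a j) => //; rewrite ?g1 ?g2 ?g3 ?eqxx ?(negbTE jk)//.
    by rewrite eq_sym (negbTE ij).
  - exfalso; apply: (mx a k) => //; rewrite ?g1 ?g2 ?g3 ?eqxx//.
      by rewrite eq_sym (negbTE ik).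
    by rewrite eq_sym (negbTE jk).
  - by apply: (sgn a).
move=> [v [q [i [rq ->]]] ->] {v C}.
have step (q' : 'I_4 -> vec) (i0 i1 i2 i3 : 'I_4) : is_frame q' -> uniq [:: i3; i0; i1; i2] ->
    generated (circ (q0 o0)) (circ (q0 o1)) (circ (q0 o2)) (circ (q' i0)) ->
    generated (circ (q0 o0)) (circ (q0 o1)) (circ (q0 o2)) (circ (q' i1)) ->
    generated (circ (q0 o0)) (circ (q0 o1)) (circ (q0 o2)) (circ (q' i2)) ->
    generated (circ (q0 o0)) (circ (q0 o1)) (circ (q0 o2)) (circ (q' i3)).
  move=> fq'; rewrite cons_uniq !inE !negb_or => /andP[/and3P[n0 n1 n2] u] h0 h1 h2.
  apply: (generated_step h0 h1 h2).
  - exact: frame_mutually_tangent.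
  - exact: is_circle_circ (frame_unit _ fq').
  - by have [p [? []]] := frame_tangent fq' n0; exists p.
  - by have [p [? []]] := frame_tangent fq' n1; exists p.
  - by have [p [? []]] := frame_tangent fq' n2; exists p.
move: i; elim: rq => [|{}q k rq IH] i.
  have h3 : generated (circ (q0 o0)) (circ (q0 o1)) (circ (q0 o2)) (circ (q0 o3)).
    by apply: (@step q0 o0 o1 o2 o3) => //; constructor.
  have := @ord4_mem o0 o1 o2 o3 i isT; rewrite !inE => /or4P[] /eqP -> //; constructor.
have fq := reach_frame f0 rq.
have [->|ik] := eqVneq i k; last by rewrite swap_other.
have [a [b [c u]]] := ord4_others k.
apply: (@step (swap q k) a b c k) => //; first exact: swap_frame.
all: rewrite swap_other//; move: u; rewrite /= !inE !negb_or => /andP[/and3P[? ? ?] _]; by rewrite eq_sym.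
Qed.

(* Up to a factor, the time coordinate of Lorentz space. *)
Definition tm v : R := v.1.1.1 + v.2.

Lemma tmN v : tm (- v) = - tm v.
Proof. rewrite /tm/=; ring. Qed.

Lemma causal_ge0 (b x y c : R) : x * x + y * y <= b * c -> 0 <= b + c -> 0 <= b /\ 0 <= c.
Proof.
move=> h bc; have s : 0 <= b * c by apply: le_trans h; rewrite -!expr2 addr_ge0 ?sqr_ge0.
have [b0|b0] := leP 0 b; have [c0|c0] := leP 0 c; [by []| | |lra]; exfalso.
  have [e|e] := eqVneq b 0; first by move: bc; rewrite e; lra.
  have : b * c < 0 by rewrite pmulr_rlt0// lt_neqAle eq_sym e.
  by lra.
have [e|e] := eqVneq c 0; first by move: bc; rewrite e; lra.
have : b * c < 0 by rewrite pmulr_llt0// lt_neqAle eq_sym e.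
by lra.
Qed.

(** The reversed Cauchy-Schwarz inequality: ordinary Cauchy-Schwarz for the (x, y) parts, then b c'
    * c b' <= ((b c' + c b') / 2)^2. *)
Lemma causal_lform_le0 u v : lform u u <= 0 -> lform v v <= 0 -> 0 <= tm u -> 0 <= tm v ->
  lform u v <= 0.
Proof.
case: u => [[[b x] y] c]; case: v => [[[b' x'] y'] c']; rewrite /lform /tm/= => hu hv tu tv.
have hu' : x * x + y * y <= b * c by move: hu; lra.
have hv' : x' * x' + y' * y' <= b' * c' by move: hv; lra.
have [b0 c0] := causal_ge0 hu' tu; have [b'0 c'0] := causal_ge0 hv' tv.
set p := x * x' + y * y'; set s := (b * c' + c * b') / 2.
have s0 : 0 <= s by rewrite divr_ge0// addr_ge0// mulr_ge0.
rewrite subr_le0 leNgt; apply/negP => sp.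
have : s ^+ 2 < p ^+ 2 by rewrite ltr_sqr ?nnegrE// ltW// (le_lt_trans s0).
apply/negP; rewrite -leNgt.
have h1 : p ^+ 2 <= (x * x + y * y) * (x' * x' + y' * y').
  by rewrite -subr_ge0; have := sqr_ge0 (x * y' - y * x'); rewrite /p !expr2; lra.
have h2 : (x * x + y * y) * (x' * x' + y' * y') <= (b * c) * (b' * c').
  by apply: ler_pM => //; rewrite -!expr2 addr_ge0 ?sqr_ge0.
have h3 : (b * c) * (b' * c') <= s ^+ 2.
  by have := sqr_ge0 (b * c' - c * b'); rewrite /s !expr2; lra.
exact: le_trans h1 (le_trans h2 h3).
Qed.

Lemma tm_point p : 0 <= tm (point_vec p).
Proof. by case: p => [z|]; rewrite /tm/= ?add0r// !addr_ge0 ?sqr_ge0. Qed.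

Lemma timelike_point u p : lform u u < 0 -> 0 <= tm u -> lform u (point_vec p) < 0.
Proof.
move=> uu tu; have : lform u (point_vec p) <= 0.
  by apply: causal_lform_le0 => //; rewrite ?point_vec_null ?tm_point// ltW.
rewrite le_eqVlt => /orP[/eqP e|//]; exfalso.
move: uu tu e; case: u => [[[b x] y] c]; rewrite /lform /tm/= => uu tu.
have h : x * x + y * y <= b * c by move: uu; lra.
have [b0 c0] := causal_ge0 h tu.
have sx := sqr_ge0 x; have sy := sqr_ge0 y.
case: p => [[z1 z2]|]/= e; last first.
  have : b = 0 by move: e; lra.
  by move=> b00; move: uu sx sy; rewrite b00 !expr2; lra.
have := sqr_ge0 (x - b * z1); have := sqr_ge0 (y - b * z2).
by have := congr1 ( *%R b) e; move: uu; rewrite !expr2; lra.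
Qed.

Lemma orient u v : lform u u <= 0 -> lform v v <= 0 -> 0 <= tm v -> lform u v < 0 -> 0 <= tm u.
Proof.
move=> uu vv tv uv; rewrite leNgt; apply/negP => tu.
have : lform (- u) v <= 0.
  by apply: causal_lform_le0 => //; rewrite ?lformNl ?lformNr ?opprK// tmN oppr_ge0 ltW.
by rewrite lformNl; lra.
Qed.

(** A frame and its negative have the same Gram matrix. This sign makes each [q i + q j] a positive
    multiple of the vector of a tangency point, and then [disk (q i)] is the side that contains no
    other circle. *)
Definition future q := forall i j, i != j -> 0 <= tm (q i + q j).

(** One pair decides: the sum over any other pair pairs to -2 or -4 with [q i + q j], so [orient]
    transfers the sign. *)
Lemma frame_future q i j : is_frame q -> i != j -> 0 <= tm (q i + q j) -> future q.
Proof.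
move=> fq ij tij k l kl.
have null a b : a != b -> lform (q a + q b) (q a + q b) = 0.
  move=> ab; rewrite !(lformDl, lformDr) !frame_unit// (lformC (q b)) frame_neq//; lra.
have d1 : ~~ ((k == i) && (k == j)) by apply/negP => /andP[/eqP e /eqP e']; move: ij; rewrite -e -e' eqxx.
have d2 : ~~ ((l == i) && (l == j)) by apply/negP => /andP[/eqP e /eqP e']; move: ij; rewrite -e -e' eqxx.
have d3 : ~~ ((k == i) && (l == i)) by apply/negP => /andP[/eqP e /eqP e']; move: kl; rewrite e e' eqxx.
have d4 : ~~ ((k == j) && (l == j)) by apply/negP => /andP[/eqP e /eqP e']; move: kl; rewrite e e' eqxx.
have [e|ne] := eqVneq (lform (q k + q l) (q i + q j)) 0; last first.
  apply: (orient _ _ tij); rewrite ?null// lt_neqAle ne/=.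
  rewrite !(lformDl, lformDr) !fq; move: d1 d2.
  by case: (k == i); case: (l == j); case: (k == j); case: (l == i) => //= _ _; lra.
have : (k == i) && (l == j) || (k == j) && (l == i).
  move: e d1 d2 d3 d4; rewrite !(lformDl, lformDr) !fq.
  case: (k == i); case: (l == j); case: (k == j); case: (l == i) => //= h _ _ _ _;
    by exfalso; move: h; lra.
by case/orP => /andP[/eqP -> /eqP ->] //; rewrite addrC.
Qed.

Lemma reach_future q0 q : is_frame q0 -> future q0 -> reach q0 q -> future q.
Proof.
move=> f0 fu0; elim=> // {}q k rq fu; have fq := reach_frame f0 rq.
have [i [j [l]]] := ord4_others k; rewrite /= !inE !negb_or => /and4P[/and3P[ki kj _] /andP[ij _] _ _].
apply: (frame_future (swap_frame k fq) ij); rewrite !swap_other 1?eq_sym//.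
exact: fu.
Qed.

(** Compare with a neighbour [q j] of v in a frame: the form of [v + w] and [v + q j] is 1 - 1 plus
    two terms at most -1, so [orient] applies. *)
Lemma orbit_future q0 v w : is_frame q0 -> future q0 -> vorbit q0 v -> vorbit q0 w -> v <> w ->
  0 <= tm (v + w).
Proof.
move=> f0 fu ov ow vw; have [sep _] := orbit_sep f0 ov ow vw.
have vv := orbit_unit f0 ov; have ww := orbit_unit f0 ow.
case: (ov) => [q [i [rq vE]]]; have fq := reach_frame f0 rq.
have [j [l [m]]] := ord4_others i; rewrite /= !inE !negb_or => /and4P[/and3P[ij _ _] _ _ _].
have fuq := reach_future f0 fu rq.
have [e|ne] := pselect (w = q j); first by rewrite e vE; exact: fuq.
have oj : vorbit q0 (q j) by exists q, j.
have [sep' _] := orbit_sep f0 oj ow (nesym ne).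
apply: (@orient _ (v + q j)).
- by rewrite !(lformDl, lformDr) vv ww (lformC w v); lra.
- by rewrite vE !(lformDl, lformDr) !frame_unit// (lformC (q j)) frame_neq//; lra.
- by rewrite vE; exact: fuq.
- have vj : lform v (q j) = -1 by rewrite vE; exact: frame_neq.
  by rewrite !(lformDl, lformDr) vv (lformC w v) (lformC w (q j)) vj; lra.
Qed.

Lemma orbit_disjoint q0 v w p : is_frame q0 -> future q0 -> vorbit q0 v -> vorbit q0 w ->
  v <> w -> circ w p -> lform v (point_vec p) <= 0.
Proof.
move=> f0 fu ov ow vw pw; have [sep _] := orbit_sep f0 ov ow vw.
have : lform (v + w) (point_vec p) <= 0.
  apply: causal_lform_le0; rewrite ?point_vec_null ?tm_point//.
    by rewrite !(lformDl, lformDr) (orbit_unit f0 ov) (orbit_unit f0 ow) (lformC w v); lra.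
  exact: orbit_future.
by rewrite lformDl pw addr0.
Qed.

(** The swap of v pairs to -7 with it, so their sum is timelike and the circles are disjoint. Thus
    the side [disk (- v)] always contains another circle of the packing. *)
Lemma orbit_outside q0 v : is_frame q0 -> future q0 -> vorbit q0 v ->
  exists2 w, vorbit q0 w & circ w <> circ v /\ circ w `<=` disk (- v).
Proof.
move=> f0 fu ov; case: (ov) => [q [i [rq vE]]]; have fq := reach_frame f0 rq.
have sw := lform_swap_self i fq; rewrite -vE in sw.
have ow : vorbit q0 (swap q i i) by exists (swap q i), i; split => //; exact: reach_swap.
have vv := orbit_unit f0 ov; have ww := orbit_unit f0 ow.
have vw : v <> swap q i i by move=> e; move: sw; rewrite -e vv; lra.
exists (swap q i i) => //; split.
  move=> /(circ_inj ww vv)[] e; move: sw; rewrite e ?lformNr vv; lra.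
move=> p pw; rewrite /disk/= lformNl oppr_gt0.
have : lform (v + swap q i i) (point_vec p) < 0.
  apply: timelike_point; last exact: orbit_future.
  by rewrite !(lformDl, lformDr) vv ww (lformC _ v) sw; lra.
by rewrite lformDl pw addr0.
Qed.

End Packing.

Section PackingFrame.
Variable R : realType.
Local Notation vec := (vec R).
Implicit Types (u v w : vec) (q : 'I_4 -> vec).

Definition minor3 (a1 a2 a3 b1 b2 b3 c1 c2 c3 : R) : R :=
  a1 * (b2 * c3 - b3 * c2) - a2 * (b1 * c3 - b3 * c1) + a3 * (b1 * c2 - b2 * c1).

(* The generalised cross product, lowered by the form. *)
Definition cross u v w : vec :=
  (minor3 u.1.1.1 u.1.1.2 u.1.2 v.1.1.1 v.1.1.2 v.1.2 w.1.1.1 w.1.1.2 w.1.2,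
   - minor3 u.1.1.1 u.1.2 u.2 v.1.1.1 v.1.2 v.2 w.1.1.1 w.1.2 w.2 / 2,
   minor3 u.1.1.1 u.1.1.2 u.2 v.1.1.1 v.1.1.2 v.2 w.1.1.1 w.1.1.2 w.2 / 2,
   - minor3 u.1.1.2 u.1.2 u.2 v.1.1.2 v.1.2 v.2 w.1.1.2 w.1.2 w.2).

Lemma lform_cross u v w :
  [/\ lform (cross u v w) u = 0, lform (cross u v w) v = 0 & lform (cross u v w) w = 0].
Proof.
case: u => [[[? ?] ?] ?]; case: v => [[[? ?] ?] ?]; case: w => [[[? ?] ?] ?].
by rewrite /lform /cross /minor3/=; split; field.
Qed.

(** Minus the Gram determinant; it is 4 when the vectors are units with pairings -1. *)
Lemma lform_cross_self u v w : lform (cross u v w) (cross u v w) =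
  lform u u * lform v w ^+ 2 + lform v v * lform u w ^+ 2 + lform w w * lform u v ^+ 2
  - lform u u * lform v v * lform w w - 2 * lform u v * lform v w * lform u w.
Proof.
case: u => [[[? ?] ?] ?]; case: v => [[[? ?] ?] ?]; case: w => [[[? ?] ?] ?].
by rewrite /lform /cross /minor3/=; field.
Qed.

(** Here [cross u v w] is orthogonal to the three vectors with square 4, while u + v + w has square
    -3 and pairs to -1 with each of them. Their difference is therefore the missing unit vector. *)
Lemma triple_frame u v w : lform u u = 1 -> lform v v = 1 -> lform w w = 1 ->
  lform u v = -1 -> lform u w = -1 -> lform v w = -1 ->
  exists q, [/\ is_frame q, q (@Ordinal 4 0 isT) = u, q (@Ordinal 4 1 isT) = v &
                q (@Ordinal 4 2 isT) = w].
Proof.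
move=> uu vv ww uv uw vw.
have [mu mv mw] := lform_cross u v w; have mm := lform_cross_self u v w.
set m := cross u v w in mu mv mw mm; rewrite uu vv ww uv uw vw in mm.
pose t := u + v + w - m.
pose q (i : 'I_4) : vec := nth t [:: u; v; w; t] i.
exists q; split => //.
have vu := uv; have wu := uw; have wv := vw; rewrite lformC in vu; rewrite lformC in wu.
rewrite lformC in wv; have um := mu; have vm := mv; have wm := mw.
rewrite lformC in um; rewrite lformC in vm; rewrite lformC in wm.
move=> [[|[|[|[|//]]]] hi] [[|[|[|[|//]]]] hj]; rewrite -val_eqE/= /q/= /t;
  rewrite ?(lformDl, lformDr, lformNl, lformNr) ?uu ?vv ?ww ?uv ?uw ?vw ?vu ?wu ?wv
  ?mu ?mv ?mw ?um ?vm ?wm ?mm; lra.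
Qed.

(** The signs of the second and third vectors are chosen relative to the first. The empty triple
    intersection forces the third pairing to be -1 as well, and a global sign makes the frame
    [future]. *)
Lemma packing_frame (P : set (set (sphere_pt R))) : apollonian_packing P ->
  exists q0, [/\ is_frame q0, future q0 & forall C, P C <-> exists2 v, vorbit q0 v & C = circ v].
Proof.
move=> [C1 [C2 [C3 [/is_circle_vec[v1 u1 ->] /is_circle_vec[v2 u2 ->] /is_circle_vec[v3 u3 ->]]]]].
move=> [[p12 T12] [p23 T23] [p13 T13] T0] ->.
have fix_sign v w p : lform v v = 1 -> lform w w = 1 -> tangent_at p (circ v) (circ w) ->
    exists w', [/\ lform w' w' = 1, circ w' = circ w & lform v w' = -1].
  move=> vv ww T; have [e|e] := tangent_form vv ww T; last by exists w.
  by exists (- w); rewrite circN !lformNl !lformNr opprK e.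
have [w2 [u2' e2 g12]] := fix_sign _ _ _ u1 u2 T12.
have [w3 [u3' e3 g13]] := fix_sign _ _ _ u1 u3 T13.
rewrite -e2 -e3 in T12 T23 T13 T0 *.
have s0 v w p : lform v v = 1 -> tangent_at p (circ v) (circ w) -> v + w <> 0.
  move=> vv T e; apply: (tangent_neqN vv T); apply/eqP.
  by rewrite -addr_eq0 e.
have g23 : lform w2 w3 = -1.
  (* With the value 1, the null vectors v1 + w2 and v1 + w3 would be orthogonal, so the two tangency
     points would coincide in a point of all three circles. *)
  have [e|//] := tangent_form u2' u3' T23; exfalso.
  have [p2 [k2 [S2 k20 _ H2]]] := form_tangent u1 u2' g12 (s0 _ _ _ u1 T12).
  have [p3 [k3 [S3 k30 _ H3]]] := form_tangent u1 u3' g13 (s0 _ _ _ u1 T13).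
  have : lform (v1 + w2) (v1 + w3) = 0.
    by rewrite !(lformDl, lformDr) u1 g13 (lformC w2 v1) g12 e; lra.
  rewrite H3 lformC H2 => /eqP.
  rewrite !mulf_eq0 (negbTE k20) (negbTE k30)/= => /eqP /lform_points pp.
  have [a1 a2] : (circ v1 `&` circ w2) p2 by rewrite S2.
  have [b1 b2] : (circ v1 `&` circ w3) p3 by rewrite S3.
  have : (circ v1 `&` circ w2 `&` circ w3) p2 by split => //; rewrite -pp.
  by rewrite T0.
have [q [fq q0 q1 q2]] := triple_frame u1 u2' u3' g12 g13 g23.
have n01 : (@Ordinal 4 0 isT : 'I_4) != @Ordinal 4 1 isT by [].
have [t0|t0] := leP 0 (tm (q (@Ordinal 4 0 isT) + q (@Ordinal 4 1 isT))).
  exists q; split => //; first exact: frame_future n01 t0.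
  by move=> C; rewrite -q0 -q1 -q2; exact: orbit_generated.
have fN : is_frame (fun i => - q i) by move=> i j; rewrite lformNl lformNr opprK.
exists (fun i => - q i); split => //.
  by apply: (frame_future fN n01); rewrite -opprD tmN oppr_ge0 ltW.
by move=> C; rewrite -q0 -q1 -q2 -!(circN (q _)); exact: (orbit_generated C fN).
Qed.

End PackingFrame.

(** * Circles tangent to a fixed circle *)

Section FordLabels.
Variable R : realType.
Local Notation vec := (vec R).
Implicit Types (u v w N : vec) (q : 'I_4 -> vec) (i j k l m : 'I_4) (a b : int * int).

Variables (q : 'I_4 -> vec) (i0 i1 i2 i3 : 'I_4).
Hypothesis fq : is_frame q.
Hypothesis uq : uniq [:: i0; i1; i2; i3].
Let v0 := q i0.

(* In the coordinate where [circ v0] is the real line and [circ (q i1)] a parallel line,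
   [(s, t)] labels the Ford circle at [s / t]. *)
Definition ford_form N (s t : R) : R :=
  s ^+ 2 * lform (q i1 + v0) N + t ^+ 2 * lform (q i2 + v0) N +
  s * t * (lform (q i3 + v0) N - lform (q i1 + v0) N - lform (q i2 + v0) N).

Definition labelled w a := forall N, lform (w + v0) N = ford_form N a.1%:~R a.2%:~R.

(** A frame through v0 whose other circles carry a Farey triple of labels: a, b and the mediant a +
    b. *)
Let tri q' a b j k l := [/\ uniq [:: i0; j; k; l], q' i0 = v0 &
  [/\ labelled (q' j) a, labelled (q' k) b & labelled (q' l) (a + b)]].

(** Once v0 is added to each vector, a swap becomes the parallelogram law. As [ford_form] is
    quadratic in the label, labels are replaced by sums and differences. *)
Let swap_label q' j k l N : uniq [:: i0; j; k; l] -> q' i0 = v0 ->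
  lform (swap q' k k + v0) N =
  2 * lform (q' j + v0) N + 2 * lform (q' l + v0) N - lform (q' k + v0) N.
Proof.
move=> u e; rewrite !lformDl -e ![lform _ N]lformC lform_swap (big_ord4 _ u); lra.
Qed.

Let uniq_rot j k l : uniq [:: i0; j; k; l] -> uniq [:: i0; j; l; k] /\ uniq [:: i0; k; l; j].
Proof.
rewrite /= !inE !negb_or => /and4P[/and3P[-> -> ->] /andP[jk jl] kl _].
by rewrite jk jl kl (eq_sym l) kl !(eq_sym _ j) jk jl.
Qed.

Let uniq_neq j k l : uniq [:: i0; j; k; l] ->
  [/\ j != i0, k != i0 & l != i0] /\ [/\ j != k, j != l & k != l].
Proof.
by rewrite /= !inE !negb_or => /and4P[/and3P[? ? ?] /andP[? ?] ? _]; rewrite !(eq_sym _ i0).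
Qed.

Let tri_swap2 q' a b j k l : tri q' a b j k l -> tri (swap q' k) a (a + b) j l k.
Proof.
move=> [u e [la lb lab]]; have [[ji ki li] [jk jl kl]] := uniq_neq u.
split; first by case: (uniq_rot u).
  by rewrite swap_other// eq_sym.
have lk : l != k by rewrite eq_sym.
split; [by rewrite (swap_other q' jk)|by rewrite (swap_other q' lk)|].
move=> N; rewrite (swap_label N u e) la lb lab /ford_form /= !rmorphD/=; ring.
Qed.

Let tri_swap1 q' a b j k l : tri q' a b j k l -> tri (swap q' j) b (a + b) k l j.
Proof.
move=> [u e [la lb lab]]; have [[ji ki li] [jk jl kl]] := uniq_neq u.
have u' : uniq [:: i0; k; j; l].
  by move: u; rewrite /= !inE !negb_or (eq_sym k j) => /and4P[/and3P[-> -> ->] /andP[-> ->] -> _].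
split; first by case: (uniq_rot u).
  by rewrite swap_other// eq_sym.
have kj : k != j by rewrite eq_sym.
have lj : l != j by rewrite eq_sym.
split; [by rewrite (swap_other q' kj)|by rewrite (swap_other q' lj)|].
move=> N; rewrite (swap_label N u' e) la lb lab /ford_form /= !rmorphD/=; ring.
Qed.

(** The mediant a + b turns into a - b; b is renamed -b, which [ford_form] cannot distinguish. *)
Let tri_swap3 q' a b j k l : tri q' a b j k l -> tri (swap q' l) a (- b) j k l.
Proof.
move=> [u e [la lb lab]]; have [[ji ki li] [jk jl kl]] := uniq_neq u.
have [u' _] := uniq_rot u.
split => //; first by rewrite swap_other// eq_sym.
split; [by rewrite (swap_other q' jl)| |].
  by move=> N; rewrite (swap_other q' kl) lb /ford_form /= !rmorphN/=; ring.
move=> N; rewrite (swap_label N u' e) la lb lab /ford_form /= !rmorphD !rmorphN/=; ring.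
Qed.

Let tri_base : tri q (1, 0) (0, 1) i1 i2 i3.
Proof.
split => //; split => N; rewrite /ford_form /= ?rmorphD/= ?expr1n ?expr0n/=; ring.
Qed.

(** The escape argument for the pairing with v0, with A asking for a Farey triple of labels: a
    tangent w has the value 1 < 3, so it occurs in such a frame. A zero label would make w + v0
    orthogonal to everything, although it pairs to -2 with a third vector of the frame. *)
Lemma orbit_label w : vorbit q w -> lform w v0 = -1 ->
  exists2 a, a != 0 & labelled w a.
Proof.
move=> [q2 [j0 [r2 wE]]] wv.
have := @reduced_escape R q v0 3 (fun q' => exists a b j k l, tri q' a b j k l).
move=> /(_ _ _ q2 r2 j0) [].
- by exists (1, 0), (0, 1), i1, i2, i3.
- move=> q' m rq' [a [b [j [k [l T]]]]]; have fq' := reach_frame fq rq'.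
  have [u e _] := T; have [[ji ki li] [jk jl kl]] := uniq_neq u.
  have [mi|mi] := eqVneq m i0; last first.
    left; have := ord4_mem m u; rewrite !inE (negbTE mi)/= => /or3P[] /eqP ->.
    + by exists b, (a + b), k, l, j; exact: tri_swap1.
    + by exists a, (a + b), j, l, k; exact: tri_swap2.
    + by exists a, (- b), j, k, l; exact: tri_swap3.
  right; rewrite mi -e; have fs := lform_swap_self i0 fq'.
  have fo m' : m' != i0 -> - lform (swap q' i0 m') (q' i0) = 1.
    by move=> mi'; rewrite swap_other// frame_neq// opprK.
  have fi : - lform (swap q' i0 i0) (q' i0) = 7 by rewrite lformC fs opprK.
  split; rewrite ?fi//.
  + by move=> m'; have [->|mi'] := eqVneq m' i0; rewrite ?fi ?fo.
  + by rewrite ler_nat.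
  rewrite (eq_bigr (fun=> 1)) => [|m' mi']; last by rewrite fo.
  by rewrite sumr_const cardC1 card_ord ler_nat.
- by rewrite -wE wv opprK; lra.
- move=> [q' [m [rq' [a [b [j [k [l T]]]]] qm]]]; have fq' := reach_frame fq rq'.
  have [u e [la lb lab]] := T; have [[ji ki li] [jk jl kl]] := uniq_neq u.
  have mi : m != i0.
    by apply/eqP => mi; move: wv; rewrite wE qm mi e frame_unit//; lra.
  have [c lc] : exists c, labelled w c.
    rewrite wE qm; have := ord4_mem m u; rewrite !inE (negbTE mi)/= => /or3P[] /eqP ->.
    + by exists a.
    + by exists b.
    + by exists (a + b).
  exists c => //; apply/eqP => c0.
  have [n [n' ]] := ord4_others2 mi; rewrite /= !inE !negb_or.
  move=> /and4P[/and3P[_ mn _] /andP[i0n _] _ _].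
  have := lc (q' n); rewrite c0 /ford_form/= wE qm -e lformDl !frame_neq// expr0n/=; lra.
Qed.

(** Subtractive Euclid on (s, t): a s + b t = a (s - t) + (a + b) t, and each subtraction is one
    swap. The bound n on s + t carries the induction. *)
Let coprime_tri (n : nat) : forall (s t : nat) q' a b j k l, (s + t <= n)%N -> coprime s t ->
  reach q q' -> tri q' a b j k l ->
  exists2 w, vorbit q w & lform w v0 = -1 /\ labelled w (a *+ s + b *+ t).
Proof.
have elt q' a b j k l m c : reach q q' -> tri q' a b j k l -> m != i0 ->
    labelled (q' m) c -> exists2 w, vorbit q w & lform w v0 = -1 /\ labelled w c.
  move=> rq' [_ e _] mi lc; exists (q' m); first by exists q', m.
  by split => //; rewrite -e frame_neq//; exact: reach_frame rq'.
elim: n => [|n IH] s t q' a b j k l st cop rq' T.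
  by move: st cop; rewrite leqn0 addn_eq0 => /andP[/eqP -> /eqP ->].
have [u e [la lb lab]] := T; have [[ji ki li] _] := uniq_neq u.
have [s0|s0] := posnP s.
  move: cop; rewrite s0 /coprime gcd0n => /eqP ->.
  by apply: (elt _ _ _ _ _ _ k) rq' T ki _; rewrite mulr0n add0r mulr1n.
have [t0|t0] := posnP t.
  move: cop; rewrite t0 /coprime gcdn0 => /eqP ->.
  by apply: (elt _ _ _ _ _ _ j) rq' T ji _; rewrite mulr0n addr0 mulr1n.
have [lt|lt|eqst] := ltngtP t s.
- have := IH (s - t)%N t _ _ _ _ _ _ _ _ (reach_swap k rq') (tri_swap2 T).
  have -> : a *+ (s - t) + (a + b) *+ t = a *+ s + b *+ t.
    by rewrite mulrnDl addrA -mulrnDr subnK// ltnW.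
  apply; first lia.
  by rewrite coprime_sym /coprime -gcdnDr subnK ?(ltnW lt)// gcdnC.
- have := IH (t - s)%N s _ _ _ _ _ _ _ _ (reach_swap j rq') (tri_swap1 T).
  have -> : b *+ (t - s) + (a + b) *+ s = a *+ s + b *+ t.
    by rewrite mulrnDl [RHS]addrC addrCA addrC -mulrnDr subnK// ltnW.
  apply; first lia.
  by rewrite coprime_sym /coprime -gcdnDr subnK ?(ltnW lt).
- move: cop; rewrite eqst /coprime gcdnn => /eqP ->.
  by apply: (elt _ _ _ _ _ _ l) rq' T li _; rewrite !mulr1n.
Qed.

Lemma label_orbit (s : int) (t : nat) : coprime `|s| t ->
  exists2 w, vorbit q w & lform w v0 = -1 /\ labelled w (s, t%:Z).
Proof.
move=> cop; have rr := reach_refl q.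
have pM (x y : int) n : ((x, y) : int * int) *+ n = (x *+ n, y *+ n).
  by elim: n => // n IH; rewrite !mulrS IH.
have [s0|s0] := leP 0 s.
  have := coprime_tri (leqnn _) cop rr tri_base.
  rewrite !pM !mul0rn !natz (_ : _ + _ = (s, t%:Z))//.
  by rewrite -[LHS]/(`|s|%N%:Z + 0, 0 + t%:Z) addr0 add0r gez0_abs.
(* For s < 0 start from the labels (1, 0) and (0, -1), which lead to (-s, -t), a label of the same
   circle. *)
have := coprime_tri (leqnn _) cop (reach_swap i3 rr) (tri_swap3 tri_base).
have nE : - ((0, 1) : int * int) = (0, -1) by [].
rewrite nE !pM !mul0rn mulNrn !natz.
rewrite (_ : _ + _ = (- s, - t%:Z)); last first.
  by rewrite -[LHS]/(`|s|%N%:Z + 0, 0 - t%:Z) addr0 add0r ltz0_abs.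
move=> [w ow [wv lw]]; exists w => //; split => // N.
by rewrite lw /ford_form/= !rmorphN/=; ring.
Qed.

(** The negated discriminant of the binary form [ford_form N], read off from [frame_parseval] for a
    null vector. *)
Lemma ford_disc N : lform N N = 0 ->
  4 * lform (q i1 + v0) N * lform (q i2 + v0) N
  - (lform (q i3 + v0) N - lform (q i1 + v0) N - lform (q i2 + v0) N) ^+ 2
  = 4 * lform v0 N ^+ 2.
Proof.
move=> NN; have := frame_parseval N N fq.
rewrite NN !(big_ord4 _ uq) !lformDl !(lformC N) -/v0 !expr2.
by move: (lform v0 N) (lform (q i1) N) (lform (q i2) N) (lform (q i3) N) => a b c d; lra.
Qed.

(** x + i h is a root s / t of the binary form: x1 is the leading coefficient of its negative, the
    middle coefficient gives x, and [ford_disc] gives h. *)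
Lemma ford_form_lattice N (h x : R) (s : int) (t : nat) : lform N N = 0 ->
  let x1 := - lform (q i1 + v0) N in
  0 < x1 -> - lform v0 N = h * x1 ->
  2 * x1 * x = x1 - lform (q i2 + v0) N + lform (q i3 + v0) N ->
  - ford_form N s%:~R t%:R = x1 * lattice_sqnorm h x s t.
Proof.
move=> NN /= x10 hE xE; have := ford_disc NN.
have -> : lform v0 N ^+ 2 = (h * - lform (q i1 + v0) N) ^+ 2 by rewrite -hE sqrrN.
move: hE xE x10; rewrite /ford_form /lattice_sqnorm.
set a := lform (q i1 + v0) N; set b := lform (q i2 + v0) N; set c := lform (q i3 + v0) N.
move=> _ xE a0 D; apply: (mulfI (_ : - (4 * a) != 0)).
  by rewrite oppr_eq0 mulf_neq0 ?pnatr_eq0// -oppr_eq0 gt_eqF.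
have -> : c = - (2 * a * x) + a + b by move: xE; lra.
have cE : c = - (2 * a * x) + a + b by move: xE; lra.
rewrite cE in D.
have bE : 4 * a * b = 4 * (h * - a) ^+ 2 + (- (2 * a * x)) ^+ 2.
  by move: D; rewrite !expr2; lra.
transitivity (4 * a ^+ 2 * s%:~R ^+ 2 + 4 * a * b * t%:R ^+ 2 - 8 * a ^+ 2 * x * s%:~R * t%:R).
  by ring.
by rewrite bE; ring.
Qed.

End FordLabels.

Section TangentDisks.
Variable R : realType.
Local Notation vec := (vec R).

(** For an orbit vector w, [no_other_circle] rejects [disk (- w)] by [orbit_outside] and accepts
    [disk w] by [orbit_disjoint]. *)
Lemma tangent_disksE (P : set (set (sphere_pt R))) (q : 'I_4 -> vec) (v0 : vec) (p : sphere_pt R) :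
  is_frame q -> future q -> (forall C, P C <-> exists2 v, vorbit q v & C = circ v) ->
  vorbit q v0 ->
  tangent_disks P (circ v0) p <->
  exists w, [/\ vorbit q w, lform w v0 = -1 & 0 < lform w (point_vec p)].
Proof.
move=> fq fu PE ov0; split.
  move=> [C [D [/PE[w ow ->] [p0 T] [/side_of_vec[v [vv Cv ->]] no] pD]]].
  exists w; have wv := orbit_tangent fq ow ov0 T; split => //.
  have [e|e] := circ_inj (orbit_unit fq ow) vv Cv; first by rewrite e.
  have [w' ow' [ne sub]] := orbit_outside fq fu ow.
  by exfalso; apply: (no (circ w') _ ne); [apply/PE; exists w'|rewrite -[v]opprK -e].
move=> [w [ow wv pw]]; exists (circ w), (disk w).
have ww := orbit_unit fq ow.
have nwv : w <> v0 by move=> e; move: wv; rewrite -e ww; lra.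
split => //; first by apply/PE; exists w.
  have [_ /(_ wv) [q' [i [j [rq' ij <- <-]]]]] := orbit_sep fq ow ov0 nwv.
  by have [p0 [? []]] := frame_tangent (reach_frame fq rq') ij; exists p0.
split; first exact: side_of_disk.
move=> C' /PE[w' ow' ->] ne sub.
have nww : w <> w' by move=> e; apply: ne; rewrite e.
have [x xw] : exists x, circ w' x.
  have [x|] := pselect (exists x, circ w' x); first by [].
  move=> nx; have := orbit_unit fq ow' => /is_circle_circ [[z [r [r0 E]]]|[a [b [c [ab E]]]]].
    exfalso; apply: nx; rewrite E; exists (Some (complex.Complex (complex.Re z + r) (complex.Im z))).
    exists (complex.Complex (complex.Re z + r) (complex.Im z)) => //=.
    by rewrite cdistE /= addrAC subrr add0r subrr expr0n addr0 sqrtr_sqr gtr0_norm.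
  by exists None; rewrite E; left.
have := sub x xw; rewrite /disk/= ltNge => /negP; apply.
exact: orbit_disjoint xw.
Qed.

(** For w with label (s, t), the form with N is x1 (h - |t z - s|^2), z = x + i h, so p lies in
    [disk w] exactly when z lies in the Ford disk of s / t. *)
Lemma tangent_disks_farey (P : set (set (sphere_pt R))) (q : 'I_4 -> vec) (i0 i1 i2 i3 : 'I_4)
    (p : sphere_pt R) (h x : R) :
  is_frame q -> future q -> uniq [:: i0; i1; i2; i3] ->
  (forall C, P C <-> exists2 v, vorbit q v & C = circ v) ->
  let N := point_vec p in
  let x1 := - lform (q i1 + q i0) N in
  0 < x1 -> h < 1 -> 0 < h -> - lform (q i0) N = h * x1 ->
  2 * x1 * x = x1 - lform (q i2 + q i0) N + lform (q i3 + q i0) N ->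
  tangent_disks P (circ (q i0)) p <-> farey h 1 x.
Proof.
move=> fq fu uq PE N x1 x10 h1 h0 hE xE.
have ov0 : vorbit q (q i0) by exists q, i0; split => //; exact: reach_refl.
have NN : lform N N = 0 by exact: point_vec_null.
have lat s t := ford_form_lattice fq uq s t NN x10 hE xE.
have key w (s : int) (t : nat) : labelled q i0 i1 i2 i3 w (s, t%:Z) ->
    (0 < lform w N) = (lattice_sqnorm h x s t < h).
  move=> lw; have := lw N; rewrite /= lformDl -pmulrn => e.
  have := lat s t; rewrite -e -/x1 => e'.
  rewrite -[RHS](ltr_pM2l x10) -e' [x1 * h]mulrC -hE; apply/idP/idP; lra.
split.
  move=> /(tangent_disksE _ fq fu PE ov0) [w [ow wv wp]].
  have [[s t] a0 lw] := orbit_label fq uq ow wv.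
  have [s' [t' [lw' a0']]] : exists s' (t' : nat), labelled q i0 i1 i2 i3 w (s', t'%:Z) /\ (s', t'%:Z) != 0.
    have [t0|t0] := leP 0 t; first by exists s, `|t|%N; rewrite gez0_abs.
    exists (- s), `|t|%N; rewrite ltz0_abs//; split.
      by move=> M; rewrite lw /ford_form/= !rmorphN/=; ring.
    by rewrite -[(_, _)]/(- (s, t) : int * int) oppr_eq0.
  move: wp; rewrite (key _ _ _ lw') => L.
  (* Denominator 0 belongs to the half-plane above height 1; h < 1 keeps the point out of it. *)
  have [t0|t0] := posnP t'.
    exfalso; have s0 : s' != 0 by move: a0'; rewrite t0; apply: contra => /eqP ->.
    move: L; rewrite /lattice_sqnorm t0 !mul0r sub0r sqrrN expr0n addr0.
    apply/negP; rewrite -leNgt (le_trans (ltW h1))//.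
    have : (1 <= s' ^+ 2)%R by rewrite expr2; nia.
    by rewrite -(ler_int R) rmorphXn.
  (* The label is only known to be nonzero; dividing by the gcd can only decrease the norm. *)
  have [k [s1 [t1 [k0 t10 cop sE tE]]]] := coprime_reduce s' t0.
  exists s1, t1; split => //; rewrite mul1r; apply: le_lt_trans L.
  rewrite sE tE (_ : lattice_sqnorm h x (k%:Z * s1) (k * t1)%N = k%:R ^+ 2 * lattice_sqnorm h x s1 t1).
    by rewrite ler_peMl ?addr_ge0 ?sqr_ge0// exprn_ege1// ler1n.
  by rewrite /lattice_sqnorm natrM intrM -!pmulrn; ring.
move=> [s [t [t0 cop]]]; rewrite mul1r => L.
have [w ow [wv lw]] := label_orbit fq uq cop.
apply/(tangent_disksE _ fq fu PE ov0); exists w; split => //.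
by rewrite (key _ _ _ lw).
Qed.

End TangentDisks.

(** * Arcs through the tangency point *)

Section Translation.
Variable R : realType.

Lemma measurable_translate (c : R) (A : set R) :
  measurable A -> measurable ((fun x => x + c) @^-1` A : set R).
Proof.
move=> mA; rewrite -[X in measurable X]setTI.
have mf : measurable_fun setT (fun x : R => x + c) by exact: measurable_funD.
exact: mf.
Qed.

Lemma lebesgue_measure_translate (c : R) (A : set R) : measurable A ->
  lebesgue_measure ((fun x => x + c) @^-1` A : set R) = lebesgue_measure A.
Proof.
move=> mA.
have mf : measurable_fun setT ((fun x => x + c) : measurableTypeR R -> measurableTypeR R).
  by exact: measurable_funD.
pose mu := measure_function_pushforward__canonical__measure_function_Measure
  (@lebesgue_measure R) mf.
suff H : forall X, ocitv X -> lebesgue_measure X = mu X.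
  by rewrite (lebesgue_measure_unique H mA).
move=> _ [[a b] _ <-] /=.
rewrite /mu /= /pushforward (_ : _ @^-1` _ = `]a - c, b - c]%classic); last first.
  by apply/seteqP; split => x /=; rewrite !in_itv/=; lra.
rewrite !lebesgue_measure_itv/= !lte_fin ltrD2r; case: ifP => // _.
by rewrite -!EFinB; congr (_%:E); lra.
Qed.

Lemma lebesgue_measure_period (T c : R) (Q : set R) : 0 <= c -> c < T ->
  (forall x, Q (x + T) <-> Q x) -> measurable (Q `&` `]c, c + T[ : set R) ->
  lebesgue_measure ([set t | 0 <= t < T /\ Q t] : set R) =
  lebesgue_measure (Q `&` `]c, c + T[ : set R).
Proof.
move=> c0 cT per mQ.
(* The piece [0, c[ moves by one period onto [T, c + T[, ]c, T[ is common to both windows, and the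
   point c is negligible. *)
pose L := Q `&` `[0, c[; pose M1 := Q `&` `]c, T[; pose M2 := Q `&` `[T, c + T[.
have mM1 : measurable (M1 : set R).
  rewrite (_ : M1 = (Q `&` `]c, c + T[) `&` `]c, T[).
    by apply: measurableI => //; exact: measurable_itv.
  rewrite /M1 -setIA; congr (_ `&` _); apply/seteqP; split => x /=; rewrite !in_itv/=; last by case.
  by move=> /andP[h1 h2]; rewrite h1 h2; split => //; lra.
have mM2 : measurable (M2 : set R).
  rewrite (_ : M2 = (Q `&` `]c, c + T[) `&` `[T, c + T[).
    by apply: measurableI => //; exact: measurable_itv.
  rewrite /M2 -setIA; congr (_ `&` _); apply/seteqP; split => x /=; rewrite !in_itv/=; last by case.
  by move=> /andP[h1 h2]; rewrite h1 h2; split => //; lra.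
have LE : L = (fun x => x + T) @^-1` M2.
  apply/seteqP; split => x; rewrite /L /M2/= !in_itv/= per => -[? ?]; split => //; lra.
have mL : measurable (L : set R) by rewrite LE; exact: measurable_translate.
have mC : measurable (Q `&` [set c] : set R).
  have [qc|qc] := pselect (Q c).
    by rewrite (_ : _ `&` _ = [set c]); [exact: measurable_set1|apply/seteqP; split => x [] // ->].
  by rewrite (_ : _ `&` _ = set0)//; apply/seteqP; split => x [] // + xc; rewrite xc.
have cC : lebesgue_measure (Q `&` [set c] : set R) = 0%E.
  apply/eqP; rewrite eq_le measure_ge0 andbT -(@lebesgue_measure_set1 R c).
  by apply: le_measure; rewrite ?inE//; exact: measurable_set1.
have -> : [set t | 0 <= t < T /\ Q t] = (L `|` (Q `&` [set c])) `|` M1.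
  apply/seteqP; split => x; rewrite /L /M1/= !in_itv/=.
    move=> [/andP[x0 xT] Qx]; have [xc|xc|xc] := ltgtP x c.
    - by left; left; rewrite x0.
    - by right.
    - by left; right.
  move=> [[[Qx /andP[h1 h2]]|[Qx xc]]|[Qx /andP[h1 h2]]]; split => //; last lra.
    by lra.
  by rewrite xc; lra.
have -> : Q `&` `]c, c + T[ = M1 `|` M2.
  apply/seteqP; split => x; rewrite /M1 /M2/= !in_itv/=.
    move=> [Qx /andP[h1 h2]]; have [xT|xT] := ltP x T; [left|right]; split => //.
      by rewrite h1.
  by move=> [[Qx h]|[Qx h]]; split => //; lra.
rewrite measureU//; [|exact: measurableU|]; last first.
  apply/seteqP; split => // x; rewrite /L /M1/= !in_itv/=.
  by move=> [[[_ h1]|[_ ->]] [_ h2]]; lra.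
rewrite measureU//; last first.
  apply/seteqP; split => // x; rewrite /L/= !in_itv/=.
  by move=> [[_ h1] [_ xc]]; move: h1; rewrite xc; lra.
rewrite measureU//; last first.
  apply/seteqP; split => // x; rewrite /M1 /M2/= !in_itv/=.
  by move=> [[_ h1] [_ h2]]; lra.
rewrite [X in (_ + X + _)%E](_ : _ = 0%E); last exact: cC.
rewrite adde0 addeC; congr (_ + _)%E; rewrite LE.
exact: lebesgue_measure_translate.
Qed.
End Translation.

Section CircleCoords.
Variable R : realType.
Local Notation vec := (vec R).

Lemma polar_angle (x y : R) : x ^+ 2 + y ^+ 2 = 1 ->
  exists t, [/\ 0 <= t, t < pi *+ 2, x = cos t & y = sin t].
Proof.
move=> xy; have pi0 := pi_gt0 R.
have x1 : -1 <= x <= 1.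
  have y2 := sqr_ge0 y; apply/andP; split; rewrite leNgt; apply/negP => hx.
    have : 0 < (-1 - x) * (1 - x) by rewrite mulr_gt0//; lra.
    by move: xy y2; rewrite !expr2; lra.
  have : 0 < (x - 1) * (x + 1) by rewrite mulr_gt0//; lra.
  by move: xy y2; rewrite !expr2; lra.
have c := acosK (_ : x \in `[-1, 1]); rewrite in_itv/= x1 in c.
have t0 := acos_ge0 x1; have tpi := acos_lepi x1.
have s : sin (acos x) ^+ 2 = y ^+ 2 by rewrite sin2cos2 c//; lra.
have s0 : 0 <= sin (acos x) by apply: sin_ge0_pi; rewrite t0 tpi.
have sE : sin (acos x) = `|y| by apply/eqP; rewrite -(@eqrXn2 _ 2)// s real_normK// num_real.
have [y0|y0] := leP 0 y.
  exists (acos x); rewrite c// sE ger0_norm//; split => //; rewrite mulr2n; lra.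
exists (pi *+ 2 - acos x); split; rewrite ?mulr2n; [lra| | |].
- have : acos x != 0.
    by apply/eqP => a0; move: sE; rewrite a0 sin0 => /esym/eqP; rewrite normr_eq0 lt_eqF.
  by move: t0; rewrite le_eqVlt eq_sym => /orP[/eqP ->|]; [rewrite eqxx|lra].
- by rewrite -mulr2n addrC cosD2pi cosN c.
- by rewrite -mulr2n addrC sinD2pi sinN sE ltr0_norm// opprK.
Qed.

(** The point of angle t on the circle of radius r that passes through w at the angle f. *)
Definition arc_point (w : R[i]) (r f t : R) : R[i] :=
  complex.Complex (complex.Re w + r * (cos t - cos f)) (complex.Im w + r * (sin t - sin f)).

Lemma lform_arc_point (w : R[i]) r f t :
  lform (point_vec (Some w)) (point_vec (Some (arc_point w r f t))) =
  - (r ^+ 2 * (1 - cos (t - f))).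
Proof.
rewrite /lform/= cosB; have := cos2Dsin2 t; have := cos2Dsin2 f.
move: (cos t) (sin t) (cos f) (sin f) => ct st cf sf ef et.
transitivity (- (r ^+ 2 * ((ct ^+ 2 + st ^+ 2) + (cf ^+ 2 + sf ^+ 2) - 2 * (ct * cf + st * sf)) / 2)).
  by field.
by rewrite ef et; field.
Qed.

(** Both this value and [lform_arc_point] are multiples of 1 - cos (t - f). Their ratio, which gives
    the height h, does not depend on t: the circle becomes a horizontal line. *)
Lemma lform_round_arc (z w : R[i]) r0 r f t : 0 < r0 ->
  complex.Re w = complex.Re z + r0 * cos f -> complex.Im w = complex.Im z + r0 * sin f ->
  lform (round_vec z r0) (point_vec (Some (arc_point w r f t))) =
  - (r * (r - r0) * (1 - cos (t - f)) / r0).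
Proof.
move=> r00 e1 e2; rewrite /lform/= cosB; have := cos2Dsin2 t; have := cos2Dsin2 f.
rewrite e1 e2; move: (cos t) (sin t) (cos f) (sin f) => ct st cf sf ef et.
transitivity ((r0 ^+ 2 - r0 ^+ 2 * (cf ^+ 2 + sf ^+ 2)
   - 2 * r0 * r * (ct * cf + st * sf - (cf ^+ 2 + sf ^+ 2))
   - r ^+ 2 * ((ct ^+ 2 + st ^+ 2) + (cf ^+ 2 + sf ^+ 2) - 2 * (ct * cf + st * sf))) / (2 * r0)).
  by field; rewrite gt_eqF.
by rewrite ef et; field; rewrite gt_eqF.
Qed.

(* [m] is a circle through [w], orthogonal there to the circle of centre [z]: the sign [s]
   tells in which direction it is traversed. *)
Lemma lform_ortho_arc (m : vec) (z w : R[i]) (r0 f : R) : 0 < r0 ->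
  complex.Re w = complex.Re z + r0 * cos f -> complex.Im w = complex.Im z + r0 * sin f ->
  lform m (round_vec z r0) = 0 -> lform m (point_vec (Some w)) = 0 -> lform m m = 4 ->
  exists2 s : R, s = 1 \/ s = -1 & forall r t,
    lform m (point_vec (Some (arc_point w r f t))) =
    2 * s * r * sin (t - f) - m.1.1.1 * (r ^+ 2 * (1 - cos (t - f))).
Proof.
case: m => [[[b x] y] c]; case: z => z1 z2; case: w => w1 w2 r00; rewrite /lform/= => e1 e2.
move=> mz mw mm; have cs := cos2Dsin2 f.
pose X := x - b * w1; pose Y := y - b * w2.
have N : X ^+ 2 + Y ^+ 2 = 4.
  by have := congr1 ( *%R b) mw; move: mm; rewrite /X /Y !expr2; lra.
have mz' : x * z1 + y * z2 - (b * (z1 ^+ 2 + z2 ^+ 2 - r0 ^+ 2) + c) / 2 = 0.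
  rewrite -[RHS](mulr0 r0) -mz; field; rewrite gt_eqF//.
have O : X * cos f + Y * sin f = 0.
  apply: (mulfI (lt0r_neq0 r00)); rewrite mulr0.
  have e1' : r0 * cos f = w1 - z1 by rewrite e1; ring.
  have e2' : r0 * sin f = w2 - z2 by rewrite e2; ring.
  have n : (w1 - z1) ^+ 2 + (w2 - z2) ^+ 2 = r0 ^+ 2.
    by rewrite -e1' -e2' !exprMn -mulrDr cs mulr1.
  transitivity (X * (r0 * cos f) + Y * (r0 * sin f)); first by ring.
  rewrite e1' e2' /X /Y; have := congr1 ( *%R b) n; move: mz' mw; rewrite !expr2; lra.
pose S := Y * cos f - X * sin f.
have S2 : S ^+ 2 = 4.
  have : S ^+ 2 + (X * cos f + Y * sin f) ^+ 2 = (X ^+ 2 + Y ^+ 2) * (cos f ^+ 2 + sin f ^+ 2).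
    by rewrite /S; ring.
  by rewrite O N cs expr0n addr0 mulr1.
have XE : X = - (S * sin f).
  rewrite -[LHS]mulr1 -cs; transitivity (cos f * (X * cos f + Y * sin f) - S * sin f).
    by rewrite /S; ring.
  by rewrite O; ring.
have YE : Y = S * cos f.
  rewrite -[LHS]mulr1 -cs; transitivity (sin f * (X * cos f + Y * sin f) + S * cos f).
    by rewrite /S; ring.
  by rewrite O; ring.
exists (S / 2).
  have /eqP : (S / 2) ^+ 2 = 1 by rewrite expr_div_n S2 expr2; field.
  by rewrite sqrf_eq1 => /orP[] /eqP ->; [left|right].
move=> r t; rewrite cosB sinB; have ct := cos2Dsin2 t.
transitivity (r * (X * (cos t - cos f) + Y * (sin t - sin f))
  - b * (r ^+ 2 * ((cos t ^+ 2 + sin t ^+ 2) + (cos f ^+ 2 + sin f ^+ 2)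
     - 2 * (cos t * cos f + sin t * sin f)) / 2)).
  by rewrite /X /Y; move: mw; rewrite !expr2; lra.
by rewrite ct cs XE YE; field.
Qed.

End CircleCoords.

Section MainFrame.
Variable R : realType.
Local Notation vec := (vec R).

Lemma vorbit_reach (q0 q : 'I_4 -> vec) (v : vec) : reach q0 q -> vorbit q0 v <-> vorbit q v.
Proof.
move=> r; split => -[q' [i [rq' ->]]]; exists q', i; split => //.
  exact: reach_trans (reach_sym r) rq'.
exact: reach_trans r rq'.
Qed.

(** [orbit_sep] puts C0 and C1 in a common frame. With the opposite orientation of C0,
    [orbit_outside] would place a circle of the packing inside the disk, against
    [no_other_circle]. *)
Lemma packing_tangent_frame (P : set (set (sphere_pt R))) (z0 : R[i]) (r0 : R)
    (C1 : set (sphere_pt R)) (p : sphere_pt R) :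
  apollonian_packing P -> 0 < r0 -> P (round_circle z0 r0) ->
  no_other_circle P (round_circle z0 r0) (round_disk z0 r0) -> P C1 ->
  tangent_at p (round_circle z0 r0) C1 ->
  exists q i0 i1 i2 i3, [/\ is_frame q, future q, uniq [:: i0; i1; i2; i3],
    forall C, P C <-> exists2 v, vorbit q v & C = circ v &
    q i0 = round_vec z0 r0 /\ C1 = circ (q i1)].
Proof.
move=> hP r00 PC0 hD0 PC1 T.
have [q0 [f0 fu0 PE0]] := packing_frame hP.
have [v0 ov0 e0] := (PE0 _).1 PC0; have [v1 ov1 e1] := (PE0 _).1 PC1.
rewrite e0 e1 in T; have g := orbit_tangent f0 ov0 ov1 T.
have n01 := tangent_neq (orbit_unit f0 ov0) T.
have [_ /(_ g) [q [i0 [i1 [rq i01 qi0 qi1]]]]] := orbit_sep f0 ov0 ov1 n01.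
have [i2 [i3 uq]] := ord4_others2 i01.
have fq := reach_frame f0 rq; have fu := reach_future f0 fu0 rq.
have PE C : P C <-> exists2 v, vorbit q v & C = circ v.
  split; first by move=> /PE0[v /(vorbit_reach _ rq)]; exists v.
  by move=> [v /(vorbit_reach _ rq) ov ->]; apply/PE0; exists v.
exists q, i0, i1, i2, i3; split => //; split; last by rewrite qi1.
rewrite qi0; move: e0; rewrite round_circleE// => e0.
have [//|e] := circ_inj (round_vec_unit z0 r00) (orbit_unit f0 ov0) e0.
have [w ow [ne sub]] := orbit_outside f0 fu0 ov0.
exfalso; apply: (hD0 (circ w)); first by apply/PE0; exists w.
  by rewrite round_circleE// e0.
by rewrite round_diskE// e.
Qed.

(** Inclusion of the disks bounds the distance d of the centres by e. As w is at distance r0 + e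
    from c, this forces the vector from c to z0 to be e times the unit normal at w. *)
Lemma enclosing_center (z0 w c : R[i]) (r0 e f : R) : 0 < r0 -> 0 < e ->
  complex.Re w = complex.Re z0 + r0 * cos f -> complex.Im w = complex.Im z0 + r0 * sin f ->
  cdist c w = r0 + e -> round_disk z0 r0 `<=` round_disk c (r0 + e) ->
  c = complex.Complex (complex.Re w - (r0 + e) * cos f) (complex.Im w - (r0 + e) * sin f).
Proof.
case: z0 => z1 z2; case: w => w1 w2; case: c => c1 c2 r00 e0 /= e1 e2.
rewrite cdistE/= => D sub; have cs := cos2Dsin2 f.
pose d1 := z1 - c1; pose d2 := z2 - c2; pose d := Num.sqrt (d1 ^+ 2 + d2 ^+ 2).
have d0 : 0 <= d by exact: sqrtr_ge0.
have dd : d ^+ 2 = d1 ^+ 2 + d2 ^+ 2 by rewrite sqr_sqrtr// addr_ge0 ?sqr_ge0.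
have inside x1 x2 : cdist (complex.Complex z1 z2) (complex.Complex x1 x2) < r0 ->
    cdist (complex.Complex c1 c2) (complex.Complex x1 x2) < r0 + e.
  move=> h; have : round_disk (complex.Complex c1 c2) (r0 + e) (Some (complex.Complex x1 x2)).
    by apply: sub; exists (complex.Complex x1 x2).
  by move=> [y /= hy [<-]].
have dr : d < r0 + e.
  by have := inside z1 z2; rewrite !cdistE/= !subrr expr0n addr0 sqrtr0; apply.
have de : d <= e.
  rewrite leNgt; apply/negP => ed; have dp : 0 < d by exact: lt_trans ed.
  (* The point z0 + s (z0 - c) is at distance r0 + e from c and r0 + e - d from z0. If e < d it
     would lie in the small disk but not in the large one. *)
  pose s := (r0 + e - d) / d.
  have s0 : 0 < s by rewrite divr_gt0//; lra.
  have sd : s * d = r0 + e - d by rewrite /s divfK// gt_eqF.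
  have := inside (z1 + s * d1) (z2 + s * d2); rewrite !cdistE/=.
  have -> : (z1 + s * d1 - z1) ^+ 2 + (z2 + s * d2 - z2) ^+ 2 = (s * d) ^+ 2.
    by rewrite exprMn dd; ring.
  have -> : (z1 + s * d1 - c1) ^+ 2 + (z2 + s * d2 - c2) ^+ 2 = (d + s * d) ^+ 2.
    rewrite (_ : d + s * d = (1 + s) * d); last by ring.
    by rewrite exprMn dd /d1 /d2; ring.
  have sd0 : 0 <= s * d by rewrite mulr_ge0// ltW.
  rewrite !sqrtr_sqr (ger0_norm sd0) (ger0_norm (addr_ge0 d0 sd0)) sd => H.
  suff : d + (r0 + e - d) < r0 + e by lra.
  by apply: H; lra.
have N : (r0 * cos f + d1) ^+ 2 + (r0 * sin f + d2) ^+ 2 = (r0 + e) ^+ 2.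
  rewrite -D sqr_sqrtr ?addr_ge0 ?sqr_ge0// e1 e2 /d1 /d2; ring.
have d2e : d ^+ 2 <= e ^+ 2 by rewrite ler_sqr ?nnegrE// ltW.
have dot : r0 * e <= r0 * (cos f * d1 + sin f * d2).
  have : (r0 + e) ^+ 2 = r0 ^+ 2 * (cos f ^+ 2 + sin f ^+ 2) +
      2 * (r0 * (cos f * d1 + sin f * d2)) + d ^+ 2 by rewrite -N dd; ring.
  by rewrite cs; move: d2e; rewrite !expr2; lra.
rewrite ler_pM2l// in dot.
have : (d1 - e * cos f) ^+ 2 + (d2 - e * sin f) ^+ 2 <= 0.
  rewrite (_ : _ + _ = d ^+ 2 - 2 * e * (cos f * d1 + sin f * d2) +
    e ^+ 2 * (cos f ^+ 2 + sin f ^+ 2)); last by rewrite dd; ring.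
  rewrite cs; have := ler_wpM2l (ltW e0) dot; move: d2e; rewrite !expr2; lra.
rewrite le_eqVlt ltNge addr_ge0 ?sqr_ge0// orbF paddr_eq0 ?sqr_ge0// !sqrf_eq0 !subr_eq0.
move=> /andP[/eqP h1 /eqP h2]; rewrite /d1 /d2 in h1 h2.
by congr (complex.Complex _ _); rewrite ?e1 ?e2; move: h1 h2; lra.
Qed.

End MainFrame.

Lemma farey_opp (R : realType) (h r x : R) : farey h r (- x) <-> farey h r x.
Proof.
have key y : farey h r y -> farey h r (- y).
  move=> [p [q [q0 cop L]]]; exists (- p), q; split => //; first by rewrite abszN.
  suff -> : lattice_sqnorm h (- y) (- p) q = lattice_sqnorm h y p q by [].
  by rewrite /lattice_sqnorm rmorphN/=; ring.
by split => /key//; rewrite opprK.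
Qed.

Lemma circle_ptE (R : realType) (w : R[i]) (r f t : R) :
  circle_pt (complex.Complex (complex.Re w - r * cos f) (complex.Im w - r * sin f)) r t =
  arc_point w r f t.
Proof.
case: w => w1 w2; rewrite /circle_pt /arc_point/=.
by congr (complex.Complex _ _) => /=; ring.
Qed.

Theorem theorem2 (R : realType) (P : set (set (sphere_pt R)))
    (z0 : R[i]) (r0 : R) (C1 : set (sphere_pt R)) (w0 : R[i])
    (ctr : R -> R[i])
    (hP : apollonian_packing P)
    (hr0 : 0 < r0)
    (hC0 : P (round_circle z0 r0))
    (hD0 : no_other_circle P (round_circle z0 r0) (round_disk z0 r0))
    (hC1 : P C1)
    (hw0 : tangent_at (Some w0) (round_circle z0 r0) C1)
    (* the last alternative covers an enclosing [C1] of radius exactly [r0 + e] *)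
    (hctr : forall e : R, 0 < e < 1 ->
       [/\ tangent_at (Some w0) (round_circle (ctr e) (r0 + e))
             (round_circle z0 r0),
           tangent_at (Some w0) (round_circle (ctr e) (r0 + e)) C1 \/
             round_circle (ctr e) (r0 + e) = C1
         & round_disk z0 r0 `<=` round_disk (ctr e) (r0 + e)]) :
  arc_prob (ctr e) (r0 + e) (tangent_disks P (round_circle z0 r0))
    @[e --> 0^'+] --> (3 / pi)%:E.
Proof.
have pi0 := pi_gt0 R.
have [q [i0 [i1 [i2 [i3 [fq fu uq PE [q0E C1E]]]]]]] := packing_tangent_frame hP hr0 hC0 hD0 hC1 hw0.
have [i01 i02 i03] : [/\ i0 != i1, i0 != i2 & i0 != i3].
  by move: uq; rewrite /= !inE !negb_or => /and4P[/and3P[]].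
have [i12 i13 i23] : [/\ i1 != i2, i1 != i3 & i2 != i3].
  by move: uq; rewrite /= !inE !negb_or => /and4P[_ /andP[]].
have [p [k [T _ kpos kE]]] := frame_tangent fq i01.
have {kpos} k0 : 0 < k by apply: kpos; exact: fu.
have pw0 : p = Some w0.
  move: T hw0; rewrite /tangent_at q0E -round_circleE// -C1E => ->.
  by move=> e; have : [set p] p by []; rewrite e.
rewrite {}pw0 in T kE.
have w0C : cdist z0 w0 = r0.
  have : (round_circle z0 r0 `&` C1) (Some w0) by rewrite hw0.
  by move=> [[y /= hy [<-]] _].
have [f [f0 fpi cf sf]] : exists f, [/\ 0 <= f, f < pi *+ 2,
    (complex.Re w0 - complex.Re z0) / r0 = cos f & (complex.Im w0 - complex.Im z0) / r0 = sin f].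
  apply: polar_angle; rewrite !expr_div_n -mulrDl.
  move: w0C; rewrite cdistE => /(congr1 (fun x => x ^+ 2)).
  rewrite sqr_sqrtr ?addr_ge0 ?sqr_ge0// => ->.
  by rewrite divff// expf_neq0// gt_eqF.
have e1 : complex.Re w0 = complex.Re z0 + r0 * cos f by rewrite -cf mulrC divfK ?gt_eqF// addrC subrK.
have e2 : complex.Im w0 = complex.Im z0 + r0 * sin f by rewrite -sf mulrC divfK ?gt_eqF// addrC subrK.
(* Being orthogonal to [q i0] and [q i1], m represents a circle through w0 that meets C0 at a right
   angle there. Its pairing supplies the horizontal coordinate; its square is 4, so it is twice a
   unit vector. *)
pose m := q i2 - q i3.
have m1 : lform m (q i0) = 0 by rewrite lformDl lformNl !frame_neq 1?eq_sym//; lra.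
have m2 : lform m (q i1) = 0 by rewrite lformDl lformNl !frame_neq 1?eq_sym//; lra.
have m3 : lform m (point_vec (Some w0)) = 0.
  by apply: (mulfI (lt0r_neq0 k0)); rewrite -kE lformDr m1 m2 addr0 mulr0.
have m4 : lform m m = 4.
  by rewrite !(lformDl, lformDr, lformNl, lformNr) !frame_unit// (lformC (q i3)) frame_neq//; lra.
have m0 : lform m (round_vec z0 r0) = 0 by rewrite -q0E.
have [s ss arcm] := lform_ortho_arc hr0 e1 e2 m0 m3 m4.
(* Read off from x = 1 / 2 - lform m N / (2 x1), with x1 = 2 k (r0 + e)^2 cos^2 (th / 2) and [arcm]
   for the numerator; h is the ratio of [lform_round_arc] to [lform_arc_point], divided by k. *)
pose b := m.1.1.1; pose al := 1 / 2 + b / (2 * k).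
pose be (e : R) := (k * (r0 + e))^-1; pose h (e : R) := e / (r0 * k * (r0 + e)).
(* The coordinate is al + s be tan (th / 2). Multiplying by s makes the slope positive, and
   [farey_opp] allows it. *)
pose F e := farey_measure (s * al) (be e) (h e) 1.
have arcE e : 0 < e -> e < 1 -> h e < 1 ->
    arc_prob (ctr e) (r0 + e) (tangent_disks P (round_circle z0 r0)) = (F e / (pi *+ 2))%:E.
  move=> e_gt0 e_lt1 h1; have re0 : 0 < r0 + e by rewrite addr_gt0.
  have h0 : 0 < h e by rewrite divr_gt0// !mulr_gt0.
  have be0 : 0 < be e by rewrite invr_gt0 mulr_gt0.
  have ctrE : ctr e = complex.Complex (complex.Re w0 - (r0 + e) * cos f) (complex.Im w0 - (r0 + e) * sin f).
    have [|T1 _ sub] := hctr e; first by rewrite e_gt0.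
    apply: (enclosing_center hr0 e_gt0 e1 e2) => //.
    have : (round_circle (ctr e) (r0 + e) `&` round_circle z0 r0) (Some w0) by rewrite T1.
    by move=> [[y /= hy [<-]] _].
  pose Q : set R := [set t | tangent_disks P (round_circle z0 r0) (Some (circle_pt (ctr e) (r0 + e) t))].
  (* The shift by f + pi places the tangency point w0, at angle f, at the pole th = - pi of the
     coordinate. *)
  have QE th : - pi < th < pi -> Q (th + (f + pi)) <-> farey (h e) 1 (tan_param (s * al) (be e) th).
    move=> thI; rewrite /Q/= ctrE circle_ptE.
    have c2 : 0 < cos (th / 2) by apply: cos_gt0_pihalf; lra.
    have thE : th = (th / 2) *+ 2 by rewrite mulr2n; lra.
    have ang : th + (f + pi) - f = th + pi by ring.
    pose N := point_vec (Some (arc_point w0 (r0 + e) f (th + (f + pi)))).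
    have cE : 1 - cos (th + (f + pi) - f) = 2 * cos (th / 2) ^+ 2.
      by rewrite ang cosDpi opprK {1}thE cos_mulr2n mulr2n; ring.
    have sE : sin (th + (f + pi) - f) = - (2 * cos (th / 2) * sin (th / 2)).
      by rewrite ang sinDpi {1}thE sin_mulr2n mulr2n; ring.
    have x1E : - lform (q i1 + q i0) N = k * ((r0 + e) ^+ 2 * (2 * cos (th / 2) ^+ 2)).
      by rewrite lformC addrC kE lformC lform_arc_point cE; ring.
    have x10 : 0 < - lform (q i1 + q i0) N by rewrite x1E !mulr_gt0 ?exprn_gt0.
    have hE : - lform (q i0) N = h e * - lform (q i1 + q i0) N.
      rewrite x1E q0E (lform_round_arc _ _ hr0 e1 e2) cE /h.
      by field; rewrite !gt_eqF.
    pose x := al + s * be e * tan (th / 2).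
    have xE : 2 * - lform (q i1 + q i0) N * x =
        - lform (q i1 + q i0) N - lform (q i2 + q i0) N + lform (q i3 + q i0) N.
      have -> : - lform (q i1 + q i0) N - lform (q i2 + q i0) N + lform (q i3 + q i0) N =
          - lform (q i1 + q i0) N - lform m N by rewrite /m !lformDl lformNl; ring.
      rewrite x1E arcm cE sE /x /al /be /tan -/b; field.
      by rewrite !gt_eqF.
    rewrite round_circleE// -q0E (tangent_disks_farey fq fu uq PE x10 h1 h0 hE xE).
    have -> : tan_param (s * al) (be e) th = s * x.
      have s2 : s * s = 1 by case: ss => ->; rewrite ?mulrNN mulr1.
      transitivity (s * al + s * s * (be e * tan (th / 2))); first by rewrite s2 mul1r.
      by rewrite /x; ring.
    by case: ss => ->; rewrite ?mul1r// mulN1r farey_opp.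
  have QI : Q `&` `]f, f + pi *+ 2[ =
      (fun x => x + - (f + pi)) @^-1` tan_pre (s * al) (be e) (farey (h e) 1).
    apply/seteqP; split => t; rewrite /tan_pre/= !in_itv/= mulr2n.
      move=> [Qt tI]; have thI : - pi < t - (f + pi) < pi by lra.
      by split => //; apply/QE => //; rewrite subrK.
    move=> [thI]; move/(QE _ thI); rewrite subrK => Qt; split => //; lra.
  have mF : measurable (tan_pre (s * al) (be e) (farey (h e) 1) : set R) by exact: measurable_farey.
  rewrite /arc_prob; have -> : [set t | 0 <= t < pi *+ 2 /\
      tangent_disks P (round_circle z0 r0) (Some (circle_pt (ctr e) (r0 + e) t))] =
      [set t | 0 <= t < pi *+ 2 /\ Q t] by [].
  rewrite (@lebesgue_measure_period R (pi *+ 2) f Q f0 fpi).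
  - rewrite QI lebesgue_measure_translate// /F /farey_measure EFinM fineK//.
    exact: tan_pre_fin_num.
  - by move=> t; rewrite /Q/= /circle_pt cosD2pi sinD2pi.
  - by rewrite QI; exact: measurable_translate.
have near0 (d : R) : 0 < d -> \forall e \near 0^'+, 0 < e /\ e < d.
  move=> d0; near=> e; split; [near: e; exact: nbhs_right_gt|near: e; exact: nbhs_right_lt].
have hpos e : 0 < e -> 0 < h e by move=> e0; rewrite divr_gt0// !mulr_gt0// addr_gt0.
have hle e : 0 < e -> h e <= e / (r0 * k * r0).
  move=> e0; rewrite ler_pM2l// lef_pV2 ?posrE ?mulr_gt0 ?addr_gt0//.
  by rewrite ler_pM2l ?mulr_gt0// lerDl ltW.
have rk : 0 < r0 * k * r0 by rewrite !mulr_gt0.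
have hsmall (d : R) : 0 < d -> \forall e \near 0^'+, [/\ 0 < e, e < 1 & h e < d].
  move=> d0; have := near0 (Num.min 1 (d * (r0 * k * r0))).
  rewrite lt_min ltr01 mulr_gt0// => /(_ isT); apply: filterS => e [e0].
  rewrite lt_min => /andP[e1' e2']; split => //.
  by apply: (le_lt_trans (hle e e0)); rewrite ltr_pdivrMr.
have Fcvg : F e @[e --> 0^'+] --> (6 : R).
  (* For e < 1 the width [be e] stays above its value at e = 1, which serves as the lower bound. *)
  apply: (@farey_measure_cvg R R (0^'+) _ (fun=> s * al) be h (k * (r0 + 1))^-1).
  - by rewrite invr_gt0 mulr_gt0// addr_gt0.
  - have := near0 1 ltr01; apply: filterS => e [e0 e1'].
    rewrite lef_pV2 ?posrE ?mulr_gt0 ?addr_gt0// ler_pM2l// lerD2l ltW//.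
  - by have := near0 1 ltr01; apply: filterS => e [e0 _]; exact: hpos.
  - apply/cvgrPdist_le => d d0; have := hsmall d d0; apply: filterS => e [e0 _ hd].
    by rewrite sub0r normrN gtr0_norm ?hpos// ltW.
apply: (@cvg_trans _ ((F e / (pi *+ 2))%:E @[e --> 0^'+])).
  apply: near_eq_cvg; have := hsmall 1 ltr01; apply: filterS => e [e0 e1' hd].
  by rewrite arcE.
have -> : 3 / pi = 6 / (pi *+ 2) :> R.
  have -> : 6 = 3 * 2 :> R by ring.
  by rewrite -[pi *+ 2]mulr_natr -mulf_div divff ?mulr1.
apply: cvg_EFin; first by near=> e.
by apply: cvgMl.
Unshelve. all: by end_near. Qed.
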